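(* Let $\Gamma=\Gamma_5$ be the Fermat curve $x^6+y^6+z^6=0$ in characteristic $5$, with automorphism group $\mathrm{PGU}_3(\mathbb{F}_{25})$, and let $\mathcal{D}$ be the set of connected components of the graph $G$ on the set $\mathcal{Q}$ of non-singular conics totally tangent to $\Gamma$. Fix $D\in\mathcal{D}$, let $\mathcal{C}_i$ be (the vertex set of) the connected component of the graph $H$ containing $D$, and let $\mathcal{C}_j$ and $\mathcal{C}_k$ be the other two connected components. Put $\mathcal{N}_D:=\{D'\in\mathcal{D}\mid D'\neq D,\ T(D,D')=\beta^{21}\}$, which is the disjoint union of $\mathcal{N}_D\cap\mathcal{C}_j$ and $\mathcal{N}_D\cap\mathcal{C}_k$. Fixing an identification $\mathrm{stab}(D)\cong\mathfrak{A}_7$ (given by the action on $D\cong T(7)$) and interchanging $j$ and $k$ if necessary, we have the following: for any $D'\in\mathcal{N}_D$, $$D'\in\mathcal{N}_D\cap\mathcal{C}_j\iff \mathrm{stab}(D)\cap\mathrm{stab}(D')\text{ is conjugate in }\mathfrak{A}_7\text{ to }\Sigma_b,$$ $$D'\in\mathcal{N}_D\cap\mathcal{C}_k\iff \mathrm{stab}(D)\cap\mathrm{stab}(D')\text{ is conjugate in }\mathfrak{A}_7\text{ to }\Sigma_b'.$$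
   Context: Work over an algebraically closed field of characteristic $5$. $\Gamma=\Gamma_5\subset\mathbb{P}^2$ is the curve $x^6+y^6+z^6=0$; its automorphism group (the group of projective transformations of $\mathbb{P}^2$ preserving $\Gamma$) is $\mathrm{PGU}_3(\mathbb{F}_{25})$, of order $378000$. $\mathcal{P}$ denotes the set of Weierstrass points of $\Gamma$; equivalently, the set of $\mathbb{F}_{25}$-rational points of $\Gamma_5$; $|\mathcal{P}|=126$. A line of $\mathbb{P}^2$ is a special secant line of $\Gamma$ if it passes through two distinct points of $\mathcal{P}$. A non-singular conic $Q\subset\mathbb{P}^2$ is totally tangent to $\Gamma$ if $Q$ meets $\Gamma$ at six distinct points, each with intersection multiplicity $2$. $\mathcal{Q}$ denotes the set of all such conics; one has $|\mathcal{Q}|=3150$ and $Q\cap\Gamma\subset\mathcal{P}$ for $Q\in\mathcal{Q}$. For $Q\in\mathcal{Q}$, $\mathcal{S}(Q)$ is the set of the $15$ special secant lines of $\Gamma$ passing through two distinct points of $Q\cap\Gamma$. $G$ is the graph with vertex set $\mathcal{Q}$ in which distinct $Q,Q'$ are adjacent if and only if $|Q\cap Q'|=4$ and $|\mathcal{S}(Q)\cap\mathcal{S}(Q')|=3$. $\mathcal{D}$ is the set of connected components of $G$ (there are $150$ of them); each $D\in\mathcal{D}$ is regarded as a subset of $\mathcal{Q}$ ($21$ conics), and as a graph it is isomorphic to the triangular graph $T(7)$ (vertices: unordered pairs of distinct elements of $\{1,\dots,7\}$; distinct pairs adjacent iff they meet), with $\mathrm{Aut}(T(7))\cong\mathfrak{S}_7$.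 For $Q\in\mathcal{Q}$ and $D'\in\mathcal{D}$ with $Q\notin D'$, the type $t(Q,D')\in\{\alpha,\beta,\gamma\}$ is defined by the values of $|Q\cap Q'\cap\Gamma|$ as $Q'$ runs over the $21$ conics of $D'$: $t(Q,D')=\alpha$ if the value is $2$ for $3$ conics and $0$ for $18$; $t(Q,D')=\beta$ if it is $2$ for $1$ conic, $1$ for $4$ conics and $0$ for $16$; $t(Q,D')=\gamma$ if it is $1$ for $6$ conics and $0$ for $15$. (One of these three cases always occurs.) For distinct $D,D'\in\mathcal{D}$, the type $T(D,D')$ is: $\beta^{21}$ if $t(Q,D')=\beta$ for all $Q\in D$; $\gamma^{21}$ if $t(Q,D')=\gamma$ for all $Q\in D$; $\alpha^{15}\gamma^{6}$ if $t(Q,D')=\alpha$ for $15$ conics $Q\in D$ and $\gamma$ for the other $6$; $\alpha^{3}\gamma^{18}$ if $t(Q,D')=\alpha$ for $3$ conics $Q\in D$ and $\gamma$ for the other $18$. (One of these four cases always occurs, and $T(D,D')=T(D',D)$.) $H$ is the graph with vertex set $\mathcal{D}$ in which distinct $D,D'$ are adjacent if and only if $T(D,D')=\alpha^{15}\gamma^{6}$. It has exactly three connected components, with vertex sets $\mathcal{C}_1,\mathcal{C}_2,\mathcal{C}_3$ of size $50$ each. $\mathrm{stab}(D)$ is the stabilizer of $D$ in $\mathrm{PGU}_3(\mathbb{F}_{25})$. Its action on $D\cong T(7)$ is faithful with image $\mathfrak{A}_7\subset\mathfrak{S}_7\cong\mathrm{Aut}(T(7))$; this identifies $\mathrm{stab}(D)$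 with $\mathfrak{A}_7$, uniquely up to conjugation by elements of $\mathfrak{S}_7$. Let $\rho:\mathbb{P}^2(\mathbb{F}_2)\to\{1,\dots,7\}$ be the bijection $(a:b:c)\mapsto 4a+2b+c$ ($a,b,c\in\{0,1\}$), and let $\rho'$ be the composite of $\rho$ and the transposition $(67)$. The action of $\mathrm{PSL}_3(\mathbb{F}_2)$ on $\mathbb{P}^2(\mathbb{F}_2)$ gives, via $\rho$ and $\rho'$, two faithful permutation representations $\mathrm{PSL}_3(\mathbb{F}_2)\hookrightarrow\mathfrak{S}_7$; their images, which are contained in $\mathfrak{A}_7$ and have order $168$, are $\Sigma_b$ and $\Sigma_b'$ respectively. They are conjugate in $\mathfrak{S}_7$ but not in $\mathfrak{A}_7$. *)

(* Defs.v *)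
From HB Require Import structures.
From Stdlib Require Import Relations.
From mathcomp Require Import all_boot all_order all_algebra all_fingroup.
From mathcomp Require Import all_solvable.
From mathcomp Require Import fraction mpoly.
From mathcomp Require Import boolp classical_sets functions cardinality.

Set Implicit Arguments.
Unset Strict Implicit.
Unset Printing Implicit Defensive.

Import GRing.Theory.
Local Open Scope ring_scope.
Local Open Scope classical_set_scope.

Definition has_card (T : Type) (A : set T) (n : nat) : Prop :=
  (A #= `I_n)%card.

(* A graph is given by its vertex set [V] and a relation [e] that is only
   meaningful between distinct vertices. *)
Definition adjacent (T : Type) (V : set T) (e : T -> T -> Prop) (x y : T) :=
  [/\ V x, V y, x <> y & e x y].

Definition components (T : Type) (V : set T) (e : T -> T -> Prop) :
    set (set T) :=
  [set C | exists2 x, V x &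
     C = [set y | clos_refl_sym_trans T (adjacent V e) x y]].

Section Plane.
Variable F : fieldType.

(* Points and lines of P^2 are the subspaces of F^3 of dimension 1 and 2, so
   that equality of points (or lines) is Leibniz equality. *)
Definition proj_point := {U : {vspace 'rV[F]_3} | \dim U == 1%N}.
Definition proj_line := {U : {vspace 'rV[F]_3} | \dim U == 2%N}.

Definition on_line (P : proj_point) (L : proj_line) : Prop :=
  (val P <= val L)%VS.

(* To be used for homogeneous [f] only. *)
Definition vanishes (f : {mpoly F[3]}) (P : proj_point) : Prop :=
  forall v : 'rV[F]_3, v \in val P -> f.@[fun i => v 0 i] = 0.

Definition zeros (f : {mpoly F[3]}) : set proj_point := [set P | vanishes f P].

(* The local ring of P^2 at P: fractions a/b of forms of the same degree with
   b not vanishing at P. *)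
Definition local_ring (P : proj_point) : set {fraction {mpoly F[3]}} :=
  [set u | exists (d : nat) (a b : {mpoly F[3]}),
     [/\ a \is d.-homog, b \is d.-homog, ~ vanishes b P
       & u = tofrac a / tofrac b]].

(* The ideal of [local_ring P] generated by a local equation of the curve
   f = 0. *)
Definition local_ideal (f : {mpoly F[3]}) (P : proj_point) :
    set {fraction {mpoly F[3]}} :=
  [set u | exists (d : nat) (a b : {mpoly F[3]}),
     [/\ a * f \is d.-homog, b \is d.-homog, ~ vanishes b P
       & u = tofrac (a * f) / tofrac b]].

(* The quotient of [local_ring P] by the sum of the ideals of f = 0 and g = 0
   has a basis [e] of [n] elements over F, that is, dimension [n]. *)
Definition intersection_multiplicity (f g : {mpoly F[3]}) (P : proj_point)
    (n : nat) : Prop :=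
  exists e : 'I_n -> {fraction {mpoly F[3]}},
    (forall i, local_ring P (e i)) /\
    forall u, local_ring P u ->
      exists! c : 'rV[F]_n, exists v w,
        [/\ local_ideal f P v, local_ideal g P w
          & u = \sum_(i < n) tofrac ((c 0 i)%:MP) * e i + v + w].

Definition projectivity (g : proj_point -> proj_point) : Prop :=
  exists2 h : 'End('rV[F]_3), lker h == 0%VS
    & forall P, val (g P) = (h @: val P)%VS.

Definition nonsingular (f : {mpoly F[3]}) : Prop :=
  forall P : proj_point,
    vanishes f P -> ~ (forall i : 'I_3, vanishes f^`M(i) P).

Definition fermat : {mpoly F[3]} := \sum_(i < 3) 'X_i ^+ 6.

Definition Gamma : set proj_point := zeros fermat.

Definition Aut_Gamma : set (proj_point -> proj_point) :=
  [set g | projectivity g /\ g @` Gamma = Gamma].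

(* The F_25-rational points of Gamma: F_25 consists of the roots of
   x^25 = x. *)
Definition calP : set proj_point :=
  [set P | Gamma P /\ exists v : 'rV[F]_3,
     [/\ v != 0, v \in val P & forall i, v 0 i ^+ 25 = v 0 i]].

Definition special_secant (L : proj_line) : Prop :=
  exists P P', [/\ calP P, calP P', P <> P', on_line P L & on_line P' L].

(* Conics are handled as sets of points; a non-singular conic determines its
   quadratic form up to a scalar. *)
Definition calQ : set (set proj_point) :=
  [set Q | exists q : {mpoly F[3]},
     [/\ q \is 2.-homog, nonsingular q, Q = zeros q, has_card (Q `&` Gamma) 6
       & forall P, (Q `&` Gamma) P ->
           intersection_multiplicity q fermat P 2]].

Definition calS (Q : set proj_point) : set proj_line :=
  [set L | special_secant L /\
     exists P P', [/\ (Q `&` Gamma) P, (Q `&` Gamma) P', P <> P',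
                      on_line P L & on_line P' L]].

Definition G_rel (Q Q' : set proj_point) : Prop :=
  has_card (Q `&` Q') 4 /\ has_card (calS Q `&` calS Q') 3.

Definition G_adj := adjacent calQ G_rel.

Definition calD : set (set (set proj_point)) := components calQ G_rel.

Inductive conic_type := Alpha | Beta | Gam.

Definition meet_count (Q : set proj_point) (D' : set (set proj_point))
    (m n : nat) :=
  has_card [set Q' | D' Q' /\ has_card (Q `&` Q' `&` Gamma) m] n.

(* t(Q, D') = tau *)
Definition t_is (Q : set proj_point) (D' : set (set proj_point))
    (tau : conic_type) :=
  match tau with
  | Alpha => meet_count Q D' 2 3 /\ meet_count Q D' 0 18
  | Beta => [/\ meet_count Q D' 2 1, meet_count Q D' 1 4
              & meet_count Q D' 0 16]
  | Gam => meet_count Q D' 1 6 /\ meet_count Q D' 0 15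
  end.

Inductive component_type := Beta21 | Gam21 | Alpha15Gam6 | Alpha3Gam18.

Definition type_count (D D' : set (set proj_point)) (tau : conic_type)
    (n : nat) :=
  has_card [set Q | D Q /\ t_is Q D' tau] n.

(* T(D, D') = tau *)
Definition T_is (D D' : set (set proj_point)) (tau : component_type) :=
  match tau with
  | Beta21 => forall Q, D Q -> t_is Q D' Beta
  | Gam21 => forall Q, D Q -> t_is Q D' Gam
  | Alpha15Gam6 => type_count D D' Alpha 15 /\ type_count D D' Gam 6
  | Alpha3Gam18 => type_count D D' Alpha 3 /\ type_count D D' Gam 18
  end.

Definition H_rel (D D' : set (set proj_point)) : Prop := T_is D D' Alpha15Gam6.

Definition H_components : set (set (set (set proj_point))) :=
  components calD H_rel.

Definition calN (D : set (set proj_point)) : set (set (set proj_point)) :=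
  [set D' | [/\ calD D', D' <> D & T_is D D' Beta21]].

Definition stab (D : set (set proj_point)) : set (proj_point -> proj_point) :=
  [set g | Aut_Gamma g /\ [set g @` Q | Q in D] = D].

(* The vertices of T(7) are the 2-subsets of 'I_7; the label k in 1..7 is
   represented by k - 1. *)
Definition T7_vertices : set {set 'I_7} :=
  [set e : {set 'I_7} | #|e| == 2%N].

Definition T7_adj :=
  adjacent T7_vertices (fun e e' : {set 'I_7} => e :&: e' != finset.set0).

(* [theta] is a graph isomorphism from T(7) to D, seen as a subgraph of G
   (its values outside the vertices of T(7) are irrelevant). *)
Definition T7_isomorphism (D : set (set proj_point))
    (theta : {set 'I_7} -> set proj_point) : Prop :=
  set_bij T7_vertices D theta /\
  forall e e', T7_vertices e -> T7_vertices e' ->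
    (T7_adj e e' <-> G_adj (theta e) (theta e')).

(* The image in the symmetric group of a subgroup [K] of [stab D] under the
   identification given by the labelling [theta] of D by T(7). *)
Definition perm_image (theta : {set 'I_7} -> set proj_point)
    (K : set (proj_point -> proj_point)) : {set 'S_7} :=
  [set s : 'S_7 | `[< exists2 g, K g &
     forall e, T7_vertices e -> g @` theta e = theta (s @: e) >] ]%SET.

End Plane.

(* Points of P^2(F_2) are represented by the nonzero vectors of F_2^3; the
   value k of the map is represented by k - 1 in 'I_7. *)
Definition rho (v : 'rV['F_2]_3) : 'I_7 :=
  inord (4 * v 0%R (inord 0) + 2 * v 0%R (inord 1) + v 0%R (inord 2)).-1%N.

Definition rho' (v : 'rV['F_2]_3) : 'I_7 :=
  tperm (inord 5) (inord 6) (rho v).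

(* The image of PSL_3(F_2) under the action on P^2(F_2), transported by [r];
   over F_2 scalar matrices of determinant 1 are trivial. *)
Definition Sigma_of (r : 'rV['F_2]_3 -> 'I_7) : {set 'S_7} :=
  [set s : 'S_7 | [exists A : 'M['F_2]_3, (\det A == 1) &&
     [forall v : 'rV['F_2]_3, (v != 0) ==> (s (r v) == r (v *m A))]]]%SET.

Definition Sigma_b : {set 'S_7} := Sigma_of rho.
Definition Sigma_b' : {set 'S_7} := Sigma_of rho'.

Definition conj_in_Alt7 (A B : {set 'S_7}) : Prop :=
  exists2 s : 'S_7, s \in ('Alt_('I_7))%g & A = (B :^ s)%g.

(* Main.v *)
(* Write h(x, y) = sum x_i y_i^5, so that the curve is h(v, v) = 0. Segre: a
   totally tangent conic is {a + t b + t^2 c} for a basis in which h has the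
   matrix antidiag(1, -2, 1), since h restricts to such a conic as the square
   of t^5 - t; it is tangent to the curve at the points with t in P^1(F_5). So
   the conics form one orbit of the unitary group, which is defined over F_25,
   and a conic is determined by its six rational points. Outside its component
   a conic sharing three special secants with a given one is bitangent to it:
   their pencil contains a double line, hence they meet in at most two points.
   The components of G are thus the 150 translates of one copy of T(7), the
   components of H are told apart by counting modulo 3 a generator of
   determinant outside the cubes, and for D' in N_D the numbers
   |Q /\ Q' /\ Gamma| define a Fano plane on the seven labels, whose group is
   stab(D) /\ stab(D'). The two groups Sigma_b, Sigma_b' are exchanged by a
   transposition and are their own normalizers in S_7, so that the parity of
   the change of labelling, an element of S_7 = Aut(T(7)), decides which of the
   two components of H goes with Sigma_b. *)

Require Import Defs.
From HB Require Import structures.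
From Stdlib Require Import Relations PArith NArith FMapPositive.
From mathcomp Require Import all_boot all_order all_algebra all_fingroup.
From mathcomp Require Import all_solvable.
From mathcomp Require Import fraction mpoly ring zify.
From mathcomp Require Import boolp classical_sets cardinality.

Set Implicit Arguments.
Unset Strict Implicit.
Unset Printing Implicit Defensive.

(** * The unitary group over the field with 25 elements *)

(** The obstacle is that the statement quantifies over sets of points of an arbitrary closed field
    and over all projectivities preserving Gamma, while the facts about 3150 conics are finite
    checks. Conics are therefore encoded by lists of point numbers and components by words in five
    generators. The words come from unverified searches; boolean checks then validate what is used
    of them, and equivariance under the unitary group reduces each question to one base conic, one
    base component and seven orbit representatives. The joint stabilizer is bounded from both sides.
    Any projectivity preserving Gamma preserves the numbers |Q /\ Q' /\ Gamma|, hence permutes the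
    labels by collineations of the plane; conversely, words in the generators realise all 168
    collineations. Seen from the base component, N_D consists of the orbits of cosets 67 and 125.
    They have classes 1 and 2 modulo 3, and their planes differ by the transposition of the labels 5
    and 6. As the stabilizer acts by even permutations, class and parity are thereby tied
    together. *)

HB.instance Definition _ := hasDecEq.Build positive Pos.eqb_spec.

Inductive f5 := E0 | E1 | E2 | E3 | E4.

Definition nat_of_f5 x := match x with E0 => 0 | E1 => 1 | E2 => 2 | E3 => 3 | E4 => 4 end.
Definition succ5 x := match x with E0 => E1 | E1 => E2 | E2 => E3 | E3 => E4 | E4 => E0 end.
Definition opp5 x := match x with E0 => E0 | E1 => E4 | E2 => E3 | E3 => E2 | E4 => E1 end.
Definition dbl5 x := match x with E0 => E0 | E1 => E2 | E2 => E4 | E3 => E1 | E4 => E3 end.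
Definition inv5 x := match x with E0 => E0 | E1 => E1 | E2 => E3 | E3 => E2 | E4 => E4 end.
Definition add5 x y := match x with
  | E0 => y | E1 => succ5 y | E2 => succ5 (succ5 y)
  | E3 => succ5 (succ5 (succ5 y)) | E4 => succ5 (succ5 (succ5 (succ5 y))) end.
Definition mul5 x y := match x with
  | E0 => E0 | E1 => y | E2 => dbl5 y | E3 => opp5 (dbl5 y) | E4 => opp5 y end.
Definition eq5 x y := match x, y with
  | E0, E0 | E1, E1 | E2, E2 | E3, E3 | E4, E4 => true | _, _ => false end.

Lemma nat_of_f5K : cancel nat_of_f5 (nth E0 [:: E0; E1; E2; E3; E4]).
Proof. by case. Qed.
HB.instance Definition _ := Equality.copy f5 (can_type nat_of_f5K).

(* [(a, b)] stands for a + b r with r^2 = 2. *)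
Notation f25 := (f5 * f5)%type.

Definition zero25 : f25 := (E0, E0).
Definition one25 : f25 := (E1, E0).
Definition add25 (x y : f25) : f25 :=
  let (a, b) := x in let (c, d) := y in (add5 a c, add5 b d).
Definition opp25 (x : f25) : f25 := let (a, b) := x in (opp5 a, opp5 b).
Definition mul25 (x y : f25) : f25 :=
  let (a, b) := x in let (c, d) := y in
  (add5 (mul5 a c) (dbl5 (mul5 b d)), add5 (mul5 a d) (mul5 b c)).
(** The Frobenius map: r^5 = r (r^2)^2 = 4 r = -r. Accordingly [norm25] is x^6, the value of the
    Hermitian form on one coordinate. *)
Definition conj25 (x : f25) : f25 := let (a, b) := x in (a, opp5 b).
Definition norm25 (x : f25) : f5 :=
  let (a, b) := x in add5 (mul5 a a) (opp5 (dbl5 (mul5 b b))).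
Definition inv25 (x : f25) : f25 :=
  let n := inv5 (norm25 x) in let (a, b) := conj25 x in (mul5 n a, mul5 n b).
Definition eq25 (x y : f25) : bool :=
  let (a, b) := x in let (c, d) := y in eq5 a c && eq5 b d.

Definition vec := (f25 * f25 * f25)%type.
Definition scale25 c (v : vec) : vec :=
  let: (x, y, z) := v in (mul25 c x, mul25 c y, mul25 c z).
Definition addv (u v : vec) : vec :=
  let: (x, y, z) := u in let: (x', y', z') := v in (add25 x x', add25 y y', add25 z z').
Definition conjv (v : vec) : vec := let: (x, y, z) := v in (conj25 x, conj25 y, conj25 z).
Definition dot (u v : vec) : f25 :=
  let: (x, y, z) := u in let: (x', y', z') := v in
  add25 (mul25 x x') (add25 (mul25 y y') (mul25 z z')).
Definition eqv (u v : vec) : bool :=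
  let: (x, y, z) := u in let: (x', y', z') := v in [&& eq25 x x', eq25 y y' & eq25 z z'].
Definition normalize (v : vec) : vec :=
  let: (x, y, z) := v in
  if ~~ eq25 x zero25 then scale25 (inv25 x) v
  else if ~~ eq25 y zero25 then scale25 (inv25 y) v else scale25 (inv25 z) v.

Definition mat := (vec * vec * vec)%type.
Definition mulvm (v : vec) (M : mat) : vec :=
  let: (x, y, z) := v in let: (a, b, c) := M in
  addv (scale25 x a) (addv (scale25 y b) (scale25 z c)).
Definition mulmm (M N : mat) : mat :=
  let: (a, b, c) := M in (mulvm a N, mulvm b N, mulvm c N).
Definition trm (M : mat) : mat :=
  let: ((a, b, c), (a', b', c'), (a'', b'', c'')) := M in
  ((a, a', a''), (b, b', b''), (c, c', c'')).
Definition conjm (M : mat) : mat := let: (a, b, c) := M in (conjv a, conjv b, conjv c).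
Definition eqm (M N : mat) : bool :=
  let: (a, b, c) := M in let: (a', b', c') := N in [&& eqv a a', eqv b b' & eqv c c'].
Definition idm : mat :=
  ((one25, zero25, zero25), (zero25, one25, zero25), (zero25, zero25, one25)).

Definition f5s := [:: E0; E1; E2; E3; E4].
Definition f25s : seq f25 := [seq (a, b) | a <- f5s, b <- f5s].

(* The normalized isotropic vectors of the Hermitian form, that is the 126
   rational points of the Fermat sextic; they are numbered from 1. *)
Definition isotropic : seq vec :=
  [seq (zero25, one25, z) | z <- f25s & eq5 (norm25 z) E4] ++
  [seq v <- [seq (one25, y, z) | y <- f25s, z <- f25s] |
    let: (_, y, z) := v in eq5 (add5 (norm25 y) (norm25 z)) E4].

Definition point := positive.
Definition points : seq point := Eval vm_compute in [seq Pos.of_nat i | i <- iota 1 126].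
Definition coord_map : PositiveMap.t vec := Eval vm_compute in
  foldl (fun t (iv : point * vec) => PositiveMap.add iv.1 iv.2 t)
    (@PositiveMap.empty _) (zip points isotropic).
Definition coord (i : point) : vec :=
  if PositiveMap.find i coord_map is Some v then v else (one25, one25, one25).

(** Three bits per coefficient turn a vector into a key of the binary tries. *)
Definition push5 (x : f5) (p : positive) : positive := match x with
  | E0 => p~0~0~0 | E1 => p~0~0~1 | E2 => p~0~1~0 | E3 => p~0~1~1 | E4 => p~1~0~0 end%positive.
Definition push25 (x : f25) p := let (a, b) := x in push5 a (push5 b p).
Definition key (v : vec) : positive :=
  let: (x, y, z) := v in push25 x (push25 y (push25 z xH)).
Definition index_map : PositiveMap.t point := Eval vm_compute in
  foldl (fun t (iv : point * vec) => PositiveMap.add (key iv.2) iv.1 t)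
    (@PositiveMap.empty _) (zip points isotropic).
Definition index_of (v : vec) : point :=
  if PositiveMap.find (key (normalize v)) index_map is Some i then i else xH.

(* Generators of PGU_3(F_25): [Ga, Gb, Gc] generate the stabilizer of the
   component containing the conic of [base_frame]; [Gt] is a generator of the
   pointwise stabilizer of two points of the curve and [Gu] a unipotent element
   fixing one of them. *)
Inductive gen := Ga | Gb | Gc | Gt | Gu.
Definition gen_code g := match g with Ga => 0 | Gb => 1 | Gc => 2 | Gt => 3 | Gu => 4 end.
Lemma gen_codeK : cancel gen_code (nth Ga [:: Ga; Gb; Gc; Gt; Gu]).
Proof. by case. Qed.
HB.instance Definition _ := Equality.copy gen (can_type gen_codeK).
Definition gens := [:: Ga; Gb; Gc; Gt; Gu].
Definition word := seq gen.

(* The code 5 a + b stands for a + b r. *)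
Definition decode25 n : f25 := (nth E0 f5s (n %/ 5), nth E0 f5s (n %% 5)).
Definition decode_mat (l : seq nat) : mat :=
  let e i := decode25 (nth 0 l i) in
  ((e 0, e 1, e 2), (e 3, e 4, e 5), (e 6, e 7, e 8)).
Definition gen_mat (g : gen) : mat := Eval vm_compute in match g with
  | Ga => decode_mat [:: 23; 12; 2; 16; 13; 7; 18; 15; 5]
  | Gb => decode_mat [:: 24; 3; 0; 16; 24; 0; 0; 0; 12]
  | Gc => decode_mat [:: 10; 13; 12; 19; 3; 16; 0; 8; 1]
  | Gt => decode_mat [:: 23; 1; 0; 8; 23; 0; 0; 0; 5]
  | Gu => decode_mat [:: 10; 6; 1; 9; 0; 16; 1; 11; 5]
  end.
(** Orders of the matrices themselves, not only modulo scalars, so that a power of a generator is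
    its exact inverse in [winv]. *)
Definition gen_order g := match g with Ga | Gc => 7 | Gb => 3 | Gt => 24 | Gu => 5 end.
Definition base_frame : mat := Eval vm_compute in
  decode_mat [:: 0; 5; 6; 22; 0; 0; 0; 19; 1].

Definition action_map (M : mat) : PositiveMap.t point :=
  foldl (fun t (iv : point * vec) => PositiveMap.add iv.1 (index_of (mulvm iv.2 M)) t)
    (@PositiveMap.empty _) (zip points isotropic).
Definition gen_map (g : gen) : PositiveMap.t point := Eval vm_compute in match g with
  | Ga => action_map (gen_mat Ga) | Gb => action_map (gen_mat Gb)
  | Gc => action_map (gen_mat Gc) | Gt => action_map (gen_mat Gt)
  | Gu => action_map (gen_mat Gu) end.
Definition gen_act (i : point) (g : gen) : point :=
  if PositiveMap.find i (gen_map g) is Some j then j else i.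
Definition word_act (w : word) (i : point) : point := foldl gen_act i w.

(* [all] and [has] with early exit under call-by-value evaluation. *)
Fixpoint every (T : Type) (p : pred T) s := if s is x :: s' then if p x then every p s' else false else true.
Fixpoint some (T : Type) (p : pred T) s := if s is x :: s' then if p x then true else some p s' else false.

Lemma everyE (T : Type) (p : pred T) s : every p s = all p s.
Proof. by elim: s => //= x s ->. Qed.

Lemma someE (T : Type) (p : pred T) s : some p s = has p s.
Proof. by elim: s => //= x s ->. Qed.

(* Breadth-first orbit enumeration; each element comes with a word reaching it
   from the start. Only its output is used, never its correctness. *)
Section Orbit.
Variables (T : Type) (eqT : T -> T -> bool) (act : T -> gen -> T) (gs : seq gen).
Fixpoint bfs n (todo seen : seq (T * word)) :=
  if n is n'.+1 then
    let visit x acc g :=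
      let e := (act x.1 g, rcons x.2 g) in
      if some (fun y => eqT y.1 e.1) acc.1 then acc else (rcons acc.1 e, rcons acc.2 e) in
    let next := foldl (fun acc x => foldl (visit x) acc gs) (seen, [::]) todo in
    bfs n' next.2 next.1
  else seen.
Definition orbit_words n x := bfs n [:: (x, [::])] [:: (x, [::])].
End Orbit.

Definition pmem (i : positive) (s : seq positive) := some (Pos.eqb i) s.

Lemma pmemE i s : pmem i s = (i \in s).
Proof. by rewrite /pmem someE; elim: s => //= j s IH; rewrite in_cons -IH. Qed.

Lemma pmem_map (T : Type) (p : pred T) (f : T -> positive) s i :
  all p s -> pmem i (map f s) -> exists2 w, p w & f w = i.
Proof.
rewrite /pmem someE; elim: s => //= w s IH /andP [pw ps] /orP [/Pos.eqb_spec ->|].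
  by exists w.
exact: IH.
Qed.

(* Two points whose joint stabilizer is generated by [Gt], with eigenvalues
   [zeta] and [zeta ^ -5]. *)
Definition pole1 : point := 43%positive.
Definition pole2 : point := 126%positive.
Definition zeta25 : f25 := decode25 7.
Definition zeta25' : f25 := decode25 14.

Definition pole_words := Eval vm_compute in
  map snd (orbit_words Pos.eqb gen_act gens 126 pole1).
Definition pole_stab_words := Eval vm_compute in
  map snd (orbit_words Pos.eqb gen_act [:: Gt; Gu] 126 pole2).

(** Double transitivity on the 126 points. With the cyclic group of order 24 generated by [Gt], this
    accounts for the whole group, as 126 * 125 * 24 = 378000. *)
Definition poles_ok :=
  [&& let s := [seq word_act w pole1 | w <- pole_words] in all (fun i => pmem i s) points,
      all (fun w => Pos.eqb (word_act w pole1) pole1) pole_stab_words &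
      let s := [seq word_act w pole2 | w <- pole_stab_words] in
      all (fun i => Pos.eqb i pole1 || pmem i s) points].

Lemma poles_okP : poles_ok.
Proof. by vm_compute. Qed.

Definition pow25 x n := iter n (mul25 x) one25.

(** An isometry fixing both poles is, after scaling, diagonal with eigenvalues x, x^(-5), 1 on the
    poles and the third basis vector. Since [zeta25] generates the multiplicative group of the
    field, it is a power of [Gt]. *)
Definition torus_ok :=
  [&& eqv (mulvm (coord pole1) (gen_mat Gt)) (scale25 zeta25 (coord pole1)),
      eqv (mulvm (coord pole2) (gen_mat Gt)) (scale25 zeta25' (coord pole2)),
      eqv (mulvm (zero25, zero25, one25) (gen_mat Gt)) (zero25, zero25, one25),
      eq25 (mul25 (pow25 zeta25 5) zeta25') one25 &
      all (fun x => eq25 x zero25 || has (fun k => eq25 x (pow25 zeta25 k)) (iota 0 24)) f25s].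

Lemma torus_okP : torus_ok.
Proof. by vm_compute. Qed.

(** * Conics and components as sets of rational points *)

Definition psub (s t : seq point) := all (fun i => pmem i t) s.

Definition param_point (A : mat) (t : f25) : vec :=
  let: (a, b, c) := A in addv a (addv (scale25 t b) (scale25 (mul25 t t) c)).
Definition base_code : seq point := Eval vm_compute in
  rcons [seq index_of (param_point base_frame (n, E0)) | n <- f5s] (index_of base_frame.2).

(** As [E3] is -2, this is antidiag(1, -2, 1). *)
Definition frame_gram : mat :=
  ((zero25, zero25, one25), (zero25, (E3, E0), zero25), (one25, zero25, zero25)).
Definition frame_gram_inv : mat :=
  ((zero25, zero25, one25), (zero25, (E2, E0), zero25), (one25, zero25, zero25)).
Definition base_ok :=
  [&& eqm (mulmm base_frame (trm (conjm base_frame))) frame_gram,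
      eqm (mulmm frame_gram frame_gram_inv) idm,
      uniq base_code, psub base_code points,
      eqv (coord (index_of base_frame.2)) (normalize base_frame.2) &
      all (fun n => let v := param_point base_frame (n, E0) in
        eqv (coord (index_of v)) (normalize v)) f5s].
Lemma base_okP : base_ok.
Proof. by vm_compute. Qed.

(* Permutations of {0, ..., 6} induced on the base component, a triangular
   graph; the base conic is the pair {0, 1}. *)
Definition gen_perm (g : gen) : seq nat := match g with
  | Ga => [:: 3; 2; 6; 5; 1; 4; 0]
  | Gb => [:: 0; 5; 6; 2; 1; 4; 3]
  | Gc => [:: 2; 3; 5; 4; 6; 1; 0]
  | _ => iota 0 7 end.
Definition stab_gens := [:: Ga; Gb; Gc].
Definition perm_word (w : word) (x : nat) : nat := foldl (fun x g => nth 0 (gen_perm g) x) x w.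

Definition pairs := [seq p <- [seq (a, b) | a <- iota 0 7, b <- iota 0 7] | p.1 < p.2].

Definition block_words : seq (nat * nat * word) := Eval vm_compute in
  orbit_words (fun p q => (p.1 == q.1) && (p.2 == q.2))
   (fun p g => let a := nth 0 (gen_perm g) p.1 in let b := nth 0 (gen_perm g) p.2 in
     (minn a b, maxn a b)) stab_gens 21 (0, 1).
Definition block_word (a b : nat) : word :=
  let p := (minn a b, maxn a b) in
  if [seq x.2 | x <- block_words & (x.1.1 == p.1) && (x.1.2 == p.2)] is w :: _ then w else [::].
Definition block_table : seq (seq (seq point)) := Eval vm_compute in
  [seq [seq if a == b then [::] else map (word_act (block_word a b)) base_code | b <- iota 0 7] | a <- iota 0 7].
Definition block a b := nth [::] (nth [::] block_table a) b.

(** Inclusion of blocks is enough: conics whose point lists are included in one another coincide, by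
    [hascode_sub]. *)
Definition blocks_ok :=
  all (fun a => all (fun b => (a == b) ||
    [&& (block a b == map (word_act (block_word a b)) base_code) &
        all (fun g => psub (map (gen_act^~ g) (block a b))
               (block (nth 0 (gen_perm g) a) (nth 0 (gen_perm g) b))) stab_gens])
    (iota 0 7)) (iota 0 7).

Lemma blocks_okP : blocks_ok.
Proof. by vm_compute. Qed.

Definition label_list (w : word) : seq (point * (nat * nat)) :=
  flatten [seq [seq (word_act w i, p) | i <- block p.1 p.2] | p <- pairs].
(** The 21 conics of a component are disjoint on the curve and 21 * 6 = 126, so a rational point has
    exactly one label. A conic lies in the component as soon as its six points have the same
    label. *)
Definition label_map (w : word) : PositiveMap.t (nat * nat) :=
  foldr (fun ip t => PositiveMap.add ip.1 ip.2 t) (@PositiveMap.empty _) (label_list w).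
Definition same_label (t : PositiveMap.t (nat * nat)) (s : seq point) : bool :=
  if s is i :: s' then
    if PositiveMap.find i t is Some p then
      every (fun j => if PositiveMap.find j t is Some q then (p.1 == q.1) && (p.2 == q.2) else false) s'
    else false
  else false.

(* Representatives of the images of the base component, each stored with its
   label map while searching. *)
Definition coset_words : seq word := Eval vm_compute in
  [seq x.1.2 | x <- orbit_words
     (fun x y => every (fun p => same_label x.1 (map (word_act y.2) (block p.1 p.2))) pairs)
     (fun x g => let w := rcons x.2 g in (label_map w, w)) gens 10 (label_map [::], [::])].
Definition coset i := nth [::] coset_words i.

Definition coset_table (g : gen) : seq nat :=
  let maps := map label_map coset_words in
  [seq find (fun t => every (fun p => same_label t (map (word_act (rcons w g)) (block p.1 p.2))) pairs) maps
    | w <- coset_words].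
Definition coset_tables : seq (seq nat) := Eval vm_compute in map coset_table gens.
Definition coset_act (i : nat) (g : gen) : nat := nth 0 (nth [::] coset_tables (gen_code g)) i.

(** The 150 words are closed under the generators modulo the stabilizer of the base component. With
    [unitary_word] this bounds the number of components by 150. *)
Definition coset_act_ok :=
  let maps := map label_map coset_words in
  all (fun g => all (fun i => let j := coset_act i g in (j < 150) &&
    let t := nth (@PositiveMap.empty _) maps j in
    all (fun p => same_label t (map (word_act (rcons (coset i) g)) (block p.1 p.2))) pairs)
    (iota 0 150)) gens.
Lemma coset_act_okP : coset_act_ok.
Proof. by vm_compute. Qed.

(** * Secant lines and neighbours of the base conic, computed on codes *)

Definition word_mat (w : word) : mat := foldl (fun M g => mulmm M (gen_mat g)) idm w.
Definition cross (u v : vec) : vec :=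
  let: (x, y, z) := u in let: (x', y', z') := v in
  let d a b c e := add25 (mul25 a b) (opp25 (mul25 c e)) in
  (d y z' z y', d z x' x z', d x y' y x').
Definition secant (i j : point) : seq point :=
  j :: [seq index_of (addv (coord i) (scale25 t (coord j))) | t <- f25s &
    let v := addv (coord i) (scale25 t (coord j)) in eq25 (dot v (conjv v)) zero25].
Definition base_pairs : seq (point * point) :=
  [seq (nth xH base_code p.1, nth xH base_code p.2) | p <- [seq p <- [seq (a, b) | a <- iota 0 6, b <- iota 0 6] | p.1 < p.2]].
Definition base_secants : seq (seq point) := [seq secant p.1 p.2 | p <- base_pairs].
(** A listed point is exhibited as a combination of the two given points; any other point is
    rejected because the normal vector [n] of the line does not annihilate it. The last clause says
    that the 15 pairs give 15 different lines, so counting pairs is counting lines. *)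
Definition secants_ok :=
  all (fun p => let s := secant p.1 p.2 in let n := cross (coord p.1) (coord p.2) in
    [&& eq25 (dot n (coord p.1)) zero25, eq25 (dot n (coord p.2)) zero25,
        pmem p.1 s && pmem p.2 s,
        all (fun k => if pmem k s then
           eqv (coord k) (coord p.2) || some (fun t =>
             eqv (coord k) (normalize (addv (coord p.1) (scale25 t (coord p.2))))) f25s
         else ~~ eq25 (dot n (coord k)) zero25) points &
        all (fun q => (p == q) || ~~ (pmem q.1 s && pmem q.2 s)) base_pairs]) base_pairs.
Lemma secants_okP : secants_ok.
Proof. by vm_compute. Qed.

Definition pset (s : seq point) : PositiveMap.t unit :=
  foldr (fun i t => PositiveMap.add i tt t) (@PositiveMap.empty _) s.
Definition base_secant_sets : seq (PositiveMap.t unit) := Eval vm_compute in map pset base_secants.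
Lemma base_secant_setsE : base_secant_sets = [seq pset (secant p.1 p.2) | p <- base_pairs].
Proof. by vm_compute. Qed.
Definition shared_secants (s : seq point) : nat :=
  count (fun t => 1 < count (fun i => if PositiveMap.find i t is Some _ then true else false) s) base_secant_sets.

(** Symmetric matrix of the quadratic form 2 (h(v, c) h(v, a) + h(v, b)^2), which is an equation of
    the conic with frame (a, b, c) by [hframe_conic]. *)
Definition gram (A : mat) : mat :=
  let: (a, b, c) := conjm A in
  let: (c0, c1, c2) := c in let: (a0, a1, a2) := a in let: (b0, b1, b2) := b in
  let two := (E2, E0) in
  let e x y z x' y' z' := add25 (mul25 z x') (add25 (mul25 x z') (mul25 two (mul25 y y'))) in
  ((e a0 b0 c0 a0 b0 c0, e a0 b0 c0 a1 b1 c1, e a0 b0 c0 a2 b2 c2),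
   (e a1 b1 c1 a0 b0 c0, e a1 b1 c1 a1 b1 c1, e a1 b1 c1 a2 b2 c2),
   (e a2 b2 c2 a0 b0 c0, e a2 b2 c2 a1 b1 c1, e a2 b2 c2 a2 b2 c2)).
Definition entries (M : mat) : seq (seq f25) :=
  let: ((a, b, c), (a', b', c'), (a'', b'', c'')) := M in
  [:: [:: a; b; c]; [:: a'; b'; c']; [:: a''; b''; c'']].
Definition entry (M : mat) i j := nth zero25 (nth [::] (entries M) i) j.
Definition rank_one (M : mat) : bool :=
  has (fun i => ~~ eq25 (entry M i i) zero25 &&
    all (fun j => all (fun k => eq25 (mul25 (entry M i i) (entry M j k)) (mul25 (entry M i j) (entry M i k)))
      (iota 0 3)) (iota 0 3)) (iota 0 3).
(** A member [M + c N] of the pencil of two quadratic forms; as [c] runs through the field, its sign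
    does not matter. *)
Definition subm (M N : mat) c : mat :=
  let: (m1, m2, m3) := M in let: (n1, n2, n3) := N in
  (addv m1 (scale25 c n1), addv m2 (scale25 c n2), addv m3 (scale25 c n3)).
Definition bitangent (w : word) : bool :=
  let M := gram (mulmm base_frame (word_mat w)) in let N := gram base_frame in
  some (fun c => rank_one (subm M N c)) f25s.

Definition disjoint01 a b := [&& a != 0, a != 1, b != 0 & b != 1].

(** A candidate with three common secants is either a pair of the base component meeting {0, 1} or
    bitangent to the base conic. Pairs of the base component disjoint from {0, 1} are among the
    conics tested. *)
Definition neighbours_ok :=
  all (fun i => all (fun p =>
    let w := block_word p.1 p.2 ++ coset i in
    if (i == 0) && ~~ disjoint01 p.1 p.2 then true
    else if shared_secants (map (word_act (coset i)) (block p.1 p.2)) != 3 then true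
    else bitangent w) pairs) (iota 0 150).
Lemma neighbours_okP : neighbours_ok.
Proof. by vm_compute. Qed.

Definition conic_value (A : mat) (v : vec) : f25 :=
  let: (a, b, c) := conjm A in
  add25 (mul25 (dot v c) (dot v a)) (mul25 (dot v b) (dot v b)).
(** One adjacency is computed, that of the pairs {0, 1} and {0, 2}: the common points are four
    finite parameters of the base conic, all in F_25, and the point at infinity of its
    parametrization is not common. All other adjacencies in the base component are images of this
    one. *)
Definition adjacent_ok :=
  let A := mulmm base_frame (word_mat (block_word 0 2)) in
  [&& shared_secants (block 0 2) == 3, ~~ eq25 (conic_value A base_frame.2) zero25 &
    count (fun t => eq25 (conic_value A (param_point base_frame t)) zero25) f25s == 4].

Definition triple_words : seq word := Eval vm_compute in map snd (orbit_words eq_op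
  (fun x g => let: (a, b, c) := x in
    (nth 0 (gen_perm g) a, nth 0 (gen_perm g) b, nth 0 (gen_perm g) c)) stab_gens 210 (0, 1, 2)).
(** Two pairs {a, b}, {a, c} with one common label amount to an ordered triple of labels.
    Transitivity on the 210 triples therefore carries one adjacency to all edges of T(7). *)
Definition triples_ok :=
  all (fun w => all (mem stab_gens) w) triple_words &&
  let s := [seq (perm_word w 0, perm_word w 1, perm_word w 2) | w <- triple_words] in
  all (fun a => all (fun b => all (fun c => [|| a == b, a == c, b == c | (a, b, c) \in s])
    (iota 0 7)) (iota 0 7)) (iota 0 7).
Lemma triples_okP : triples_ok.
Proof. by vm_compute. Qed.

Lemma adjacent_okP : adjacent_ok.
Proof. by vm_compute. Qed.

(** * Types, classes and orbits of the 150 components, computed on codes *)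

Definition meet_number (s t : seq point) := count (fun i => pmem i t) s.

Definition coset_block (i : nat) (p : nat * nat) := map (word_act (coset i)) (block p.1 p.2).
Definition profile (i : nat) (p : nat * nat) (m : nat) : nat :=
  count (fun q => meet_number (block p.1 p.2) (coset_block i q) == m) pairs.
Definition profile_type (p : nat -> nat) (tau : conic_type) := match tau with
  | Alpha => (p 2 == 3) && (p 0 == 18)
  | Beta => [&& p 2 == 1, p 1 == 4 & p 0 == 16]
  | Gam => (p 1 == 6) && (p 0 == 15) end.
Definition type_number (i : nat) (tau : conic_type) := count (fun p => profile_type (profile i p) tau) pairs.
Definition coset_class (i : nat) := count (fun g => if g is Gt then true else false) (coset i) %% 3.

(* Representatives of the orbits of the stabilizer of the base component. *)
Definition orbit_reps := [:: 0; 1; 2; 6; 67; 106; 125].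
Definition types_ok :=
  all (fun i => [&& all (fun p => profile_type (profile i p) Beta) pairs == (i \in [:: 67; 125]) &
    (type_number i Alpha == 15) && (type_number i Gam == 6) == (i == 106)]) orbit_reps.
Lemma types_okP : types_ok.
Proof. by vm_compute. Qed.

Definition coset_move (i : nat) (w : word) := foldl coset_act i w.
Definition orbit_table : seq (nat * nat * word) := Eval vm_compute in
  flatten [seq [seq (x.1, i, x.2) | x <- orbit_words eqn coset_act stab_gens 20 i] | i <- orbit_reps].
Definition orbits_ok :=
  all (fun x => [&& x.1.2 \in orbit_reps, all (mem stab_gens) x.2 & coset_move x.1.2 x.2 == x.1.1]) orbit_table &&
  all (fun i => i \in map (fun x => x.1.1) orbit_table) (iota 0 150).
Lemma orbits_okP : orbits_ok.
Proof. by vm_compute. Qed.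

(** [coset_class] is read off from a chosen word; this check makes it an invariant of the component,
    since each generator shifts it by a constant modulo 3. *)
Definition classes_ok :=
  all (fun i => all (fun g => coset_class (coset_act i g) ==
    (coset_class i + if g is Gt then 1 else 0) %% 3) gens) (iota 0 150).
Lemma classes_okP : classes_ok.
Proof. by vm_compute. Qed.

(** Components are equal once they share a conic, so it suffices to find the base conic in none of
    the other 149. *)
Definition base_separated :=
  all (fun i => all (fun p => ~~ psub base_code (coset_block i p)) pairs) (iota 1 149).
Lemma base_separatedP : base_separated.
Proof. by vm_compute. Qed.

Definition blocks_separated :=
  all (fun p => all (fun q => (p == q) || ~~ psub (block p.1 p.2) (block q.1 q.2)) pairs) pairs.
Lemma blocks_separatedP : blocks_separated.
Proof. by vm_compute. Qed.

(* A step of a walk in the first class: [Gt] stands for the word of coset 106,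
   which takes the base component to a neighbour. *)
Definition walk_act (i : nat) (g : gen) := if g is Gt then coset_move i (coset 106) else coset_act i g.
Definition walks : seq (nat * word) := Eval vm_compute in orbit_words eqn walk_act [:: Ga; Gb; Gc; Gt] 50 0.
Definition walks_ok :=
  all (fun x => (foldl walk_act 0 x.2 == x.1) && all (mem [:: Ga; Gb; Gc; Gt]) x.2) walks &&
  all (fun i => (coset_class i != 0) || (i \in map fst walks)) (iota 0 150).
Lemma walks_okP : walks_ok.
Proof. by vm_compute. Qed.

(* The labels of the points of P^2(F_2) are one less than their binary codes. *)
Definition xor (a b : nat) : nat := N.to_nat (N.lxor (N.of_nat a) (N.of_nat b)).
Definition third_table : seq (seq nat) := Eval vm_compute in
  [seq [seq (xor a.+1 b.+1).-1 | b <- iota 0 7] | a <- iota 0 7].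
Definition third (a b : nat) : nat := nth 0 (nth [::] third_table a) b.
Definition swap56 (a : nat) : nat := if a == 5 then 6 else if a == 6 then 5 else a.
Definition third' (a b : nat) : nat := swap56 (third (swap56 a) (swap56 b)).

(** How intersection numbers produce a plane on the labels: p is linked to q when a conic of
    component i meets p once and q twice on the curve. The third point of the line through the two
    labels of p is the one label outside p that belongs to no pair linked to p. *)
Definition linked_pairs (i : nat) (p : nat * nat) :=
  [seq q <- pairs | some (fun y => meet_number (block q.1 q.2) (coset_block i y) == 2)
    [seq y <- pairs | meet_number (block p.1 p.2) (coset_block i y) == 1]].
Definition plane_words (gs : seq gen) : seq word := map snd (orbit_words eq_op
  (fun x g => let: (a, b, c) := x in
    (nth 0 (gen_perm g) a, nth 0 (gen_perm g) b, nth 0 (gen_perm g) c)) gs 168 (0, 1, 3)).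
(** The labels 0, 1, 3 have binary codes 1, 2, 4, a triangle of the plane, and the remaining labels
    are obtained from it by third points. A collineation is thus determined by the image of this
    triangle; since words in [gs] reach all 7 * 6 * 4 = 168 triangles, they exhaust the
    collineations. *)
Definition plane_ok (i : nat) (gs : seq gen) (T : nat -> nat -> nat) (ws : seq word) :=
  [&& (T 0 1 == 2) && all (fun c => c \in [:: 0; 1; 2; 3; T 0 3; T 1 3; T 2 3]) (iota 0 7),
   all (fun g => (coset_act i g == i) && (g \in stab_gens)) gs,
   all (fun g => all (fun a => all (fun b => (a == b) ||
      (nth 0 (gen_perm g) (T a b) == T (nth 0 (gen_perm g) a) (nth 0 (gen_perm g) b))) (iota 0 7)) (iota 0 7)) gs,
   all (all (mem gs)) ws,
   (let s := [seq (perm_word w 0, perm_word w 1, perm_word w 3) | w <- ws] in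
    all (fun a => all (fun b => all (fun c => [|| a == b, a == c, b == c, T a b == c | (a, b, c) \in s])
      (iota 0 7)) (iota 0 7)) (iota 0 7)) &
   all (fun p => let l := linked_pairs i p in
     all (fun x => ((x == T p.1 p.2) == [&& x != p.1, x != p.2 & all (fun q => (x != q.1) && (x != q.2)) l]) &&
       (T p.1 p.2 == T p.2 p.1)) (iota 0 7)) pairs].
Definition plane_words_j : seq word := Eval vm_compute in plane_words [:: Ga; Gb].
Definition plane_words_k : seq word := Eval vm_compute in plane_words [:: Gb; Gc].
Lemma plane_j : plane_ok 67 [:: Ga; Gb] third plane_words_j.
Proof. by vm_compute. Qed.
Lemma plane_k : plane_ok 125 [:: Gb; Gc] third' plane_words_k.
Proof. by vm_compute. Qed.

(* In the group of the plane, the stabilizer of two points fixes only the third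
   point of their line. *)
Definition moved_ok :=
  let ps := [seq [seq perm_word w x | x <- iota 0 7] | w <- plane_words_j] in
  all (fun a => all (fun b => (a == b) || (let qs := [seq l <- ps | (nth 0 l a == a) && (nth 0 l b == b)] in
    all (fun x => [|| x == a, x == b, x == third a b | some (fun l => nth 0 l x != x) qs]) (iota 0 7))) (iota 0 7)) (iota 0 7).
Lemma moved_okP : moved_ok.
Proof. by vm_compute. Qed.

Import GRing.Theory.
Local Open Scope ring_scope.
Local Open Scope classical_set_scope.

(** * Forms restricted to a conic *)

Lemma mnm_decomp (F : fieldType) (d : nat) (m : 'X_{1..3}) : mdeg m = d.+1 ->
  exists i (m' : 'X_{1..3}), mdeg m' = d /\ 'X_[m] = 'X_[m'] * 'X_i :> {mpoly F[3]}.
Proof.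
move=> dm; have [i mi] : exists i, (0 < m i)%N.
  apply/existsP; apply: contraPT dm; rewrite negb_exists => /forallP h.
  have -> : m = 0%MM.
    by apply/mnmP => i; rewrite mnm0E; apply/eqP; rewrite -leqn0 leqNgt h.
  by rewrite mdeg0.
have e : m = (m - U_(i) + U_(i))%MM.
  apply/mnmP => k; rewrite mnmDE mnmBE mnm1E.
  by case: eqP => [<-|]; lia.
exists i, (m - U_(i))%MM; split; last by rewrite {1}e mpolyXD.
by move: dm; rewrite {1}e mdegD mdeg1 addn1 => -[].
Qed.

Section NormalForm.
Variables (F : fieldType) (A : 'M[F]_3).
Hypothesis uA : A \in unitmx.

(** The linear forms dual to the rows of [A]: on the point a + t b + t^2 c the form [ell j] takes
    the value t^j. *)
Definition ell (j : 'I_3) : {mpoly F[3]} := \sum_i (invmx A) i j *: 'X_i.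

Definition conic_form : {mpoly F[3]} := ell 0 * ell 2%:R - ell 1 ^+ 2.

Definition param (t : F) : 'rV[F]_3 := \row_i \sum_j A j i * t ^+ j.

Definition restr : {mpoly F[3]} -> {poly F} :=
  mmap (@polyC F) (fun i => \sum_j (A j i)%:P * 'X^j).

HB.instance Definition _ := GRing.RMorphism.on restr.

Lemma restrZ c a : restr (c *: a) = c%:P * restr a.
Proof. exact: mmapZ. Qed.

Lemma restrX i : restr 'X_i = \sum_j (A j i)%:P * 'X^j.
Proof. by rewrite /restr mmapX mmap1U. Qed.

Lemma horner_restr a t : (restr a).[t] = a.@[fun i => param t 0 i].
Proof.
rewrite /restr /mmap mevalE horner_sum; apply: eq_bigr => m _.
rewrite hornerM hornerC; congr (_ * _); rewrite horner_prod.
apply: eq_bigr => i _; rewrite horner_exp; congr (_ ^+ _).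
rewrite /param mxE horner_sum; apply: eq_bigr => j _.
by rewrite hornerM hornerC hornerXn.
Qed.

Lemma X_ell i : 'X_i = \sum_j A j i *: ell j.
Proof.
transitivity (\sum_k (invmx A *m A) k i *: ('X_k : {mpoly F[3]})).
  rewrite mulVmx // (bigD1 i) //= big1 ?addr0 => [|k /negPf nki]; rewrite mxE.
    by rewrite eqxx scale1r.
  by rewrite nki scale0r.
rewrite /ell; under [RHS]eq_bigr do rewrite scaler_sumr.
rewrite exchange_big /=; apply: eq_bigr => k _.
rewrite mxE scaler_suml; apply: eq_bigr => j _.
by rewrite scalerA mulrC.
Qed.

Lemma restr_ell j : restr (ell j) = 'X^j.
Proof.
rewrite /ell rmorph_sum /=.
transitivity (\sum_k ((A *m invmx A) k j)%:P * ('X^k : {poly F})).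
  under eq_bigr do rewrite restrZ restrX mulr_sumr.
  rewrite exchange_big /=; apply: eq_bigr => k _.
  rewrite mxE rmorph_sum mulr_suml; apply: eq_bigr => i _.
  by rewrite /= polyCM; ring.
rewrite mulmxV // (bigD1 j) //= big1 ?addr0 => [|k /negPf nkj]; rewrite mxE.
  by rewrite eqxx mul1r.
by rewrite nkj mul0r.
Qed.

Lemma restr_conic_form : restr conic_form = 0.
Proof.
by rewrite /conic_form rmorphB rmorphM rmorphXn /= !restr_ell -exprD -exprM subrr.
Qed.

Lemma dhomogU (i : 'I_3) : ('X_i : {mpoly F[3]}) \is 1.-homog.
Proof. by rewrite dhomogX /= mdeg1. Qed.

Lemma ell_homog j : ell j \is 1.-homog.
Proof. by apply: rpred_sum => i _; apply: dhomogZ; exact: dhomogU. Qed.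

Lemma dhomogXn (a : {mpoly F[3]}) n : a \is 1.-homog -> a ^+ n \is n.-homog.
Proof. by move=> /(dhomogMn n); rewrite mul1n. Qed.

Lemma conic_form_homog : conic_form \is 2.-homog.
Proof.
apply: rpredB; last exact/dhomogXn/ell_homog.
by rewrite -[2%N]/(1 + 1)%N; apply: dhomogM; apply: ell_homog.
Qed.

(* The normal monomial of degree [d] restricting to [t ^ k] on the conic. *)
Definition normal_mon (d k : nat) : {mpoly F[3]} :=
  ell 0 ^+ (d - uphalf k) * ell 1 ^+ odd k * ell 2%:R ^+ k./2.

Lemma normal_mon_homog d k : (k <= d.*2)%N -> normal_mon d k \is d.-homog.
Proof.
move=> kd; have {2}-> : d = ((d - uphalf k) + odd k + k./2)%N.
  by move: (odd_double_half k); rewrite uphalf_half; lia.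
by do 2?[apply: dhomogM]; apply/dhomogXn/ell_homog.
Qed.

Lemma restr_normal_mon d k : restr (normal_mon d k) = 'X^k.
Proof.
rewrite /normal_mon !rmorphM !rmorphXn /= !restr_ell -!exprM -!exprD.
congr ('X^_); rewrite -[LHS]/(0 * (d - uphalf k) + 1 * odd k + 2 * k./2)%N.
by rewrite mul0n mul1n mul2n odd_double_half.
Qed.

(** Multiplying a monomial that already contains [ell 1] by [ell 1] creates a square, which is
    replaced by [ell 0 * ell 2] minus the conic form; in all other cases the product is already
    normal. *)
Lemma normal_monM d k (j : 'I_3) : (k <= d.*2)%N ->
  exists b, normal_mon d k * ell j = normal_mon d.+1 (k + j) + b * conic_form.
Proof.
move=> kd; have hk := odd_double_half k; have hu := uphalf_half k.
have [] : [\/ j = 0, j = 1 | j = 2%:R].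
  by case: j => [[|[|[|//]]] ?]; [constructor 1|constructor 2|constructor 3];
     apply: val_inj.
- move=> ->; exists 0; rewrite mul0r !addr0 addn0 /normal_mon.
  have -> : (d.+1 - uphalf k = (d - uphalf k).+1)%N by lia.
  by rewrite exprS; ring.
- move=> ->; rewrite /normal_mon /conic_form.
  have -> : (k + (1%R : 'I_3) = k.+1)%N by rewrite addn1.
  have -> : uphalf k.+1 = (k./2).+1 by [].
  have -> : k.+1./2 = uphalf k by [].
  rewrite /= hu; case ok: (odd k); rewrite /= ?add0n ?add1n.
    exists (- (ell 0 ^+ (d - (k./2).+1) * ell 2%:R ^+ k./2)).
    have -> : (d.+1 - (k./2).+1 = (d - (k./2).+1).+1)%N by lia.
    by rewrite !exprS; ring.
  exists 0; rewrite mul0r addr0 subSS !expr0 !expr1; ring.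
- move=> ->; exists 0; rewrite mul0r addr0 /normal_mon.
  have -> : (k + (2%:R%R : 'I_3) = k.+2)%N by rewrite addn2.
  rewrite /= negbK.
  have -> : (d.+1 - (uphalf k).+1 = d - uphalf k)%N by lia.
  by rewrite exprS; ring.
Qed.

Definition conic_lift (d : nat) (p : {poly F}) : {mpoly F[3]} :=
  \sum_(k < (d.*2).+1) p`_k *: normal_mon d k.

Lemma conic_lift_homog d p : conic_lift d p \is d.-homog.
Proof.
by apply: rpred_sum => k _; apply/dhomogZ/normal_mon_homog; rewrite -ltnS.
Qed.

Lemma restr_conic_lift d (p : {poly F}) : (size p <= (d.*2).+1)%N -> restr (conic_lift d p) = p.
Proof.
move=> sp; rewrite rmorph_sum /=.
under eq_bigr do rewrite restrZ restr_normal_mon mul_polyC.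
by rewrite -poly_def; apply/polyP => i; rewrite coef_poly; case: ltnP => // h;
   rewrite nth_default // (leq_trans sp).
Qed.

Definition in_nf d a :=
  exists (p : {poly F}) b, (size p <= (d.*2).+1)%N /\ a = conic_lift d p + b * conic_form.

Lemma in_nfD d a b : in_nf d a -> in_nf d b -> in_nf d (a + b).
Proof.
move=> [p [x [sp ->]]] [p' [x' [sp' ->]]]; exists (p + p'), (x + x'); split.
  by rewrite (leq_trans (size_polyD _ _)) // geq_max sp.
rewrite mulrDl addrACA; congr (_ + _); rewrite -big_split /=.
by apply: eq_bigr => i _; rewrite coefD scalerDl.
Qed.

Lemma in_nfZ d c a : in_nf d a -> in_nf d (c *: a).
Proof.
move=> [p [x [sp ->]]]; exists (c *: p), (c *: x); split.
  exact: leq_trans (size_scale_leq _ _) sp.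
rewrite scalerDr -scalerAl; congr (_ + _); rewrite scaler_sumr.
by apply: eq_bigr => i _; rewrite coefZ scalerA.
Qed.

Lemma in_nf0 d : in_nf d 0.
Proof.
exists 0, 0; rewrite size_poly0 mul0r addr0; split=> //.
by rewrite /conic_lift big1 // => i _; rewrite coef0 scale0r.
Qed.

Lemma in_nf_sum d (I : Type) (s : seq I) (P : pred I) (f : I -> {mpoly F[3]}) :
  (forall i, in_nf d (f i)) -> in_nf d (\sum_(i <- s | P i) f i).
Proof. by move=> h; apply: big_ind => //; [exact: in_nf0 | exact: in_nfD]. Qed.

Lemma in_nf_mon d k b : (k <= d.*2)%N -> in_nf d (normal_mon d k + b * conic_form).
Proof.
move=> kd; exists 'X^k, b; rewrite size_polyXn ltnS kd; split=> //.
rewrite /conic_lift; congr (_ + _).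
rewrite (bigD1 (Ordinal (kd : (k < (d.*2).+1)%N))) //= coefXn eqxx scale1r.
rewrite big1 ?addr0 // => i /eqP ne; rewrite coefXn.
by case: eqP => [e|]; [case: ne; apply: val_inj|rewrite scale0r].
Qed.

Lemma in_nfM_ell d a j : in_nf d a -> in_nf d.+1 (a * ell j).
Proof.
move=> [p [x [sp ->]]]; rewrite mulrDl.
have -> : x * conic_form * ell j = 0 + (x * ell j) * conic_form by ring.
apply: in_nfD; last first.
  exists 0, (x * ell j); rewrite size_poly0; split=> //.
  by congr (_ + _); rewrite /conic_lift big1 // => i _; rewrite coef0 scale0r.
rewrite mulr_suml; apply: in_nf_sum => i.
rewrite -scalerAl; apply: in_nfZ.
have id : (i <= d.*2)%N by rewrite -ltnS.
have [b ->] := normal_monM j id; apply: in_nf_mon.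
by have := ltn_ord j; rewrite doubleS; lia.
Qed.

Lemma in_nfM_X d a i : in_nf d a -> in_nf d.+1 (a * 'X_i).
Proof.
move=> h; rewrite X_ell mulr_sumr; apply: in_nf_sum => j.
by rewrite -scalerAr; apply/in_nfZ/in_nfM_ell.
Qed.

Lemma in_nf_X d (m : 'X_{1..3}) : mdeg m = d -> in_nf d 'X_[m].
Proof.
elim: d m => [|d IH] m.
  move/eqP; rewrite mdeg_eq0 => /eqP ->; rewrite mpolyX0.
  have -> : (1 : {mpoly F[3]}) = normal_mon 0 0 + 0 * conic_form.
    by rewrite /normal_mon /= !expr0 !mulr1 mul0r addr0.
  exact: in_nf_mon.
by move=> /(mnm_decomp F) [i [m' [dm' ->]]]; apply/in_nfM_X/IH.
Qed.

(** Modulo the conic, forms of degree d are spanned by the 2d + 1 normal monomials, one for each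
    power t^k with k at most 2d, because these spans are stable under multiplication by linear
    forms. Hence a form is determined modulo the conic by its restriction, and divisibility by the
    conic becomes a statement on polynomials in t. *)
Lemma normal_form d a : a \is d.-homog ->
  (size (restr a) <= (d.*2).+1)%N /\
  exists b, a = conic_lift d (restr a) + b * conic_form.
Proof.
move=> /dhomogP ha; have [p [b [sp e]]] : in_nf d a.
  rewrite (mpolyE a) big_seq; apply: big_ind => [||m /ha dm].
  - exact: in_nf0.
  - exact: in_nfD.
  - exact/in_nfZ/in_nf_X.
have -> : restr a = p by rewrite e rmorphD rmorphM /= restr_conic_form mulr0 addr0 restr_conic_lift.
by split=> //; exists b.
Qed.

Lemma restr_eq0 d a : a \is d.-homog -> restr a = 0 ->
  exists b, a = b * conic_form.
Proof.
move=> /normal_form [_ [b e]] r0; exists b; rewrite e r0 /conic_lift big1 ?add0r //.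
by move=> i _; rewrite coef0 scale0r.
Qed.
End NormalForm.

(** * Intersection multiplicity along a conic *)

Lemma meval_homogZ (F : fieldType) n d (a : {mpoly F[n]}) c (v : 'I_n -> F) :
  a \is d.-homog -> a.@[fun i => c * v i] = c ^+ d * a.@[v].
Proof.
move=> /dhomogP ha; rewrite !mevalE mulr_sumr big_seq [RHS]big_seq.
apply: eq_bigr => m /ha <-; rewrite mulrCA; congr (_ * _).
rewrite /= mdegE -prodrXr -big_split /=; apply: eq_bigr => i _.
by rewrite exprMn.
Qed.

(** The error of approximating a / b by j / l, written with an extra unit g: it is (a l - b j) g
    that will be a combination of the two curve equations. *)
Lemma frac_jet (K : fieldType) (a b l g j : K) : b != 0 -> l != 0 -> g != 0 ->
  a / b = j / l + (a * l - b * j) * g / (b * l * g).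
Proof. by move=> b0 l0 g0; field; rewrite b0 l0 g0. Qed.

Lemma frac_clear (K : fieldType) (j l a1 b1 a2 b2 : K) :
  l != 0 -> b1 != 0 -> b2 != 0 -> j / l = a1 / b1 + a2 / b2 ->
  j * (b1 * b2) = (a1 * b2 + a2 * b1) * l.
Proof.
move=> l0 b10 b20; rewrite addf_div // => /eqP.
by rewrite eqr_div ?mulf_neq0 // => /eqP.
Qed.

Lemma decomp_sub (K : comNzRingType) (s s' v v' w w' : K) :
  s + v + w = s' + v' + w' -> s' - s = (v + -1 * v') + (w + -1 * w').
Proof. by move=> /(canRL (addrK _)) /(canRL (addrK _)) ->; ring. Qed.

Lemma decomp_elim (K : comNzRingType) (x y v v' w w' : K) :
  y * (x + v + w) + - x * (y + v' + w') = (y * v + - x * v') + (y * w + - x * w').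
Proof. by ring. Qed.

Section LocalIdeal.
Variables (F : fieldType) (P : proj_point F) (f : {mpoly F[3]}).
Local Notation "x %:F" := (tofrac x).

Lemma not_vanishesM d e (a b : {mpoly F[3]}) : a \is d.-homog ->
  b \is e.-homog -> ~ vanishes a P -> ~ vanishes b P -> ~ vanishes (a * b) P.
Proof.
case: P => U dU; rewrite /vanishes /= => ha hb.
have [w [wU w0]] : exists w, w \in U /\ w != 0.
  by exists (vpick U); rewrite memv_pick vpick0 -dimv_eq0 (eqP dU).
have Uw v : v \in U -> exists c, v = c *: w.
  suff -> : U = <[w]>%VS by move=> /vlineP.
  by apply/eqP; rewrite eq_sym eqEdim -memvE wU dim_vline w0 (eqP dU).
have hom c k (x : {mpoly F[3]}) : x \is k.-homog ->
    x.@[fun i => (c *: w) 0 i] = c ^+ k * x.@[fun i => w 0 i].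
  by move=> hx; rewrite -(meval_homogZ _ _ hx); apply: meval_eq => i; rewrite mxE.
move=> na nb nab; have := nab w wU; rewrite mevalM => /eqP; rewrite mulf_eq0.
by case/orP => /eqP e0; [apply: na|apply: nb] => v /Uw [c ->];
   rewrite (hom _ _ _ ha, hom _ _ _ hb) e0 mulr0.
Qed.

Lemma tofrac_neq0 (b : {mpoly F[3]}) : ~ vanishes b P -> b%:F != 0.
Proof.
by move=> nb; rewrite tofrac_eq0; apply/eqP => b0; apply: nb => v _; rewrite b0 meval0.
Qed.

Lemma local_idealD u v :
  local_ideal f P u -> local_ideal f P v -> local_ideal f P (u + v).
Proof.
move=> [d [a [b [ha hb nb ->]]]] [d' [a' [b' [ha' hb' nb' ->]]]].
exists (d + d')%N, (a * b' + a' * b), (b * b'); split.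
- have -> : (a * b' + a' * b) * f = (a * f) * b' + b * (a' * f) by ring.
  by apply: rpredD; apply: dhomogM.
- exact: dhomogM.
- exact: (not_vanishesM hb hb').
- rewrite (addf_div _ _ (tofrac_neq0 nb) (tofrac_neq0 nb')) -!tofracM -tofracD; congr (_%:F / _).
  by ring.
Qed.

Lemma local_idealZ c u : local_ideal f P u -> local_ideal f P ((c%:MP)%:F * u).
Proof.
move=> [d [a [b [ha hb nb ->]]]]; exists d, (c *: a), b; split=> //.
  by rewrite -scalerAl; apply: dhomogZ.
by rewrite -mul_mpolyC mulrA -tofracM mulrA.
Qed.

Lemma local_ideal0 : local_ideal f P 0.
Proof.
have [w [wU w0]] : exists w, w \in val P /\ w != 0.
  case: P => U /= /eqP dU; exists (vpick U).
  by rewrite memv_pick vpick0 -dimv_eq0 dU.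
exists 0%N, 0, 1; split; rewrite ?mul0r ?rpred0 ?dhomog1 ?tofrac0 ?mul0r //.
by move=> /(_ w wU); rewrite meval1 => /eqP; rewrite oner_eq0.
Qed.

Lemma local_ring0 : local_ring P 0.
Proof.
have [d [a [b [h1 h2 h3 h4]]]] := local_ideal0.
by exists d, (a * f), b.
Qed.
End LocalIdeal.

Section Multiplicity.
Variables (F : fieldType) (A : 'M[F]_3).
Hypothesis uA : A \in unitmx.
Variables (P : proj_point F) (c0 : F) (f : {mpoly F[3]}) (m k : nat)
  (r : {poly F}).
Hypothesis hP : val P = <[row 0%R A]>%VS.
Hypothesis c0_neq0 : c0 != 0.
Hypothesis hf : f \is m.-homog.
Hypothesis restr_f : restr A f = 'X^k * r.
Hypothesis r0 : r.[0] != 0.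
Hypothesis k_gt0 : (0 < k)%N.
Let q := c0 *: conic_form A.

Local Notation "x %:F" := (tofrac x).
Local Notation ell := (ell A).

Lemma param0 i : param A 0 0 i = row 0 A 0 i.
Proof.
by rewrite !mxE (bigD1 0) //= expr0 mulr1 big1 ?addr0 // => j /negPf;
   case: j => [[|j] ?] //; rewrite expr0n mulr0.
Qed.

Lemma vanishesE d b : b \is d.-homog -> vanishes b P <-> (restr A b).[0] = 0.
Proof.
move=> hb; rewrite horner_restr; split=> [h|h v].
  under meval_eq do rewrite param0.
  by apply: h; rewrite hP memv_line.
rewrite hP => /vlineP [c ->].
under meval_eq do rewrite mxE -param0.
by rewrite (meval_homogZ _ _ hb) h mulr0.
Qed.

(** Powers of [ell 1 / ell 0], which restricts to the parameter t, a uniformizer of the conic at the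
    point t = 0. *)
Definition local_basis (i : nat) : {fraction {mpoly F[3]}} :=
  (ell 1 ^+ i)%:F / (ell 0 ^+ i)%:F.

Definition jet (p : {poly F}) : {mpoly F[3]} :=
  \sum_(i < k) p`_i *: (ell 1 ^+ i * ell 0 ^+ (k.-1 - i)).

Lemma jet_homog p : jet p \is (k.-1).-homog.
Proof.
apply: rpred_sum => i _; apply: dhomogZ.
have {2}-> : k.-1 = (i + (k.-1 - i))%N by have := ltn_ord i; lia.
by apply: dhomogM; apply/dhomogXn/ell_homog.
Qed.

Lemma restr_jet (p : {poly F}) : (size p <= k)%N -> restr A (jet p) = p.
Proof.
move=> sp; rewrite rmorph_sum /=.
under eq_bigr do rewrite restrZ rmorphM !rmorphXn /= !restr_ell // expr0 expr1n mulr1 expr1 mul_polyC.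
by rewrite -poly_def; apply/polyP => i; rewrite coef_poly; case: ltnP => // h;
   rewrite nth_default // (leq_trans sp).
Qed.

Lemma ell0_not_vanishes n : ~ vanishes (ell 0 ^+ n) P.
Proof.
rewrite (vanishesE (dhomogXn n (ell_homog A 0))) rmorphXn /= restr_ell // expr0.
by rewrite expr1n hornerC => /eqP; rewrite oner_eq0.
Qed.

Lemma jet_frac (p : {poly F}) :
  \sum_(i < k) ((p`_i)%:MP)%:F * local_basis i = (jet p)%:F / (ell 0 ^+ k.-1)%:F.
Proof.
rewrite /jet rmorph_sum /= mulr_suml; apply: eq_bigr => i _.
rewrite /local_basis -mul_mpolyC !tofracM -!mulrA; congr (_ * (_ * _)).
have {2}-> : k.-1 = ((k.-1 - i) + i)%N by have := ltn_ord i; lia.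
rewrite exprD tofracM invfM mulrA divff ?mul1r //.
exact/tofrac_neq0/ell0_not_vanishes.
Qed.

(** The local ring modulo both equations is F[t] / t^k: the conic identifies functions with rational
    functions of t regular at 0, and f restricts to t^k times the unit r. *)
Lemma local_generation u : local_ring P u ->
  exists (p : {poly F}) v w, [/\ (size p <= k)%N, local_ideal q P v, local_ideal f P w &
     u = \sum_(i < k) ((p`_i)%:MP)%:F * local_basis i + v + w].
Proof.
move=> [d [a [b [ha hb nb ->]]]].
set al := restr A a; set be := restr A b.
have be0 : be.[0] != 0 by apply/eqP => /(vanishesE hb).
have cop : coprimep ('X^k) be.
  rewrite coprimep_expl // coprimep_sym coprimepX.
  by rewrite /root.
(* The denominator does not vanish at 0, hence is invertible modulo X^k; after scaling, [y] is its
   inverse and [ga] below the jet of a / b. *)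
have /Bezout_coprimepP [[x y] /= /eqpP [[c c'] /= /andP [c1 c2] exy]] := cop.
have {}exy : (c'^-1 * c) *: x * 'X^k + ((c'^-1 * c) *: y) * be = 1.
  rewrite -!scalerAl -scalerDr -scalerA exy scalerA mulVf ?scale1r //.
move: ((c'^-1 * c) *: x) ((c'^-1 * c) *: y) exy => {}x {}y exy.
pose ga := (y * al) %% 'X^k.
have sga : (size ga <= k)%N.
  have := ltn_modp (y * al) ('X^k).
  by rewrite -size_poly_eq0 size_polyXn /= ltnS => /idP.
pose de := al * x + be * ((y * al) %/ 'X^k).
have ede : al - be * ga = 'X^k * de.
  have -> : ga = y * al - (y * al) %/ 'X^k * 'X^k.
    by apply/eqP; rewrite eq_sym subr_eq addrC; apply/eqP; exact: divp_eq.
  by rewrite /de -{1}[al]mulr1 -exy; ring.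
pose a' := a * ell 0 ^+ k.-1 - b * jet ga.
have ha' : a' \is (d + k.-1).-homog.
  apply: rpredB; apply: dhomogM => //; last exact: jet_homog.
  by apply/dhomogXn/ell_homog.
have ra' : restr A a' = 'X^k * de.
  rewrite rmorphB !rmorphM /= restr_jet // rmorphXn /= restr_ell // expr0 expr1n mulr1.
  exact: ede.
have [sa' _] := normal_form uA ha'; have [sf _] := normal_form uA hf.
have sXk (p : {poly F}) n : (size ('X^k * p)%R <= n)%N -> (size p <= n)%N.
  have [->|p0] := eqVneq p 0; first by rewrite size_poly0.
  by rewrite mulrC size_mulXn //; apply: leq_trans; exact: leq_addl.
(* Lifts of the two cofactors of X^k: a' restricts to X^k de and f to X^k r, so a' g' and de' f
   agree on the conic and differ by a multiple of its equation. *)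
pose de' := conic_lift A (d + k.-1) de; pose g' := conic_lift A m r.
have rde' : restr A de' = de by apply: restr_conic_lift => //; apply: sXk; rewrite -ra'.
have rg' : restr A g' = r by apply: restr_conic_lift => //; apply: sXk; rewrite -restr_f.
have hde' : de' \is (d + k.-1).-homog by apply: conic_lift_homog.
have hg' : g' \is m.-homog by apply: conic_lift_homog.
have hc : a' * g' - de' * f \is (d + k.-1 + m).-homog.
  by apply: rpredB; apply: dhomogM.
have [h eh] : exists h, a' * g' - de' * f = h * conic_form A.
  apply: (restr_eq0 uA hc).
  by rewrite rmorphB !rmorphM /= ra' rg' rde' restr_f; ring.
have nl := @ell0_not_vanishes k.-1; have hl : ell 0 ^+ k.-1 \is k.-1.-homog.
  exact/dhomogXn/ell_homog.
have ng : ~ vanishes g' P by rewrite (vanishesE hg') rg'; apply/eqP.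
have hbl := dhomogM hb hl; have nbl := not_vanishesM hb hl nb nl.
have hD := dhomogM hbl hg'; have nD := not_vanishesM hbl hg' nbl ng.
exists ga, ((c0^-1 *: h * q)%:F / (b * ell 0 ^+ k.-1 * g')%:F),
  ((de' * f)%:F / (b * ell 0 ^+ k.-1 * g')%:F); split=> //.
- exists (d + k.-1 + m)%N, (c0^-1 *: h), (b * ell 0 ^+ k.-1 * g'); split=> //.
  by rewrite /q -scalerAl -scalerAr scalerA mulVf // scale1r -eh.
- by exists (d + k.-1 + m)%N, de', (b * ell 0 ^+ k.-1 * g'); split=> //; apply: dhomogM.
rewrite jet_frac -addrA -mulrDl -tofracD.
have -> : c0^-1 *: h * q + de' * f = a' * g'.
  rewrite /q -scalerAl -scalerAr scalerA mulVf // scale1r -eh; ring.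
rewrite /a' !tofracM !tofracB !tofracM.
have := tofrac_neq0 nb; have := tofrac_neq0 nl; have := tofrac_neq0 ng.
move: (b%:F) (a%:F) ((ell 0 ^+ k.-1)%:F) (g'%:F) ((jet ga)%:F) => B AA L G J G0 L0 B0.
exact: (frac_jet AA J B0 L0 G0).
Qed.

(** After clearing denominators, restriction to the conic kills the first ideal and leaves X^k
    dividing p times a polynomial prime to X, which is impossible for a nonzero p of degree below
    k. *)
Lemma local_free (p : {poly F}) v w : (size p <= k)%N ->
  local_ideal q P v -> local_ideal f P w ->
  \sum_(i < k) ((p`_i)%:MP)%:F * local_basis i = v + w -> p = 0.
Proof.
move=> sp [d1 [a1 [b1 [ha1 hb1 nb1 ->]]]] [d2 [a2 [b2 [ha2 hb2 nb2 ->]]]].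
have n1 := tofrac_neq0 nb1; have n2 := tofrac_neq0 nb2.
have n0 := tofrac_neq0 (@ell0_not_vanishes k.-1).
rewrite jet_frac => /(frac_clear n0 n1 n2)/eqP.
rewrite -!tofracM -tofracD -!tofracM tofrac_eq => /eqP /(congr1 (restr A)).
rewrite rmorphM rmorphM rmorphM rmorphD !rmorphM rmorphXn /= restr_jet // restr_ell //.
rewrite restrZ restr_conic_form // mulr0 mulr0 mul0r add0r restr_f expr0 expr1n mulr1.
move=> e; apply/eqP/contraT => p0.
have dv : 'X^k %| p * (restr A b1 * restr A b2).
  by rewrite e; apply/dvdpP; exists (restr A a2 * r * restr A b1); ring.
have cop b d : b \is d.-homog -> ~ vanishes b P -> coprimep ('X^k) (restr A b).
  move=> hb nb; rewrite coprimep_expl // coprimep_sym coprimepX.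
  by rewrite /root; apply/eqP => /(vanishesE hb).
move: dv; rewrite Gauss_dvdpl ?coprimepMr ?(cop _ _ hb1) ?(cop _ _ hb2) //.
by move=> /(dvdp_leq p0); rewrite size_polyXn => h; move: (leq_ltn_trans sp h); rewrite ltnn.
Qed.
End Multiplicity.

Section MultiplicityTwo.
Variables (F : fieldType) (A : 'M[F]_3).
Hypothesis uA : A \in unitmx.
Variables (P : proj_point F) (c0 : F) (f : {mpoly F[3]}) (m : nat) (r : {poly F}).
Hypothesis hP : val P = <[row 0%R A]>%VS.
Hypothesis c0_neq0 : c0 != 0.
Hypothesis hf : f \is m.-homog.
Hypothesis r0 : r.[0] != 0.

Local Notation "x %:F" := (tofrac x).

Lemma multiplicity2 : restr A f = 'X^2 * r ->
  intersection_multiplicity (c0 *: conic_form A) f P 2.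
Proof.
move=> rf; exists (fun i => local_basis A i); split.
  move=> i; exists (i : nat), (ell A 1 ^+ i), (ell A 0 ^+ i); split=> //.
  - exact/dhomogXn/ell_homog.
  - exact/dhomogXn/ell_homog.
  - exact: ell0_not_vanishes.
move=> u hu; have [p [v [w [sp hv hw e]]]] := local_generation uA hP c0_neq0 hf rf r0 isT hu.
exists (\row_i p`_i); split.
  by exists v, w; split=> //; rewrite e; congr (_ + _ + _); apply: eq_bigr => i _; rewrite mxE.
move=> x [v' [w' [hv' hw' e']]].
pose p' := \poly_(i < 2) (x 0 (inord i) - p`_i).
have : p' = 0.
  apply: (local_free uA hP c0_neq0 hf rf r0 isT (p := p') (v := v + (-1)%:MP%:F * v') (w := w + (-1)%:MP%:F * w')).
  - exact: size_poly.
  - by apply: local_idealD => //; apply: local_idealZ.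
  - by apply: local_idealD => //; apply: local_idealZ.
  under eq_bigr => i _ do rewrite coef_poly ltn_ord inord_val mpolyCB tofracB mulrBl.
  rewrite sumrB mpolyCN mpolyC1 tofracN tofrac1; apply: decomp_sub.
  by rewrite -e e'.
move=> /polyP p'0; apply/rowP => i; rewrite !mxE.
have := p'0 i; rewrite coef_poly ltn_ord inord_val coef0 => /eqP.
by rewrite subr_eq0 => /eqP.
Qed.

(** At a simple zero the generation result with k = 1 makes every element of the local ring
    congruent to a constant, so two elements are never independent modulo the ideals. *)
Lemma not_multiplicity2 : restr A f = 'X * r ->
  ~ intersection_multiplicity (c0 *: conic_form A) f P 2.
Proof.
move=> rf [e [he hb]]; have rf1 : restr A f = 'X^1 * r by [].
have gen i : exists c v w, [/\ local_ideal (c0 *: conic_form A) P v, local_ideal f P w &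
    e i = (c%:MP)%:F + v + w].
  have [p [v [w [sp hv hw ee]]]] := local_generation uA hP c0_neq0 hf rf1 r0 isT (he i).
  exists p`_0, v, w; split=> //; rewrite ee big_ord_recl big_ord0 addr0.
  by rewrite /local_basis !expr0 tofrac1 divr1 mulr1.
have [x [v [w [hv hw ex]]]] := gen 0; have [y [v' [w' [hv' hw' ey]]]] := gen 1.
have [c [hc uc]] := hb 0 (local_ring0 P f).
have c_0 : c = 0.
  apply: uc; exists 0, 0; split; try exact: local_ideal0.
  by rewrite big1 ?add0r // => i _; rewrite mxE mpolyC0 tofrac0 mul0r.
have key a b (v1 w1 : {fraction {mpoly F[3]}}) :
  local_ideal (c0 *: conic_form A) P v1 -> local_ideal f P w1 ->
  (a%:MP)%:F * e 0 + (b%:MP)%:F * e 1 = v1 + w1 -> a = 0 /\ b = 0.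
  move=> hv1 hw1 eab; pose z : 'rV[F]_2 := \row_i (if i == 0 then a else b).
  have : c = z.
    apply: uc; exists ((-1)%:MP%:F * v1), ((-1)%:MP%:F * w1).
    split; try exact: local_idealZ.
    rewrite big_ord_recl big_ord1 !mxE /=.
    have -> : lift ord0 ord0 = 1 :> 'I_2 by apply: val_inj.
    by rewrite mpolyCN mpolyC1 tofracN tofrac1 eab !mulN1r -addrA -opprD subrr.
  rewrite c_0 => /rowP ez; have := ez 0; have := ez 1.
  by rewrite !mxE.
(* With e 0 congruent to x and e 1 to y, the relation y e 0 - x e 1 = 0 forces x = y = 0; but then e
   0 itself is a relation. *)
have [y0 /eqP] : y = 0 /\ - x = 0.
  apply: (key _ _ (y%:MP%:F * v + (- x)%:MP%:F * v') (y%:MP%:F * w + (- x)%:MP%:F * w')).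
  - by apply: local_idealD; apply: local_idealZ.
  - by apply: local_idealD; apply: local_idealZ.
  by rewrite ex ey mpolyCN tofracN; apply: decomp_elim.
rewrite oppr_eq0 => /eqP x0.
have [/eqP] : (1 : F) = 0 /\ (0 : F) = 0.
  apply: (key _ _ _ _ hv hw).
  by rewrite mpolyC1 mpolyC0 tofrac1 tofrac0 ex x0 mpolyC0 tofrac0 mul1r mul0r addr0 add0r.
by rewrite oner_eq0.
Qed.
End MultiplicityTwo.

(** * Points and the Hermitian form *)

Lemma ord3P (i : 'I_3) : [\/ i = 0, i = 1 | i = 2%:R].
Proof.
by case: i => [[|[|[|//]]] ?]; [constructor 1|constructor 2|constructor 3]; apply: val_inj.
Qed.

Lemma sum3 (V : nmodType) (f : 'I_3 -> V) : \sum_i f i = f 0 + f 1 + f 2%:R.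
Proof.
rewrite !big_ord_recl big_ord0 addr0 addrA.
by congr (_ + f _ + f _); apply: val_inj.
Qed.

Lemma has_card_uniq (T : Type) (A : set T) m n : has_card A m -> has_card A n -> m = n.
Proof.
by move=> h1 h2; apply/(@card_eq_II m n); apply: card_eq_trans h2; apply: card_esym.
Qed.

Lemma has_card_image (I : eqType) (T : Type) (f : I -> T) (s : seq I) (A : set T) :
  uniq s -> {in s &, injective f} -> (forall x, A x <-> exists2 i, i \in s & x = f i) ->
  has_card A (size s).
Proof.
have [->|[i0 _]] : s = [::] \/ exists i0, i0 \in s.
- by case: s => [|i s]; [left|right; exists i; rewrite mem_head].
- move=> _ _ h; rewrite /has_card (_ : A = set0) /=; last first.
    by rewrite -subset0 => x /h [].
  by rewrite II0; exact: card_eq00.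
move=> us inj hA; rewrite /has_card.
have -> : A = (fun k => f (nth i0 s k)) @` `I_(size s).
  rewrite predeqE => x; rewrite hA; split=> [[i si ->]|[k /= ks <-]].
    by exists (index i s); [rewrite /= index_mem|rewrite nth_index].
  by exists (nth i0 s k) => //; rewrite mem_nth.
apply: inj_card_eq => k l; rewrite !inE /= => hk hl /inj e.
by apply/eqP; rewrite -(nth_uniq i0 hk hl us) e ?mem_nth.
Qed.

Lemma has_card_seq (T : choiceType) (A : set T) n : has_card A n ->
  exists s : seq T, [/\ uniq s, size s = n & forall x, A x <-> x \in s].
Proof.
move=> hA; have fA : finite_set A by apply/finite_setP; exists n.
exists (finmap.enum_fset (fset_set A)); split; first exact: finmap.fset_uniq.
  exact: card_fset_set.
by move=> x; rewrite -[in A x](fset_setK fA).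
Qed.

Section Points.
Variable F : fieldType.
Implicit Types (v w : 'rV[F]_3) (P : proj_point F).

(** The zero vector receives an arbitrary point, which makes [pt] total. *)
Definition pt_span v : {vspace 'rV[F]_3} :=
  (if v == 0%R then <[const_mx 1%R]> else <[v]>)%VS.

Lemma pt_span_dim v : \dim (pt_span v) == 1%N.
Proof.
rewrite /pt_span; have [_|v0] := eqVneq v 0; last by rewrite dim_vline v0.
rewrite dim_vline.
suff -> : const_mx 1 != 0 :> 'rV[F]_3 by [].
by apply/eqP => /rowP /(_ 0); rewrite !mxE => /eqP; rewrite oner_eq0.
Qed.

Definition pt v : proj_point F := exist _ (pt_span v) (pt_span_dim v).

Lemma val_pt v : v != 0 -> val (pt v) = <[v]>%VS.
Proof. by move=> v0; rewrite /= /pt_span (negPf v0). Qed.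

Lemma ptP P : exists2 v, v != 0 & P = pt v.
Proof.
case: P => U dU; have U0 : vpick U != 0 by rewrite vpick0 -dimv_eq0 (eqP dU).
exists (vpick U) => //; apply: val_inj; rewrite val_pt //=.
by apply/eqP; rewrite eq_sym eqEdim -memvE memv_pick dim_vline U0 (eqP dU).
Qed.

Lemma mem_pt v w : v != 0 -> reflect (exists c, w = c *: v) (w \in val (pt v)).
Proof. by move=> v0; rewrite val_pt //; exact: vlineP. Qed.

Lemma pt_eqP v w : v != 0 -> w != 0 -> pt v = pt w <-> exists c, w = c *: v.
Proof.
move=> v0 w0; split=> [e|[c e]].
  by apply/(mem_pt _ v0); rewrite e val_pt // memv_line.
have c0 : c != 0 by apply: contraNneq w0 => c0; rewrite e c0 scale0r.
apply: val_inj; rewrite !val_pt //; apply/eqP.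
rewrite eq_sym eqEdim !dim_vline v0 w0 leqnn andbT -memvE.
by apply/vlineP; exists c.
Qed.

Lemma ptZ c v : c != 0 -> v != 0 -> pt (c *: v) = pt v.
Proof.
by move=> c0 v0; symmetry; apply/pt_eqP; rewrite ?scaler_eq0 ?negb_or ?c0 //; exists c.
Qed.

Lemma vanishes_pt d (f : {mpoly F[3]}) v : f \is d.-homog -> v != 0 ->
  vanishes f (pt v) <-> f.@[fun i => v 0 i] = 0.
Proof.
move=> hf v0; split=> [h|h w /(mem_pt _ v0) [c ->]].
  by apply: h; apply/(mem_pt _ v0); exists 1; rewrite scale1r.
by under meval_eq do rewrite mxE; rewrite (meval_homogZ _ _ hf) h mulr0.
Qed.

Lemma meval_ell (A : 'M[F]_3) j v :
  (ell A j).@[fun i => v 0 i] = (v *m invmx A) 0 j.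
Proof.
rewrite /ell rmorph_sum mxE; apply: eq_bigr => i _.
by rewrite /= mevalZ mevalXU mulrC.
Qed.

Lemma meval_conic_form (A : 'M[F]_3) v (x := v *m invmx A) :
  (conic_form A).@[fun i => v 0 i] = x 0 0 * x 0 2%:R - x 0 1 ^+ 2.
Proof. by rewrite /conic_form mevalB mevalM rmorphXn /= !meval_ell. Qed.

Definition conic_of (A : 'M[F]_3) : set (proj_point F) := zeros (conic_form A).

Lemma conic_of_pt A v (x := v *m invmx A) : v != 0 ->
  conic_of A (pt v) <-> x 0 0 * x 0 2%:R = x 0 1 ^+ 2.
Proof.
move=> v0; rewrite /conic_of /zeros /= (vanishes_pt (conic_form_homog A) v0).
by rewrite meval_conic_form; split=> [/eqP|->]; rewrite ?subrr ?subr_eq0 // => /eqP.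
Qed.

Lemma param_mul (A : 'M[F]_3) t : param A t = (\row_j t ^+ j) *m A.
Proof.
by apply/rowP => i; rewrite !mxE; apply: eq_bigr => j _; rewrite !mxE mulrC.
Qed.

Lemma param_neq0 (A : 'M[F]_3) t : A \in unitmx -> param A t != 0.
Proof.
move=> uA; apply/eqP => /(congr1 (mulmx^~ (invmx A))).
rewrite param_mul mulmxK // mul0mx => /rowP /(_ 0); rewrite !mxE expr0 => /eqP.
by rewrite oner_eq0.
Qed.

Lemma row_neq0 (A : 'M[F]_3) i : A \in unitmx -> row i A != 0.
Proof.
move=> uA; apply/eqP => /(congr1 (mulmx^~ (invmx A))).
rewrite rowE mulmxK // mul0mx => /rowP /(_ i); rewrite !mxE !eqxx => /eqP.
by rewrite oner_eq0.
Qed.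

Lemma param_eq (A : 'M[F]_3) s t : A \in unitmx ->
  pt (param A s) = pt (param A t) -> s = t.
Proof.
move=> uA /pt_eqP [||c]; rewrite ?param_neq0 // !param_mul scalemxAl.
move=> /(can_inj (mulmxK uA)) /rowP e; move: (e 0) (e 1); rewrite !mxE !expr0 !expr1.
by rewrite mulr1 => <-; rewrite mul1r.
Qed.

Lemma param_neq_row2 (A : 'M[F]_3) t : A \in unitmx ->
  pt (param A t) <> pt (row 2%:R A).
Proof.
move=> uA /pt_eqP [||c]; rewrite ?param_neq0 ?row_neq0 // !param_mul scalemxAl rowE.
move=> /(can_inj (mulmxK uA)) /rowP e; move: (e 0) (e 2%:R); rewrite !mxE /= !expr0 mulr1.
by move=> <-; rewrite mul0r => /eqP; rewrite oner_eq0.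
Qed.

Lemma conic_of_param (A : 'M[F]_3) t : A \in unitmx -> conic_of A (pt (param A t)).
Proof.
move=> uA; apply/conic_of_pt; first exact: param_neq0.
by rewrite param_mul mulmxK // !mxE expr0 expr1 mul1r.
Qed.

Lemma conic_of_row2 (A : 'M[F]_3) : A \in unitmx -> conic_of A (pt (row 2%:R A)).
Proof.
move=> uA; apply/conic_of_pt; first exact: row_neq0.
by rewrite rowE mulmxK // !mxE /= mul0r expr0n.
Qed.

Lemma conic_ofP (A : 'M[F]_3) P : A \in unitmx -> conic_of A P ->
  (exists t, P = pt (param A t)) \/ P = pt (row 2%:R A).
Proof.
move=> uA; have [v v0 ->] := ptP P; move/(conic_of_pt A v0).
have ev : v = (v *m invmx A) *m A by rewrite mulmxKV.
move: ev v0; move: (v *m invmx A) => x -> v0 e.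
have x0 : x != 0 by apply: contraNneq v0 => ->; rewrite mul0mx.
have [z|nz] := eqVneq (x 0 0) 0.
  right; move: e; rewrite z mul0r => /esym/eqP; rewrite expf_eq0 /= => /eqP x1.
  have ex : x = x 0 2%:R *: delta_mx 0 2%:R.
    apply/rowP => i; rewrite !mxE; have [->|->|->] := ord3P i; rewrite /= ?mulr0 ?mulr1 //.
  have n2 : x 0 2%:R != 0 by apply: contraNneq x0 => h; rewrite ex h scale0r.
  by rewrite ex -scalemxAl -rowE ptZ // row_neq0.
left; exists (x 0 1 / x 0 0); rewrite -[RHS](ptZ nz) ?param_neq0 //; congr pt.
rewrite param_mul scalemxAl; congr (_ *m _); apply/rowP => i; rewrite !mxE.
have [->|->|->] := ord3P i.
- by rewrite expr0 mulr1.
- by rewrite expr1 mulrCA divff ?mulr1.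
- have -> : x 0 2%:R = x 0 1 ^+ 2 / x 0 0 by rewrite -e; field.
  by rewrite -[nat_of_ord _]/2%N; field.
Qed.

End Points.

Section Hermitian.
Variable F : closedFieldType.
Hypothesis charF : 5%N \in [pchar F].
Implicit Types (v w : 'rV[F]_3) (P : proj_point F).

Definition hf v w : F := \sum_i v 0 i * w 0 i ^+ 5.

Lemma five0 : 5%:R = 0 :> F.
Proof. exact: pcharf0. Qed.

Lemma frobD (R : comNzRingType) (x y : R) : 5%N \in [pchar R] ->
  (x + y) ^+ 5 = x ^+ 5 + y ^+ 5.
Proof. by move=> h; rewrite -!(pFrobenius_autE h) rmorphD. Qed.

Lemma frob_sum (R : comNzRingType) (I : finType) (f : I -> R) : 5%N \in [pchar R] ->
  (\sum_i f i) ^+ 5 = \sum_i f i ^+ 5.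
Proof. by move=> h; rewrite -(pFrobenius_autE h) (rmorph_sum (pFrobenius_aut h)). Qed.

Lemma hfDl u v w : hf (u + v) w = hf u w + hf v w.
Proof. by rewrite /hf -big_split; apply: eq_bigr => i _; rewrite !mxE mulrDl. Qed.

Lemma hfDr u v w : hf u (v + w) = hf u v + hf u w.
Proof.
by rewrite /hf -big_split; apply: eq_bigr => i _; rewrite !mxE frobD // mulrDr.
Qed.

Lemma hfZl c v w : hf (c *: v) w = c * hf v w.
Proof. by rewrite /hf mulr_sumr; apply: eq_bigr => i _; rewrite !mxE mulrA. Qed.

Lemma hfZr c v w : hf v (c *: w) = c ^+ 5 * hf v w.
Proof.
by rewrite /hf mulr_sumr; apply: eq_bigr => i _; rewrite !mxE exprMn mulrCA.
Qed.

Lemma fermat_homog : fermat F \is 6.-homog.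
Proof. by apply: rpred_sum => i _; apply/dhomogXn/dhomogU. Qed.

Lemma meval_fermat v : (fermat F).@[fun i => v 0 i] = hf v v.
Proof.
rewrite /fermat rmorph_sum; apply: eq_bigr => i _ /=.
by rewrite rmorphXn /= mevalXU exprS.
Qed.

Lemma Gamma_pt v : v != 0 -> Gamma (pt v) <-> hf v v = 0.
Proof.
by move=> v0; rewrite /Gamma /zeros /= (vanishes_pt fermat_homog v0) meval_fermat.
Qed.

Lemma restr_fermat (A : 'M[F]_3) :
  restr A (fermat F) = \sum_i \sum_j (hf (row i A) (row j A))%:P * 'X^(i + 5 * j).
Proof.
have char5 : 5%N \in [pchar {poly F}] by rewrite pchar_poly.
rewrite /fermat rmorph_sum /=.
transitivity (\sum_k \sum_i \sum_j (A i k * A j k ^+ 5)%:P * ('X^(i + 5 * j) : {poly F})).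
  apply: eq_bigr => k _; rewrite rmorphXn /= restrX exprS.
  rewrite (frob_sum _ char5) mulr_suml; apply: eq_bigr => i _.
  rewrite mulr_sumr; apply: eq_bigr => j _.
  rewrite exprMn -exprM polyCM rmorphXn exprD [(5 * j)%N]mulnC /=; ring.
rewrite exchange_big; apply: eq_bigr => i _; rewrite exchange_big.
apply: eq_bigr => j _; rewrite -mulr_suml /hf rmorph_sum; congr (_ * _).
by apply: eq_bigr => k _; rewrite !mxE.
Qed.

Definition frame_form (i j : 'I_3) : F :=
  if (i + j == 2)%N then (if i == 1 then - 2%:R else 1) else 0.

Definition hframe (A : 'M[F]_3) : Prop :=
  A \in unitmx /\ forall i j, hf (row i A) (row j A) = frame_form i j.

Lemma restr_fermat_hframe A : hframe A -> restr A (fermat F) = ('X^5 - 'X) ^+ 2.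
Proof.
move=> [_ hA]; rewrite restr_fermat !sum3 !hA /frame_form /=.
rewrite !polyC0 !mul0r !polyC1 polyCN polyC_natr.
rewrite -[(0 + 5 * 2)%N]/10%N -[(1 + 5 * 1)%N]/6%N -[(2 + 5 * 0)%N]/2%N; ring.
Qed.

End Hermitian.

(** * Conics of Hermitian frames are totally tangent *)

Section Reparametrization.
Variable F : closedFieldType.
Hypothesis charF : 5%N \in [pchar F].
Implicit Types (A T : 'M[F]_3).

Lemma row_mulmx T A i : row i (T *m A) = \sum_k T i k *: row k A.
Proof. by rewrite row_mul mulmx_sum_row; apply: eq_bigr => k _; rewrite mxE. Qed.

Lemma hf_suml (I : finType) (c : I -> F) (u : I -> 'rV[F]_3) w :
  hf (\sum_i c i *: u i) w = \sum_i c i * hf (u i) w.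
Proof.
apply: (big_rec2 (fun x y => hf x w = y)) => [|i x y _ <-].
  by rewrite /hf big1 // => i _; rewrite mxE mul0r.
by rewrite hfDl hfZl.
Qed.

Lemma hf_sumr (I : finType) (c : I -> F) (u : I -> 'rV[F]_3) w :
  hf w (\sum_i c i *: u i) = \sum_i c i ^+ 5 * hf w (u i).
Proof.
apply: (big_rec2 (fun x y => hf w x = y)) => [|i x y _ <-].
  by rewrite /hf big1 // => i _; rewrite mxE expr0n mulr0.
by rewrite (hfDr charF) hfZr.
Qed.

Lemma hf_row_mulmx T A i j :
  hf (row i (T *m A)) (row j (T *m A)) =
  \sum_k \sum_l T i k * T j l ^+ 5 * hf (row k A) (row l A).
Proof.
rewrite !row_mulmx hf_suml; apply: eq_bigr => k _.
by rewrite hf_sumr mulr_sumr; apply: eq_bigr => l _; rewrite mulrA.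
Qed.

Lemma ell_mulmx T A j : T \in unitmx -> A \in unitmx ->
  ell A j = \sum_k T k j *: ell (T *m A) k.
Proof.
move=> uT uA; rewrite /ell; under [RHS]eq_bigr do rewrite scaler_sumr.
rewrite exchange_big; apply: eq_bigr => i _ /=.
have -> : invmx A = invmx (T *m A) *m T.
  have uTA : T *m A \in unitmx by rewrite unitmx_mul uT.
  apply: (can_inj (mulmxK uA)); rewrite -mulmxA !mulVmx //.
rewrite mxE scaler_suml; apply: eq_bigr => k _.
by rewrite scalerA mulrC.
Qed.

Definition mx3 (s : seq (seq F)) : 'M[F]_3 := \matrix_(i, j) nth 0 (nth [::] s i) j.

Lemma mx3E s i j : mx3 s i j = nth 0 (nth [::] s i) j.
Proof. by rewrite mxE. Qed.

(* [t |-> t + a] on the parameter of a conic. *)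
Definition shift_mx (a : F) : 'M[F]_3 :=
  mx3 [:: [:: 1; a; a ^+ 2]; [:: 0; 1; 2%:R * a]; [:: 0; 0; 1]].

Definition swap_mx : 'M[F]_3 := mx3 [:: [:: 0; 0; 1]; [:: 0; 1; 0]; [:: 1; 0; 0]].

Lemma shift_unit a : shift_mx a \in unitmx.
Proof.
suff : shift_mx a *m shift_mx (- a) = 1%:M by case/mulmx1_unit.
apply/matrixP => i j; rewrite mxE sum3 !mx3E mxE.
by have [->|->|->] := ord3P i; have [->|->|->] := ord3P j; rewrite /=; ring.
Qed.

Lemma swap_unit : swap_mx \in unitmx.
Proof.
suff : swap_mx *m swap_mx = 1%:M by case/mulmx1_unit.
apply/matrixP => i j; rewrite mxE sum3 !mx3E mxE.
by have [->|->|->] := ord3P i; have [->|->|->] := ord3P j; rewrite /=; ring.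
Qed.

Lemma conic_form_shift a A : A \in unitmx ->
  conic_form (shift_mx a *m A) = conic_form A.
Proof.
move=> uA; rewrite [RHS]/conic_form !(ell_mulmx _ (shift_unit a) uA) !sum3 !mx3E /=.
by rewrite /conic_form -!mul_mpolyC expr2 mulr_natl mulr2n mpolyCD !mpolyCM mpolyC0 mpolyC1; ring.
Qed.

Lemma conic_form_swap A : A \in unitmx ->
  conic_form (swap_mx *m A) = conic_form A.
Proof.
move=> uA; rewrite [RHS]/conic_form !(ell_mulmx _ swap_unit uA) !sum3 !mx3E /=.
by rewrite /conic_form !scale0r !scale1r; ring.
Qed.

Lemma row_shift a A : row 0 (shift_mx a *m A) = param A a.
Proof.
rewrite row_mulmx; apply/rowP => i; rewrite sum3 !mx3E !mxE /= sum3.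
by rewrite !expr0 !expr1; ring.
Qed.

Lemma row0_swap A : row 0 (swap_mx *m A) = row 2%:R A.
Proof. by rewrite row_mulmx sum3 !mx3E /= !scale0r !add0r scale1r. Qed.

(** Translation by an element of F_5 commutes with t^5 - t. It moves a tangency point to the
    parameter 0, where the local computation is done; [hframe_swap] does the same for the point at
    infinity. *)
Lemma hframe_shift a A : a ^+ 5 = a -> hframe A -> hframe (shift_mx a *m A).
Proof.
move=> a5 [uA hA]; split; first by rewrite unitmx_mul shift_unit.
have e5 : 5%:R = 0 :> F := five0 charF.
have e32 : 2%:R ^+ 5 = 2%:R :> F.
  by apply/eqP; rewrite -subr_eq0; apply/eqP; transitivity (6%:R * 5%:R : F); [ring|rewrite e5 mulr0].
have a25 : (a ^+ 2) ^+ 5 = a ^+ 2 by rewrite exprAC a5.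
have a2a : (2%:R * a) ^+ 5 = 2%:R * a by rewrite exprMn a5 e32.
have fin (x y z : F) : x - y = 5%:R * z -> x = y.
  by rewrite e5 mul0r => /eqP; rewrite subr_eq0 => /eqP.
move=> i j; rewrite hf_row_mulmx sum3 !(sum3 (fun l => _ * hf _ (row l A))).
rewrite !hA /frame_form !mx3E.
have [->|->|->] := ord3P i; have [->|->|->] := ord3P j;
  rewrite /= ?a25 ?a2a ?expr0n ?expr1n ?a5 /=; ring.
Qed.

Lemma hframe_swap A : hframe A -> hframe (swap_mx *m A).
Proof.
move=> [uA hA]; split; first by rewrite unitmx_mul swap_unit.
move=> i j; rewrite hf_row_mulmx sum3 !(sum3 (fun l => _ * hf _ (row l A))).
rewrite !hA /frame_form !mx3E.
by have [->|->|->] := ord3P i; have [->|->|->] := ord3P j;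
  rewrite /= ?expr0n ?expr1n /=; ring.
Qed.

Lemma hframe_multiplicity A : hframe A ->
  intersection_multiplicity (conic_form A) (fermat F) (pt (row 0 A)) 2.
Proof.
move=> hA; rewrite -[conic_form A]scale1r.
apply: (multiplicity2 hA.1 _ _ (fermat_homog F) (r := ('X^4 - 1) ^+ 2)).
- exact/val_pt/row_neq0/hA.1.
- exact: oner_neq0.
- by rewrite !hornerE expr0n /= sub0r sqrrN expr1n oner_neq0.
- by rewrite restr_fermat_hframe //; ring.
Qed.

Lemma param_nat_pow n : n%:R ^+ 5 = n%:R :> F.
Proof. by rewrite -(pFrobenius_autE charF) rmorph_nat. Qed.

Lemma prime_field_root (t : F) : t ^+ 5 = t -> exists2 n, (n < 5)%N & t = n%:R.
Proof.
move=> e; have : t * (t - 1) * (t - 2%:R) * (t - 3%:R) * (t - 4%:R) = 0.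
  transitivity (t ^+ 5 - t + 5%:R * (- 2%:R * t ^+ 4 + 7%:R * t ^+ 3 - 10%:R * t ^+ 2 + 5%:R * t)); first by ring.
  by rewrite e (five0 charF) subrr mul0r addr0.
move/eqP; rewrite !mulf_eq0 !subr_eq0 -!orbA.
by case/or4P => [|||/orP []] /eqP ->; [exists 0%N|exists 1%N|exists 2%N|exists 3%N|exists 4%N].
Qed.

Lemma nat5_inj : {in gtn 5 &, injective (fun n => n%:R : F)}.
Proof.
move=> m n; rewrite !inE => hm hn e.
wlog le : m n hm hn e / (m <= n)%N.
  by move=> h; case/orP: (leq_total m n) => /h; [apply|move=> ->].
have : (5 %| n - m)%N by rewrite (dvdn_pcharf charF) natrB // e subrr.
move/dvdnP => [[|k]]; lia.
Qed.

Definition frame_points A : seq (proj_point F) :=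
  rcons [seq pt (param A n%:R) | n <- iota 0 5] (pt (row 2%:R A)).

Lemma frame_points_uniq A : A \in unitmx -> uniq (frame_points A).
Proof.
move=> uA; rewrite /frame_points rcons_uniq; apply/andP; split.
  by apply/mapP => -[n _ e]; apply: (param_neq_row2 (t := n%:R) uA).
rewrite map_inj_in_uniq ?iota_uniq // => m n; rewrite !mem_iota => hm hn.
by move/(param_eq uA)/nat5_inj; apply.
Qed.

Lemma hframe_Gamma A t : hframe A -> Gamma (pt (param A t)) <-> t ^+ 5 = t.
Proof.
move=> hA; rewrite (Gamma_pt (param_neq0 t hA.1)) -meval_fermat -horner_restr.
rewrite restr_fermat_hframe // !hornerE; split=> [/eqP|->]; last by rewrite subrr ?mul0r ?expr0n.
by rewrite ?expf_eq0 ?mulf_eq0 ?orbb /= subr_eq0 => /eqP.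
Qed.

Lemma hframe_meet A P : hframe A ->
  (conic_of A `&` (@Gamma F)) P <-> P \in frame_points A.
Proof.
move=> hA; have uA := hA.1; rewrite /frame_points mem_rcons inE; split.
  move=> [/(conic_ofP uA) [[t ->]|-> _]]; last by rewrite eqxx.
  move/(hframe_Gamma _ hA)/prime_field_root => [n n5 ->].
  by apply/orP; right; apply/mapP; exists n; rewrite ?mem_iota.
case/orP => [/eqP ->|/mapP [n _ ->]]; split.
- exact: conic_of_row2.
- apply/Gamma_pt; first exact: row_neq0.
  by rewrite hA.2.
- exact: conic_of_param.
- exact/(hframe_Gamma _ hA)/param_nat_pow.
Qed.

Lemma conic_form_nonsingular A : A \in unitmx -> nonsingular (conic_form A).
Proof.
move=> uA P; have [v v0 ->] := ptP P => _ h; case/negP: v0; apply/eqP.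
have dell i j : (ell A j)^`M(i) = (invmx A i j)%:MP.
  rewrite /ell raddf_sum /= (bigD1 i) //= big1 ?addr0.
    rewrite mderivZ mderivX mnm1E eqxx scale1r.
    have -> : (U_(i) - U_(i) = 0 :> 'X_{1..3})%MM by apply/mnmP => k; rewrite mnmBE mnm0E subnn.
    by rewrite mpolyX0 -mul_mpolyC mulr1.
  by move=> k /negPf nk; rewrite mderivZ mderivX mnm1E nk scale0r scaler0.
pose x := v *m invmx A.
(* The gradient of x_0 x_2 - x_1^2 in the dual coordinates; the gradient in the original coordinates
   is [invmx A *m y]. *)
pose y : 'cV[F]_3 := \col_j nth 0 [:: x 0 2%:R; - (2%:R * x 0 1); x 0 0] j.
have y0 : y = 0.
  suff : invmx A *m y = 0 by move/(congr1 (mulmx A)); rewrite mulKVmx // mulmx0.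
  apply/colP => i; rewrite mxE sum3 [RHS]mxE [y 0 0]mxE [y 1 0]mxE [y 2%:R 0]mxE /=.
  have hv : v \in val (pt v).
    by rewrite /= /pt_span; case: eqP => [->|_]; rewrite ?mem0v ?memv_line.
  have := h i v hv; rewrite /conic_form expr2 mderivB !mderivM !dell.
  rewrite !(mevalB, mevalD, mevalM, mevalC) !meval_ell -/x => e; rewrite -[RHS]e; ring.
have x0 : x = 0.
  have two0 : 2%:R != 0 :> F by rewrite -(dvdn_pcharf charF).
  have e j : y j 0 = 0 by rewrite y0 mxE.
  apply/rowP => i; rewrite [RHS]mxE.
  have [->|->|->] := ord3P i; [have := e 2%:R|have := e 1|have := e 0]; rewrite mxE //=.
  by move/eqP; rewrite oppr_eq0 mulf_eq0 (negPf two0) => /eqP.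
by rewrite -(mulmxKV uA v) -/x x0 mul0mx.
Qed.

Lemma hframe_calQ A : hframe A -> calQ (conic_of A).
Proof.
move=> hA; have uA := hA.1; exists (conic_form A); split=> //.
- exact: conic_form_homog.
- exact: conic_form_nonsingular.
- apply: (@has_card_image _ _ id (frame_points A)) => [|//|P].
    exact: frame_points_uniq.
  by rewrite (hframe_meet _ hA); split=> [|[_ ? ->]] //; exists P.
move=> P; rewrite -/(conic_of A) (hframe_meet _ hA) mem_rcons inE.
case/orP => [/eqP ->|/mapP [n _ ->]].
  rewrite -row0_swap -(conic_form_swap uA); apply: hframe_multiplicity.
  exact: hframe_swap.
rewrite -row_shift -(conic_form_shift n%:R uA); apply: hframe_multiplicity.
exact/hframe_shift/hA/param_nat_pow.
Qed.

End Reparametrization.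

(** * Quadratic forms, and frames of non-singular conics *)

Section QuadraticForms.
Variable F : fieldType.

Definition bil (S : 'M[F]_3) (u v : 'rV[F]_3) : F := (u *m S *m v^T) 0 0.

Lemma bilE S u v : bil S u v = \sum_i (u *m S) 0 i * v 0 i.
Proof. by rewrite /bil mxE; apply: eq_bigr => i _; rewrite [v^T i 0]mxE. Qed.

Lemma bilDl S u u' v : bil S (u + u') v = bil S u v + bil S u' v.
Proof. by rewrite /bil !mulmxDl mxE. Qed.

Lemma bilDr S u v v' : bil S u (v + v') = bil S u v + bil S u v'.
Proof. by rewrite /bil raddfD /= mulmxDr mxE. Qed.

Lemma bilZl S c u v : bil S (c *: u) v = c * bil S u v.
Proof. by rewrite /bil -!scalemxAl mxE. Qed.

Lemma bilZr S c u v : bil S u (c *: v) = c * bil S u v.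
Proof. by rewrite /bil linearZ /= -scalemxAr mxE. Qed.

Lemma bilC S u v : S^T = S -> bil S u v = bil S v u.
Proof.
move=> sS; have -> : bil S u v = (u *m S *m v^T)^T 0 0 by rewrite mxE.
by rewrite !trmx_mul trmxK sS mulmxA.
Qed.

Lemma delta_row (v : 'rV[F]_3) (i j k : 'I_3) : (v *m delta_mx i j) 0 k = v 0 i *+ (k == j).
Proof.
rewrite mxE (bigD1 i) //= big1 ?addr0 => [|l /negPf nl]; rewrite mxE ?nl ?mulr0 //.
by rewrite eqxx /= mulr_natr.
Qed.

Hypothesis two0 : 2%:R != 0 :> F.

(** The derivatives are recorded along with the values, as non-singularity is stated through partial
    derivatives and is needed as invertibility of S. *)
Definition has_gram (q : {mpoly F[3]}) :=
  exists S : 'M[F]_3, [/\ S^T = S, forall v : 'rV[F]_3, q.@[fun i => v 0 i] = bil S v v &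
    forall (v : 'rV[F]_3) i, (q^`M(i)).@[fun i => v 0 i] = 2%:R * (v *m S) 0 i].

Lemma has_gramD p q : has_gram p -> has_gram q -> has_gram (p + q).
Proof.
move=> [S [s1 s2 s3]] [S' [s1' s2' s3']]; exists (S + S'); split.
- by rewrite linearD /= s1 s1'.
- by move=> v; rewrite mevalD s2 s2' /bil mulmxDr mulmxDl [RHS]mxE.
- by move=> v i; rewrite mderivD mevalD s3 s3' -mulrDr mulmxDr [in RHS]mxE.
Qed.

Lemma has_gramZ c p : has_gram p -> has_gram (c *: p).
Proof.
move=> [S [s1 s2 s3]]; exists (c *: S); split.
- by rewrite linearZ /= s1.
- by move=> v; rewrite mevalZ s2 /bil -scalemxAr -scalemxAl [RHS]mxE.
- by move=> v i; rewrite mderivZ mevalZ s3 -scalemxAr [in RHS]mxE mulrCA.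
Qed.

Lemma has_gramXX i j : has_gram ('X_i * 'X_j).
Proof.
exists (2%:R^-1 *: (delta_mx i j + delta_mx j i)); split.
- by rewrite linearZ linearD /= !trmx_delta addrC.
- move=> v; rewrite mevalM !mevalXU bilE; under eq_bigr do rewrite -scalemxAr mxE mulmxDr mxE !delta_row.
  under eq_bigr do rewrite -mulrA mulrDl; rewrite -mulr_sumr big_split /=.
  rewrite (bigD1 j) //= eqxx [X in (_ + X + _)]big1 ?addr0 => [|k /negPf ->]; last by rewrite mul0r.
  rewrite (bigD1 i) //= eqxx [X in (_ + (_ + X))]big1 ?addr0 => [|k /negPf ->]; last by rewrite mul0r.
  by rewrite !mulr1n; field.
move=> v k; rewrite -scalemxAr mxE mulrA divff // mul1r mulmxDr mxE !delta_row.
have dX (l : 'I_3) : ('X_l : {mpoly F[3]})^`M(k) = (k == l)%:R%:MP.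
  rewrite mderivX mnm1E eq_sym; case: eqP => [->|_]; last by rewrite scale0r mpolyC0.
  have -> : (U_(l) - U_(l) = 0 :> 'X_{1..3})%MM by apply/mnmP => m; rewrite mnmBE mnm0E subnn.
  by rewrite mpolyX0 scale1r mpolyC1.
by rewrite mderivM !dX mevalD !mevalM !mevalC !mevalXU mulr_natl mulr_natr addrC.
Qed.

Lemma homog2_has_gram q : q \is 2.-homog -> has_gram q.
Proof.
move=> /dhomogP hq; rewrite (mpolyE q) big_seq; apply: big_ind => [||m /hq dm].
- exists 0; split=> [|v|v i]; rewrite ?trmx0 ?meval0 ?/bil ?mulmx0 ?mul0mx ?mderiv0 ?meval0 ?mxE ?mulr0 //.
- exact: has_gramD.
apply: has_gramZ; have [i [m' [dm' ->]]] := mnm_decomp F dm.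
have [j [m'' [/eqP dm'' ->]]] := mnm_decomp F dm'.
move: dm''; rewrite mdeg_eq0 => /eqP ->; rewrite mpolyX0 mul1r.
exact: has_gramXX.
Qed.
End QuadraticForms.

Section ConicFrame.
Variable F : closedFieldType.
Hypothesis two0 : 2%:R != 0 :> F.

Lemma horner_ext (p q : {poly F}) : (forall t, p.[t] = q.[t]) -> p = q.
Proof.
move=> h; apply/eqP; rewrite -subr_eq0; apply/negPn/negP => /closed_nonrootP [t].
by rewrite /root !hornerE h subrr eqxx.
Qed.

Lemma nonsingular_gram q (S : 'M[F]_3) : nonsingular q ->
  q \is 2.-homog ->
  (forall v : 'rV[F]_3, q.@[fun i => v 0 i] = bil S v v) ->
  (forall (v : 'rV[F]_3) i, (q^`M(i)).@[fun i => v 0 i] = 2%:R * (v *m S) 0 i) -> S \in unitmx.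
Proof.
move=> ns hq hS dS; rewrite unitmxE unitfE; apply/negP => /det0P [v v0 vS].
apply: (ns (pt v)); first by apply/(vanishes_pt hq v0); rewrite hS /bil vS mul0mx mxE.
move=> i w /(mem_pt _ v0) [c ->].
by rewrite dS -scalemxAl vS scaler0 mxE mulr0.
Qed.

(** Otherwise u and v span a totally isotropic plane, too large for a nondegenerate form in three
    variables. *)
Lemma isotropic_pair (S : 'M[F]_3) (u v : 'rV[F]_3) : S \in unitmx -> S^T = S ->
  u != 0 -> v != 0 -> pt u <> pt v -> bil S u u = 0 -> bil S v v = 0 -> bil S u v != 0.
Proof.
move=> uS sS u0 v0 nuv qu qv; apply/eqP => buv.
pose V : 'M[F]_(1 + 1, 3) := col_mx u v.
have fV : row_free V.
  apply: inj_row_free => x; rewrite -[x]hsubmxK mul_row_col => e.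
  have eu (y : 'M[F]_1) (w : 'rV[F]_3) : y *m w = y 0 0 *: w.
    by rewrite [y]mx11_scalar mul_scalar_mx mxE eqxx mulr1n.
  move: e; rewrite !eu => e.
  have x2 : rsubmx x 0 0 = 0.
    apply/eqP/contraT => n2; case: nuv; apply/esym/pt_eqP => //.
    have [z|n1] := eqVneq (lsubmx x 0 0) 0.
      by move: e; rewrite z scale0r add0r => /eqP; rewrite scaler_eq0 (negPf n2) (negPf v0).
    exists (- (lsubmx x 0 0)^-1 * rsubmx x 0 0).
    rewrite -scalerA scaleNr; apply: (scalerI n1).
    rewrite scalerN scalerA divff // scale1r.
    by apply/eqP; rewrite -addr_eq0 e.
  have x1 : lsubmx x 0 0 = 0.
    move: e; rewrite x2 scale0r addr0 => /eqP.
    by rewrite scaler_eq0 (negPf u0) orbF => /eqP.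
  have -> : lsubmx x = 0 by apply/rowP => i; rewrite ord1 x1 mxE.
  have -> : rsubmx x = 0 by apply/rowP => i; rewrite ord1 x2 mxE.
  by rewrite row_mx0.
have z : V *m S *m V^T = 0.
  rewrite /V tr_col_mx mul_col_mx mul_col_row.
  have e0 (a b : 'rV[F]_3) : bil S a b = 0 -> a *m S *m b^T = 0.
    by move=> h; apply/rowP => i; rewrite ord1 /bil in h *; rewrite h mxE.
  by rewrite !e0 // ?block_mx0 // bilC.
have := mulmx0_rank_max z; rewrite mxrank_tr mxrankMfree ?row_free_unit //.
by move/eqP: fV => ->.
Qed.

(** The frame is u, a vector n orthogonal to u and v, and a multiple of v. The form vanishes on the
    curve parametrized by it, hence is divisible by the conic form of the frame, and the degrees
    agree. *)
Lemma conic_frame (q : {mpoly F[3]}) (u v : 'rV[F]_3) : q \is 2.-homog -> nonsingular q ->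
  u != 0 -> v != 0 -> pt u <> pt v -> vanishes q (pt u) -> vanishes q (pt v) ->
  exists A, [/\ A \in unitmx, pt (row 0 A) = pt u, pt (row 2%:R A) = pt v &
    exists2 c, c != 0 & q = c *: conic_form A].
Proof.
move=> hq ns u0 v0 nuv /(vanishes_pt hq u0) qu /(vanishes_pt hq v0) qv.
have [S [sS hS dS]] := homog2_has_gram two0 hq.
have uS := nonsingular_gram ns hq hS dS.
rewrite hS in qu; rewrite hS in qv.
have buv := isotropic_pair uS sS u0 v0 nuv qu qv.
set be := bil S u v in buv.
have bvu : bil S v u = be by rewrite bilC.
have [n [n0 bun bvn]] : exists n, [/\ n != 0, bil S u n = 0 & bil S v n = 0].
  (* Orthogonality to u and v is two linear conditions on three coordinates, so a nonzero solution
     exists. *)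
  pose W : 'M[F]_(3, 1 + 1) := row_mx (u *m S)^T (v *m S)^T.
  have : kermx W != 0.
    rewrite kermx_eq0 /row_free neq_ltn; apply/orP; left.
    exact: leq_ltn_trans (rank_leq_col _) _.
  move/rowV0Pn => [n /sub_kermxP nW n0]; exists n.
  move: nW; rewrite /W mul_mx_row -[RHS]row_mx0 => /eq_row_mx [e1 e2].
  have e (w : 'rV[F]_3) : n *m (w *m S)^T = 0 -> bil S w n = 0.
    by move=> h; rewrite bilC // /bil -{1}sS -mulmxA -trmx_mul h mxE.
  by split=> //; apply: e.
pose ga := bil S n n.
(* The value of the form at u + t n + t^2 c v is t^2 (ga + 2 c be), which this choice makes zero. *)
pose c := - ga / (2%:R * be).
pose B (x y z : 'rV[F]_3) : 'M[F]_3 := col_mx x (col_mx y z).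
have rB x y z : [/\ row 0 (B x y z) = x, row 1 (B x y z) = y & row 2%:R (B x y z) = z].
  split; apply/rowP => i; rewrite !mxE.
  - by case: splitP => j //= _; rewrite ord1.
  - case: splitP => j //= ej; first by move: (ltn_ord j); rewrite -ej.
    rewrite mxE; case: splitP => k //= ek; first by rewrite ord1.
    by move: ej; rewrite ek.
  - case: splitP => j //= ej; first by move: (ltn_ord j); rewrite -ej.
    rewrite mxE; case: splitP => k //= ek; last by rewrite ord1.
    by move: ej; rewrite ek ord1.
have unitB (d : F) : d != 0 -> B u n (d *: v) \in unitmx.
  move=> d0; rewrite unitmxE unitfE; apply/negP => /det0P [x x0 xB].
  have [r0 r1 r2] := rB u n (d *: v).
  move: xB; rewrite mulmx_sum_row sum3 r0 r1 r2 scalerA => e.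
  have pair w : x 0 0 * bil S u w + x 0 1 * bil S n w + x 0 2%:R * d * bil S v w = 0.
    by rewrite -!bilZl -!bilDl e /bil !mul0mx mxE.
  have := pair v; rewrite -/be qv (bilC n v sS) bvn !mulr0 !addr0 => /eqP.
  rewrite mulf_eq0 (negPf buv) orbF => /eqP z0.
  have := pair u; rewrite qu (bilC n u sS) bun bvu !mulr0 !add0r => /eqP.
  rewrite !mulf_eq0 (negPf buv) (negPf d0) !orbF => /eqP z2.
  move: e; rewrite z0 z2 mul0r !scale0r add0r addr0 => /eqP.
  rewrite scaler_eq0 (negPf n0) orbF => /eqP z1.
  case/negP: x0; apply/eqP/rowP => i; rewrite mxE.
  by have [->|->|->] := ord3P i.
have ga0 : ga != 0.
  apply/eqP => g0; case/negP: n0; apply/eqP.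
  have uB := unitB 1 (oner_neq0 _); rewrite scale1r in uB.
  have : B u n v *m (n *m S)^T = 0.
    have [r0 r1 r2] := rB u n v.
    have e (w : 'rV[F]_3) : bil S w n = 0 -> w *m (n *m S)^T = 0.
      by move=> h; apply/rowP => i; rewrite ord1 trmx_mul sS mulmxA [RHS]mxE; exact: h.
    apply/row_matrixP => i; rewrite row_mul row0.
    by have [->|->|->] := ord3P i; rewrite ?r0 ?r1 ?r2 e.
  move/(congr1 (mulmx (invmx (B u n v)))); rewrite mulKmx // mulmx0 => /(congr1 trmx).
  rewrite trmxK trmx0 => /(congr1 (mulmx^~ (invmx S))); by rewrite mulmxK // mul0mx.
have c0 : c != 0.
  by rewrite /c mulf_neq0 ?oppr_eq0 // invr_eq0 mulf_neq0.
pose A := B u n (c *: v); have uA : A \in unitmx by apply: unitB.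
have [r0 r1 r2] := rB u n (c *: v).
have rq : restr A q = 0.
  apply: horner_ext => t; rewrite horner_restr hS horner0.
  have -> : param A t = u + t *: n + (t ^+ 2 * c) *: v.
    rewrite param_mul mulmx_sum_row sum3 r0 r1 r2 !mxE scalerA expr0 expr1 scale1r.
    by [].
  rewrite !(bilDl, bilDr, bilZl, bilZr) qu qv (bilC n u sS) (bilC n v sS) bun bvn bvu -/be -/ga.
  by rewrite /c; field; rewrite two0 buv.
exists A; split=> //; first by rewrite r0.
  by rewrite r2 ptZ.
have [b eb] := restr_eq0 uA hq rq.
have q0 : q != 0.
  apply/eqP => q0; case/eqP: ga0; rewrite /ga -hS q0 meval0 //.
have cf0 : conic_form A != 0 by apply: contraNneq q0 => z; rewrite eb z mulr0.
have b0 : b != 0 by apply: contraNneq q0 => z; rewrite eb z mul0r.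
(* Both forms have degree 2, so the quotient b is a constant. *)
have sz (p : {mpoly F[3]}) : p != 0 -> p \is 2.-homog -> msize p = 3%N.
  move=> p0 hp; have e : 2%N = (msize p).-1 := dhomog_uniq p0 hp (dhomog_msize hp).
  by have := msize_poly_eq0 p; rewrite (negPf p0); case: (msize p) e => // ? /= <-.
have := msizeM b0 cf0; rewrite -eb (sz _ q0 hq) (sz _ cf0 (conic_form_homog A)) => e.
have /eqP/msize_poly1P [d d0 ed] : msize b = 1%N.
  by move: e; case: (msize b) => [|[|k]] //; rewrite addSn /= addnC.
exists d => //; by rewrite eb ed mul_mpolyC.
Qed.
End ConicFrame.

(** * Totally tangent conics *)

Section Segre.
Variable F : closedFieldType.
Hypothesis charF : 5%N \in [pchar F].

Let two0 : 2%:R != 0 :> F.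
Proof. by rewrite -(dvdn_pcharf charF). Qed.

Lemma double_roots_dvdp (s : seq F) (g : {poly F}) : uniq s ->
  {in s, forall a, root g a /\ root g^`() a} -> (\prod_(a <- s) ('X - a%:P)) ^+ 2 %| g.
Proof.
have sq a : root g a -> root g^`() a -> ('X - a%:P) ^+ 2 %| g.
  move=> /factor_theorem [h ->]; rewrite derivM derivXsubC mulr1 /root hornerD hornerM.
  rewrite !hornerE subrr mulr0 add0r => /factor_theorem [k ->].
  by apply/dvdpP; exists k; rewrite expr2 mulrA.
elim: s => [|a s IH] /=; first by rewrite big_nil expr1n dvd1p.
move=> /andP [nas us] h; rewrite big_cons exprMn Gauss_dvdp.
  have [ra r'a] := h a (mem_head _ _); rewrite sq //= IH // => b bs.
  by apply: h; rewrite inE bs orbT.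
apply/coprimep_expl/coprimep_expr; rewrite coprimep_sym coprimep_XsubC.
by rewrite root_prod_XsubC.
Qed.

Lemma restr_shift (A : 'M[F]_3) a g : restr (shift_mx a *m A) g = restr A g \Po ('X + a%:P).
Proof.
apply: horner_ext => t; rewrite horner_comp !horner_restr !hornerE.
suff -> : param (shift_mx a *m A) t = param A (t + a) by [].
rewrite -!row_shift mulmxA; congr (row 0 (_ *m A)).
apply/matrixP => k l; rewrite mxE sum3 !mx3E.
by have [->|->|->] := ord3P k; have [->|->|->] := ord3P l; rewrite /=; ring.
Qed.

Lemma restr_fermat_coef (A : 'M[F]_3) :
  (restr A (fermat F))`_0 = hf (row 0 A) (row 0 A) /\
  (restr A (fermat F))`_1 = hf (row 1 A) (row 0 A).
Proof.
rewrite restr_fermat // !sum3 !(coefD, coefCM, coefXn) /=.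
by rewrite !mulr0 !addr0 !mulr1 add0r.
Qed.

(** The two values are the coefficients of 1 and t in the sextic restricted to the conic; a nonzero
    second one would be a simple zero, excluded by [not_multiplicity2]. *)
Lemma tangent_coef (A : 'M[F]_3) c : A \in unitmx -> c != 0 ->
  Gamma (pt (row 0 A)) ->
  intersection_multiplicity (c *: conic_form A) (fermat F) (pt (row 0 A)) 2 ->
  hf (row 0 A) (row 0 A) = 0 /\ hf (row 1 A) (row 0 A) = 0.
Proof.
move=> uA c0 /(Gamma_pt (row_neq0 0 uA)) h00 hm; split=> //; apply/eqP/negPn/negP => h10.
have [e0 e1] := restr_fermat_coef A; rewrite h00 in e0.
have /factor_theorem [r] : root (restr A (fermat F)) 0 by rewrite /root horner_coef0 e0.
rewrite polyC0 subr0 mulrC => er.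
apply: (not_multiplicity2 uA (val_pt (row_neq0 0 uA)) c0 (fermat_homog F) _ er hm).
by rewrite horner_coef0; move: e1; rewrite er coefXM /= => ->.
Qed.

(* Comparing the coefficients of [X], [X^6], [X^7] forces a monic quartic [K]
   with [K(0) != 0] whose square has this shape to be [X^4 - s]. *)
Lemma square_shape (K : {poly F}) (c h20 h01 h11 h21 h02 : F) :
  size K = 5 -> K \is monic -> K`_0 != 0 -> c != 0 ->
  h20%:P + h01%:P * 'X^3 + h11%:P * 'X^4 + h21%:P * 'X^5 + h02%:P * 'X^8 = c *: K ^+ 2 ->
  [/\ h01 = 0, h21 = 0, h02 = c, h11 = 2%:R * c * K`_0 & h20 = c * K`_0 ^+ 2].
Proof.
move=> sK mK k0 c0.
have : K = (K`_0)%:P + (K`_1)%:P * 'X + (K`_2)%:P * 'X^2 + (K`_3)%:P * 'X^3 + 'X^4.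
  have l4 : K`_4 = 1 by move/monicP: mK; rewrite /lead_coef sK.
  apply/polyP => i; rewrite !(coefD, coefCM, coefXn, coefC, coefX).
  do 5?[case: i => [|i]; rewrite /= ?mulr0 ?mulr1 ?add0r ?addr0 //].
  by rewrite nth_default // sK.
move: k0; move: (K`_0) (K`_1) (K`_2) (K`_3) => k0 k1 k2 k3 k00 ->.
have -> : (k0%:P + k1%:P * 'X + k2%:P * 'X^2 + k3%:P * 'X^3 + 'X^4) ^+ 2 =
  (k0 ^+ 2)%:P + (2%:R * k0 * k1)%:P * 'X + (2%:R * k0 * k2 + k1 ^+ 2)%:P * 'X^2 +
  (2%:R * k0 * k3 + 2%:R * k1 * k2)%:P * 'X^3 +
  (2%:R * k0 + 2%:R * k1 * k3 + k2 ^+ 2)%:P * 'X^4 +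
  (2%:R * k1 + 2%:R * k2 * k3)%:P * 'X^5 + (2%:R * k2 + k3 ^+ 2)%:P * 'X^6 +
  (2%:R * k3)%:P * 'X^7 + 'X^8 :> {poly F}.
  by rewrite !(polyCD, polyCM, polyC_exp, polyC_natr); ring.
move=> /polyP e.
move: (e 0) (e 1) (e 3) (e 4) (e 5) (e 6) (e 7) (e 8).
rewrite !(coefZ, coefD, coefCM, coefXn, coefC, coefX) /= !(mulr0, mulr1, addr0, add0r).
move=> -> /esym/eqP; rewrite !mulf_eq0 (negPf c0) (negPf two0) (negPf k00) /= => /eqP ->.
move=> -> -> ->.
move=> /esym e6 /esym/eqP; rewrite !mulf_eq0 (negPf c0) (negPf two0) /= => /eqP e7.
move: e6 => /eqP; rewrite e7 expr0n addr0 !mulf_eq0 (negPf c0) (negPf two0) /= => /eqP ->.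
by move=> ->; split; ring.
Qed.

(** Two of the six points are put at the parameters 0 and infinity. The other four are double roots
    of the restricted sextic, which is therefore d t^2 K(t)^2 with K a monic quartic. The sextic
    only has exponents i + 5 j, and this sparsity forces K = t^4 + K(0); a diagonal rescaling then
    gives (t^5 - t)^2. *)
Lemma calQ_hframe (Q : set (proj_point F)) : calQ Q ->
  exists2 A, hframe A & Q = conic_of A.
Proof.
move=> [q [hq ns eQ /has_card_seq [s [us ss hs]] hm]].
move: ss us hs; case: s => [|P0 [|Pi s]] // ss us hs.
have [u u0 eu] := ptP P0; have [v v0 ev] := ptP Pi.
have nuv : pt u <> pt v.
  by rewrite -eu -ev => e; move: us; rewrite /= e inE eqxx.
have P0s : (Q `&` (@Gamma F)) P0 by apply/hs; rewrite mem_head.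
have Pis : (Q `&` (@Gamma F)) Pi by apply/hs; rewrite !in_cons eqxx orbT.
have [A [uA e0 e2 [c c0 eq]]] : exists A, [/\ A \in unitmx, pt (row 0 A) = pt u, pt (row 2%:R A) = pt v &
    exists2 c, c != 0 & q = c *: conic_form A].
  apply: (conic_frame two0 hq ns u0 v0 nuv).
    by move: P0s => []; rewrite eQ /zeros /= eu.
  by move: Pis => []; rewrite eQ /zeros /= ev.
have eQA : Q = conic_of A.
  rewrite eQ /conic_of /zeros predeqE => P; have [w w0 ->] := ptP P.
  rewrite /= (vanishes_pt hq w0) (vanishes_pt (conic_form_homog A) w0) eq mevalZ.
  split=> [/eqP|->]; last by rewrite mulr0.
  by rewrite mulf_eq0 (negPf c0) => /eqP.
pose p := restr A (fermat F).
pose h i j := hf (row i A) (row j A).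
have ep : p = \sum_i \sum_j (h i j)%:P * 'X^(i + 5 * j) by apply: restr_fermat.
have tang t : (Q `&` (@Gamma F)) (pt (param A t)) -> root p t /\ root p^`() t.
  move=> Pt; have uT : shift_mx t *m A \in unitmx by rewrite unitmx_mul shift_unit.
  have [||h0 h1] := tangent_coef uT c0.
  - by rewrite row_shift; case: Pt.
  - by rewrite row_shift conic_form_shift // -eq; apply: hm.
  have [] := restr_fermat_coef (shift_mx t *m A); rewrite h0 h1 restr_shift -/p.
  move=> d0 d1; split; rewrite /root.
    by move: d0; rewrite -horner_coef0 horner_comp !hornerE => ->.
  have -> : p^`().[t] = (p \Po ('X + t%:P))`_1.
    rewrite -[1%N]/(0.+1) -[RHS]mulr1n -coef_deriv deriv_comp derivD derivX derivC addr0 mulr1.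
    by rewrite -horner_coef0 horner_comp !hornerE.
  by rewrite d1.
have tP P : P \in s -> exists t, [/\ P = pt (param A t), t != 0 & (Q `&` (@Gamma F)) P].
  move=> Ps; have Ps' : P \in [:: P0, Pi & s].
    by rewrite in_cons; apply/orP; right; rewrite in_cons; apply/orP; right.
  have QP := (hs P).2 Ps'.
  case: (QP) => + _; rewrite {1}eQA => /(conic_ofP uA) [[t et]|e]; last first.
    by move: us; rewrite /= ev -e2 -e Ps andbF.
  have nP : P <> P0 by move=> e; move: us; rewrite /= -e in_cons Ps orbT.
  exists t; split; [exact: et| |exact: QP].
  apply/negP => /eqP t0; apply: nP.
  rewrite et t0 eu -e0; congr pt; apply/rowP => i; exact: param0.
have [r [sr hr]] : exists r : seq F, s = [seq pt (param A t) | t <- r] /\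
   {in r, forall t, t != 0 /\ (Q `&` (@Gamma F)) (pt (param A t))}.
  elim: (s) tP => [|P s' IH] tP; first by exists [::].
  have [|r [-> hr]] := IH; first by move=> P' h'; apply: tP; rewrite inE h' orbT.
  have [t [-> t0 Qt]] := tP P (mem_head _ _); exists (t :: r); split=> // t'.
  by rewrite in_cons => /orP [/eqP ->|/hr].
have ur : uniq r by move: us; rewrite /= sr => /and3P [_ _ /map_uniq].
have szr : size r = 4 by move: ss; rewrite sr /= size_map => -[].
have [p0 p'0] : root p 0 /\ root p^`() 0.
  apply: tang; have -> : param A 0 = row 0 A by apply/rowP => i; exact: param0.
  by rewrite e0 -eu.
have [h00 h10] : h 0 0 = 0 /\ h 1 0 = 0.
  have [c_0 c_1] := restr_fermat_coef A; rewrite -/p -/(h _ _) -/(h _ _) in c_0 c_1.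
  move: p0 p'0; rewrite /root !horner_coef0 c_0 coef_deriv c_1 mulr1n.
  by move=> /eqP -> /eqP ->.
have [h22 h12] : h 2%:R 2%:R = 0 /\ h 1 2%:R = 0.
  have uT : swap_mx F *m A \in unitmx by rewrite unitmx_mul swap_unit.
  have [||] := tangent_coef uT c0.
  - by rewrite row0_swap e2 -ev; case: Pis.
  - by rewrite row0_swap conic_form_swap // -eq e2 -ev; apply: hm.
  have -> : row 1 (swap_mx F *m A) = row 1 A.
    by rewrite row_mulmx sum3 !mx3E /= !scale0r addr0 add0r scale1r.
  by rewrite row0_swap.
(* Tangency at 0 and infinity kills four Gram entries; the exponents i + 5 j of the remaining five
   are lowered by 2. *)
pose g := (h 2%:R 0)%:P + (h 0 1)%:P * 'X^3 + (h 1 1)%:P * 'X^4 + (h 2%:R 1)%:P * 'X^5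
          + (h 0 2%:R)%:P * 'X^8.
have epg : p = 'X^2 * g.
  rewrite ep !sum3 h00 h10 h22 h12 !polyC0 !mul0r /g.
  rewrite -[(0 + 5 * 1)%N]/5%N -[(0 + 5 * 2)%N]/10%N -[(1 + 5 * 1)%N]/6%N -[(2 + 5 * 0)%N]/2%N -[(2 + 5 * 1)%N]/7%N.
  ring.
pose K := \prod_(a <- r) ('X - a%:P).
have dK : K ^+ 2 %| g.
  apply: double_roots_dvdp => // t tr; have [t0 /tang [rp rp']] := hr t tr.
  have rg : root g t by move: rp; rewrite epg rootM => /orP [|//]; rewrite /root hornerXn expf_eq0 (negPf t0).
  split=> //; move: rp'; rewrite epg derivM /root hornerD hornerM (eqP rg) mulr0 add0r.
  by rewrite hornerM hornerXn mulf_eq0 expf_eq0 (negPf t0).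
(* If g were zero, the conic would lie on the curve, and a parameter different from 0 and from the
   roots of K would give a seventh common point. *)
have g0 : g != 0.
  apply/eqP => g0; have pz : p = 0 by rewrite epg g0 mulr0.
  have : 'X * K != 0 by rewrite mulf_neq0 ?polyX_eq0 // monic_neq0 // monic_prod_XsubC.
  move/closed_nonrootP => [t]; rewrite rootM negb_or => /andP [t0 rt].
  have : (Q `&` (@Gamma F)) (pt (param A t)).
    split; first by rewrite eQA; apply: conic_of_param.
    apply/(Gamma_pt (param_neq0 t uA)).
    by rewrite -meval_fermat -horner_restr -/p pz horner0.
  move/hs; rewrite !in_cons => /or3P [/eqP e|/eqP e|].
  - have e' : pt (param A t) = pt (param A 0).
      have -> : param A 0 = row 0 A by apply/rowP => i; exact: param0.
      by rewrite e0 e.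
    by move: t0; rewrite (param_eq uA e') /root hornerX eqxx.
  - by case: (param_neq_row2 (t := t) uA); rewrite e2 e.
  rewrite sr => /mapP [t' t'r /(param_eq uA) e].
  by move: rt; rewrite /K root_prod_XsubC e t'r.
have sK : size K = 5 by rewrite size_prod_XsubC szr.
have mK : K \is monic by apply: monic_prod_XsubC.
have [d ed] : exists d, g = d *: K ^+ 2.
  move/dvdpP: dK => [w ew]; have w0 : w != 0 by apply: contraNneq g0 => z; rewrite ew z mul0r.
  have sK2 : size (K ^+ 2) = 9 by rewrite expr2 size_monicM ?monic_neq0 // sK.
  have sg : (size g <= 9)%N.
    have sX (a : F) n : (n <= 8)%N -> (size (a%:P * 'X^n)%R <= 9)%N.
      by move=> n8; rewrite mul_polyC (leq_trans (size_scale_leq _ _)) // size_polyXn.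
    do 4?[apply: (leq_trans (size_polyD _ _)); rewrite geq_max; apply/andP; split];
      try exact: sX.
    by rewrite (leq_trans (size_polyC_leq1 _)).
  have : size w = 1%N.
    move: sg; rewrite ew size_Mmonic ?monic_exp // sK2.
    have : size w != 0%N by rewrite size_poly_eq0.
    by case: (size w) => [|[|k]] //; rewrite !addSn addnC.
  by move/eqP/size_poly1P => [d _ ed]; exists d; rewrite ew ed mul_polyC.
have d0 : d != 0 by apply: contraNneq g0 => z; rewrite ed z scale0r.
have K0 : K`_0 != 0.
  rewrite -horner_coef0; change (~~ root K 0); rewrite root_prod_XsubC.
  by apply/negP => /hr []; rewrite eqxx.
have [h01 h21 h02 h11 h20] := square_shape sK mK K0 d0 ed.
(* With mu^4 = -K(0), the substitution of mu t for t turns K into mu^4 (t^4 - 1). *)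
have [mu emu] := solve_monicpoly (fun i => if i == 0%N then - K`_0 else 0) (isT : (0 < 4)%N).
rewrite big_ord_recl /= expr0 mulr1 big1 ?addr0 in emu; last by move=> i _; rewrite mul0r.
have mu0 : mu != 0.
  by apply: contraNneq K0 => z; move: emu; rewrite z expr0n /= => /eqP; rewrite eq_sym oppr_eq0.
(* Scaling the frame by la multiplies its Gram matrix by la^6; this normalizes the entry (0, 2),
   which has become mu^10 d, to 1. *)
have [la ela] := solve_monicpoly (fun i => if i == 0%N then (mu ^+ 10 * d)^-1 else 0) (isT : (0 < 6)%N).
rewrite big_ord_recl /= expr0 mulr1 big1 ?addr0 in ela; last by move=> i _; rewrite mul0r.
have md0 : mu ^+ 10 * d != 0 by rewrite mulf_neq0 ?expf_neq0.
have la0 : la != 0.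
  apply/eqP => z; move: ela; rewrite z expr0n /= => /eqP.
  by rewrite eq_sym invr_eq0 (negPf md0).
pose T := mx3 [:: [:: la; 0; 0]; [:: 0; la * mu; 0]; [:: 0; 0; la * mu ^+ 2]] : 'M[F]_3.
have uT : T \in unitmx.
  suff : T *m mx3 [:: [:: la^-1; 0; 0]; [:: 0; (la * mu)^-1; 0]; [:: 0; 0; (la * mu ^+ 2)^-1]] = 1%:M by case/mulmx1_unit.
  apply/matrixP => i j; rewrite mxE sum3 !mx3E mxE.
  by have [->|->|->] := ord3P i; have [->|->|->] := ord3P j; rewrite /= ?(mulr0, mul0r, addr0, add0r) //;
    rewrite divff // ?mulf_neq0 ?expf_neq0.
have K0e : K`_0 = - mu ^+ 4 by rewrite emu opprK.
have de : la ^+ 6 * mu ^+ 10 * d = 1 by rewrite -mulrA ela mulVf.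
exists (T *m A).
  split; first by rewrite unitmx_mul uT.
  have key (x y z : F) : x * y * z = 1 -> x * y * z = 1 by [].
  move=> i j; rewrite hf_row_mulmx // sum3 !(sum3 (fun l => _ * hf _ (row l A))) -!/(h _ _).
  rewrite h00 h10 h22 h12 h01 h21 h02 h11 h20 K0e /frame_form !mx3E.
  have [->|->|->] := ord3P i; have [->|->|->] := ord3P j; rewrite /= ?expr0n /=; try ring.
  - by rewrite -[RHS]de; ring.
  - by rewrite -[RHS]mulr1 -[X in _ = _ * X]de; ring.
  - by rewrite -[RHS]de; ring.
rewrite eQA /conic_of /zeros predeqE => P; have [w w0 ->] := ptP P.
rewrite /= (vanishes_pt (conic_form_homog A) w0) (vanishes_pt (conic_form_homog _) w0).
have -> : conic_form A = ((la * mu) ^+ 2) *: conic_form (T *m A).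
  rewrite {1}/conic_form !(ell_mulmx _ uT uA) !sum3 !mx3E /= !scale0r !addr0 !add0r.
  rewrite /conic_form -!scalerAl -!scalerAr !scalerA !expr2 -!scalerAl -!scalerAr !scalerA scalerBr.
  by congr (_ *: _ - _ *: _); ring.
rewrite mevalZ; split=> [/eqP|->]; last by rewrite mulr0.
by rewrite mulf_eq0 expf_eq0 /= mulf_eq0 (negPf la0) (negPf mu0) => /eqP.
Qed.

End Segre.

(** * The unitary group *)

Section UnitaryGroup.
Variable F : closedFieldType.
Hypothesis charF : 5%N \in [pchar F].
Local Notation frob := (pFrobenius_aut charF).
Implicit Types A B C : 'M[F]_3.

Definition hgram A : 'M[F]_3 := A *m (map_mx frob A)^T.

Lemma hgramE A i j : hgram A i j = hf (row i A) (row j A).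
Proof.
by rewrite mxE; apply: eq_bigr => k _; rewrite !mxE pFrobenius_autE.
Qed.

Definition unitary B := hgram B = 1%:M.

Lemma unitary_unit B : unitary B -> B \in unitmx.
Proof. by move/mulmx1_unit => []. Qed.

Lemma hgram_mul A B : hgram (A *m B) = A *m hgram B *m (map_mx frob A)^T.
Proof. by rewrite /hgram map_mxM trmx_mul !mulmxA. Qed.

Lemma unitaryM B C : unitary B -> unitary C -> unitary (B *m C).
Proof. by move=> hB hC; rewrite /unitary hgram_mul hC mulmx1. Qed.

Lemma unitaryV B : unitary B -> unitary (invmx B).
Proof.
move=> hB; have uB := unitary_unit hB.
have h : hgram (invmx B *m B) = 1%:M.
  by rewrite mulVmx // /hgram map_mx1 trmx1 mulmx1.
by move: h; rewrite hgram_mul hB mulmx1.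
Qed.

Lemma unitary1 : unitary 1%:M.
Proof. by rewrite /unitary /hgram map_mx1 trmx1 mulmx1. Qed.

Lemma unitary_hf B (u v : 'rV[F]_3) : unitary B -> hf (u *m B) (v *m B) = hf u v.
Proof.
have e (x y : 'rV[F]_3) : hf x y = (x *m (map_mx frob y)^T) 0 0.
  by rewrite mxE; apply: eq_bigr => k _; rewrite !mxE pFrobenius_autE.
by move=> hB; rewrite !e map_mxM trmx_mul !mulmxA -(mulmxA u) -/(hgram B) hB mulmx1.
Qed.

Lemma unitary_frob2 B i j : unitary B -> B i j ^+ 25 = B i j.
Proof.
move=> hB; pose B1 := map_mx frob B; pose B2 := map_mx frob B1.
have h1 : B *m B1^T = 1%:M by [].
have h2 : B1 *m B2^T = 1%:M.
  by rewrite /B2 map_trmx -map_mxM h1 map_mx1.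
have e : B = B2.
  have h3 : B2 *m B1^T = 1%:M by rewrite -trmx1 -h2 trmx_mul trmxK.
  have uB1 : B1^T \in unitmx by have [] := mulmx1_unit h1.
  by apply: (can_inj (mulmxK uB1)); rewrite h1 h3.
rewrite {2}e !mxE !pFrobenius_autE -exprM //.
Qed.

Definition act B (P : proj_point F) : proj_point F := pt (vpick (val P) *m B).

Lemma vpick_pt (v : 'rV[F]_3) : v != 0 -> exists2 c, c != 0 & vpick (val (pt v)) = c *: v.
Proof.
move=> v0; have := memv_pick (val (pt v)) => /(mem_pt _ v0) [c e]; exists c => //.
apply/eqP => c0; move: e; rewrite c0 scale0r => /eqP; rewrite vpick0 val_pt //.
by move/eqP => e; move: (dim_vline v); rewrite e dimv0 v0.
Qed.

Lemma mulmx_neq0 (v : 'rV[F]_3) B : B \in unitmx -> v != 0 -> v *m B != 0.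
Proof.
move=> uB; apply: contraNneq => /(congr1 (mulmx^~ (invmx B))).
by rewrite mulmxK // mul0mx => ->.
Qed.

Lemma act_pt B v : B \in unitmx -> v != 0 -> act B (pt v) = pt (v *m B).
Proof.
move=> uB v0; rewrite /act; have [c c0 ->] := vpick_pt v0.
by rewrite -scalemxAl ptZ // mulmx_neq0.
Qed.

Lemma actM B C P : B \in unitmx -> C \in unitmx -> act (B *m C) P = act C (act B P).
Proof.
move=> uB uC; have [v v0 ->] := ptP P.
by rewrite !act_pt ?unitmx_mul ?uB ?mulmx_neq0 // mulmxA.
Qed.

Lemma act1 P : act 1%:M P = P.
Proof. by have [v v0 ->] := ptP P; rewrite act_pt ?unitmx1 ?mulmx1. Qed.

Lemma actK B : B \in unitmx -> cancel (act B) (act (invmx B)).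
Proof. by move=> uB P; rewrite -actM ?unitmx_inv // mulmxV // act1. Qed.

Lemma actKV B : B \in unitmx -> cancel (act (invmx B)) (act B).
Proof. by move=> uB P; rewrite -actM ?unitmx_inv // mulVmx // act1. Qed.

Lemma act_inj B : B \in unitmx -> injective (act B).
Proof. by move=> uB; apply: can_inj (actK uB). Qed.

Lemma actZ c B P : c != 0 -> B \in unitmx -> act (c *: B) P = act B P.
Proof.
move=> c0 uB; have [v v0 ->] := ptP P.
have ucB : c *: B \in unitmx by rewrite unitmxZ ?unitfE.
by rewrite !act_pt // -scalemxAr ptZ // mulmx_neq0.
Qed.

Lemma act_projectivity B : B \in unitmx -> projectivity (act B).
Proof.
move=> uB; exists (linfun (mulmxr B)).
  apply/lker0P => u v; rewrite !lfunE /=; exact: (can_inj (mulmxK uB)).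
move=> P; have [v v0 ->] := ptP P.
by rewrite act_pt // !val_pt ?mulmx_neq0 // limg_line lfunE.
Qed.

Lemma act_Gamma B P : unitary B -> Gamma (act B P) <-> Gamma P.
Proof.
move=> hB; have uB := unitary_unit hB; have [v v0 ->] := ptP P.
by rewrite act_pt // !Gamma_pt ?mulmx_neq0 // unitary_hf.
Qed.

Lemma act_Aut_Gamma B : unitary B -> Aut_Gamma (act B).
Proof.
move=> hB; have uB := unitary_unit hB; split; first exact: act_projectivity.
rewrite predeqE => P; split=> [[Q hQ <-]|hP]; first exact/act_Gamma.
by exists (act (invmx B) P); rewrite ?actKV //; apply/(act_Gamma _ (unitaryV hB)).
Qed.

Lemma act_calP B P : unitary B -> calP P -> calP (act B P).
Proof.
move=> hB [hP [v [v0 vP fv]]]; have uB := unitary_unit hB.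
split; first exact/act_Gamma.
have e : P = pt v.
  have [w w0 e] := ptP P; move: vP; rewrite e => /(mem_pt _ w0) [c ec].
  by apply/pt_eqP => //; exists c.
exists (v *m B); split; first exact: mulmx_neq0.
  by rewrite e act_pt // val_pt ?mulmx_neq0 // memv_line.
move=> i; rewrite mxE -[25%N]/(5 * 5)%N exprM !(frob_sum _ charF).
by apply: eq_bigr => k _; rewrite -exprM exprMn fv unitary_frob2.
Qed.

Lemma act_conic_of A B : A \in unitmx -> B \in unitmx ->
  act B @` conic_of A = conic_of (A *m B).
Proof.
move=> uA uB.
have key A' P : A' \in unitmx -> conic_of A' P -> forall C, C \in unitmx -> conic_of (A' *m C) (act C P).
  move=> uA'; have [v v0 ->] := ptP P => /(conic_of_pt _ v0) h C uC.
  rewrite act_pt //; apply/conic_of_pt; first exact: mulmx_neq0.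
  have -> : v *m C *m invmx (A' *m C) = v *m invmx A'; last exact: h.
  have uAC : A' *m C \in unitmx by rewrite unitmx_mul uA'.
  by apply: (can_inj (mulmxK uAC)); rewrite mulmxKV // mulmxA mulmxKV.
rewrite predeqE => P; split=> [[Q hQ <-]|hP]; first exact: key.
exists (act (invmx B) P); last by rewrite actKV.
have uAB : A *m B \in unitmx by rewrite unitmx_mul uA.
by have := key _ _ uAB hP (invmx B); rewrite mulmxK //; apply; rewrite unitmx_inv.
Qed.

Lemma hframe_hgram A A' : hframe A -> hframe A' -> hgram A = hgram A'.
Proof. by move=> [_ h] [_ h']; apply/matrixP => i j; rewrite !hgramE h h'. Qed.

(** Frames have one common Gram matrix, so the change of frame is an isometry; in particular the
    conics form a single orbit. *)
Lemma hframe_unitary A A' : hframe A -> hframe A' -> unitary (invmx A *m A').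
Proof.
move=> hA hA'; have uA := hA.1.
rewrite /unitary hgram_mul -(hframe_hgram hA hA') /hgram.
rewrite !mulmxA mulVmx // mul1mx -trmx_mul -map_mxM mulVmx //.
by rewrite map_mx1 trmx1.
Qed.

Lemma hframe_mul A B : hframe A -> unitary B -> hframe (A *m B).
Proof.
move=> [uA hA] hB; split; first by rewrite unitmx_mul uA unitary_unit.
by move=> i j; rewrite !row_mul unitary_hf.
Qed.

Lemma act_calQ B Q : unitary B -> calQ Q -> calQ (act B @` Q).
Proof.
move=> hB /(calQ_hframe charF) [A hA ->].
rewrite (act_conic_of hA.1 (unitary_unit hB)).
exact/(hframe_calQ charF)/hframe_mul.
Qed.

Lemma calQ_act A Q : hframe A -> calQ Q -> exists2 B, unitary B & Q = act B @` conic_of A.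
Proof.
move=> hA /(calQ_hframe charF) [A' hA' ->]; have uA := hA.1.
have hB := hframe_unitary hA hA'; exists (invmx A *m A') => //.
by rewrite (act_conic_of uA (unitary_unit hB)) mulKVmx.
Qed.

Lemma image_actM B C (X : set (proj_point F)) : B \in unitmx -> C \in unitmx ->
  act (B *m C) @` X = act C @` (act B @` X).
Proof.
move=> uB uC; rewrite predeqE => P; split=> [[Q hQ <-]|[_ [Q hQ <-] <-]].
  by rewrite actM //; exists (act B Q) => //; exists Q.
by exists Q; rewrite // actM.
Qed.

Lemma image_act1 (X : set (proj_point F)) : act 1%:M @` X = X.
Proof.
by rewrite predeqE => P; split=> [[Q hQ <-]|hP]; [rewrite act1|exists P; rewrite ?act1].
Qed.

Lemma image_actK B (X : set (proj_point F)) : B \in unitmx ->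
  act (invmx B) @` (act B @` X) = X.
Proof. by move=> uB; rewrite -image_actM ?unitmx_inv // mulmxV // image_act1. Qed.

Lemma image_actKV B (X : set (proj_point F)) : B \in unitmx ->
  act B @` (act (invmx B) @` X) = X.
Proof. by move=> uB; rewrite -image_actM ?unitmx_inv // mulVmx // image_act1. Qed.

End UnitaryGroup.

(** * Transport of the computations over F_25 to the field F *)

Lemma allf25P (p : f25 -> bool) : all p f25s -> forall x, p x.
Proof.
rewrite /f25s /= !andbT => h [a b].
by move: h; do ?[case/andP]; case: a; case: b; do ?[case/andP || move=> ?].
Qed.

Lemma eq5P x y : reflect (x = y) (eq5 x y).
Proof. by case: x; case: y; constructor. Qed.

Lemma eq25P x y : reflect (x = y) (eq25 x y).
Proof.
case: x y => [a b] [c d]; apply: (iffP andP) => [[/eq5P -> /eq5P ->]|[-> ->]] //.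
by split; apply/eq5P.
Qed.

Lemma eqvP u v : reflect (u = v) (eqv u v).
Proof.
case: u v => [[x y] z] [[x' y'] z'].
apply: (iffP and3P) => [[/eq25P -> /eq25P -> /eq25P ->]|[-> -> ->]] //.
by split; apply/eq25P.
Qed.

Lemma eqmP M N : reflect (M = N) (eqm M N).
Proof.
case: M N => [[x y] z] [[x' y'] z'].
apply: (iffP and3P) => [[/eqvP -> /eqvP -> /eqvP ->]|[-> -> ->]] //.
by split; apply/eqvP.
Qed.

Definition gen_mats_ok g :=
  [&& eqm (mulmm (gen_mat g) (trm (conjm (gen_mat g)))) idm,
      eqm (iter (gen_order g) (mulmm (gen_mat g)) idm) idm &
      all (fun i => (gen_act i g \in points) &&
        eqv (normalize (mulvm (coord i) (gen_mat g))) (coord (gen_act i g))) points].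

Lemma gen_matsP g : gen_mats_ok g.
Proof. by case: g; vm_compute. Qed.

Definition normalized (v : vec) :=
  let: (x, y, z) := v in
  eq25 x one25 || (eq25 x zero25 && (eq25 y one25 || (eq25 y zero25 && eq25 z one25))).

Definition herm25 (u v : vec) := dot u (conjv v).

Definition points_ok :=
  all (fun i => [&& normalized (coord i), eq25 (herm25 (coord i) (coord i)) zero25 &
     index_of (coord i) == i]) points.

Lemma points_okP : points_ok.
Proof. by vm_compute. Qed.

(** The two shapes exhaust the normalized isotropic vectors: (0, 0, 1) has norm 1. *)
Definition points_complete :=
  all (fun z => eq5 (norm25 z) E4 ==>
    let i := index_of (zero25, one25, z) in (i \in points) && eqv (coord i) (zero25, one25, z)) f25s
  && all (fun y => all (fun z => eq5 (add5 (norm25 y) (norm25 z)) E4 ==>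
    let i := index_of (one25, y, z) in (i \in points) && eqv (coord i) (one25, y, z)) f25s) f25s.

Lemma points_completeP : points_complete.
Proof. by vm_compute. Qed.

Section Model.
Variable F : closedFieldType.
Hypothesis charF : 5%N \in [pchar F].
Variable r : F.
Hypothesis r2 : r ^+ 2 = 2%:R.

Lemma natr_mod5 n : n%:R = (n %% 5)%N%:R :> F.
Proof. by rewrite {1}(divn_eq n 5) natrD natrM (five0 charF) mulr0 add0r. Qed.

Definition inF5 (x : f5) : F := (nat_of_f5 x)%:R.
Definition inF (x : f25) : F := let (a, b) := x in inF5 a + inF5 b * r.

Lemma inF5D x y : inF5 (add5 x y) = inF5 x + inF5 y.
Proof.
rewrite /inF5 -natrD [RHS]natr_mod5; congr (_%:R).
by case: x; case: y.
Qed.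

Lemma inF5M x y : inF5 (mul5 x y) = inF5 x * inF5 y.
Proof.
rewrite /inF5 -natrM [RHS]natr_mod5; congr (_%:R).
by case: x; case: y.
Qed.

Lemma inF5N x : inF5 (opp5 x) = - inF5 x.
Proof.
apply/eqP; rewrite -addr_eq0 -inF5D; apply/eqP.
by case: x.
Qed.

Lemma inF5_dbl x : inF5 (dbl5 x) = 2%:R * inF5 x.
Proof.
rewrite /inF5 -natrM [RHS]natr_mod5; congr (_%:R).
by case: x.
Qed.

Lemma inF5_frob x : inF5 x ^+ 5 = inF5 x.
Proof. exact: param_nat_pow. Qed.

Lemma inF5_eq0 x : inF5 x = 0 -> x = E0.
Proof.
move=> /eqP; rewrite /inF5 -(dvdn_pcharf charF).
by case: x.
Qed.

Lemma inFD x y : inF (add25 x y) = inF x + inF y.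
Proof. by case: x y => [a b] [c d]; rewrite /= !inF5D; ring. Qed.

Lemma inFN x : inF (opp25 x) = - inF x.
Proof. by case: x => [a b]; rewrite /= !inF5N; ring. Qed.

Lemma inFM x y : inF (mul25 x y) = inF x * inF y.
Proof.
case: x y => [a b] [c d]; rewrite /= !inF5D !inF5_dbl !inF5M -r2; ring.
Qed.

Lemma inF0 : inF zero25 = 0.
Proof. by rewrite /= /inF5 /= mul0r addr0. Qed.

Lemma inF1 : inF one25 = 1.
Proof. by rewrite /= /inF5 /= mul0r addr0. Qed.

Lemma r_frob : r ^+ 5 = - r.
Proof.
have -> : r ^+ 5 = (r ^+ 2) ^+ 2 * r by ring.
rewrite r2; have -> : 2%:R ^+ 2 * r = 5%:R * r - r by ring.
by rewrite (five0 charF) mul0r add0r.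
Qed.

Lemma inF_conj x : inF (conj25 x) = inF x ^+ 5.
Proof.
case: x => [a b]; rewrite /= inF5N frobD // exprMn !inF5_frob r_frob; ring.
Qed.

Lemma inF_norm x : inF5 (norm25 x) = inF x * inF (conj25 x).
Proof.
case: x => [a b]; rewrite /= inF5D !inF5N inF5_dbl !inF5M -r2; ring.
Qed.

Lemma inF_eq0 x : inF x = 0 -> x = zero25.
Proof.
move=> x0; have /inF5_eq0 : inF5 (norm25 x) = 0 by rewrite inF_norm x0 mul0r.
by case: x {x0} => [[] []].
Qed.

Lemma inF_inj : injective inF.
Proof.
move=> x y e; have : inF (add25 x (opp25 y)) = 0 by rewrite inFD inFN e subrr.
by move/inF_eq0; case: x {e} => [[] []]; case: y => [[] []].
Qed.

(** The 25 values of [inF] are already roots of X^25 - X, so there is no room for another root. *)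
Lemma inF_surj t : t ^+ 25 = t -> exists x, t = inF x.
Proof.
move=> ht; have [/existsP [x /eqP ->]|no] := boolP [exists x : 'I_25, t == inF (nth zero25 f25s x)].
  by eexists.
have u : uniq (t :: [seq inF (nth zero25 f25s (i : nat)) | i : 'I_25]).
  rewrite /= map_inj_uniq ?enum_uniq ?andbT.
    apply/mapP => -[i _ e]; case/negP: no; apply/existsP; exists i; exact/eqP.
  move=> i j /inF_inj e; apply: val_inj.
  by move: e; case: i => i hi; case: j => j hj /=;
    do 25?[case: i hi => [|i] hi; first by do 25?[case: j hj => [|j] hj //]].
have p0 : ('X^25 - 'X : {poly F}) != 0.
  by rewrite -size_poly_gt0 size_polyDl ?size_polyXn // size_polyN size_polyX.
have ar : all (root ('X^25 - 'X)) (t :: [seq inF (nth zero25 f25s (i : nat)) | i : 'I_25]).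
  apply/andP; split; first by rewrite /root !hornerE ht subrr.
  apply/allP => _ /mapP [i _ ->]; rewrite /root !hornerE.
  rewrite -[25%N]/(5 * 5)%N exprM -!inF_conj.
  by case: (nth zero25 f25s i) => [[] []]; rewrite subrr.
have := max_poly_roots p0 ar u.
by rewrite size_polyDl ?size_polyXn ?size_polyN ?size_polyX //= size_map size_enum_ord ltnn.
Qed.

Definition inV (v : vec) : 'rV[F]_3 :=
  let: (x, y, z) := v in \row_i nth 0 [:: inF x; inF y; inF z] i.

Definition inM (M : mat) : 'M[F]_3 :=
  let: (a, b, c) := M in \matrix_(i, j) nth 0 [:: inV a 0 j; inV b 0 j; inV c 0 j] i.

Lemma inV_scale c v : inV (scale25 c v) = inF c *: inV v.
Proof.
case: v => [[x y] z]; apply/rowP => i; rewrite !mxE !inFM.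
by have [->|->|->] := ord3P i.
Qed.

Lemma inV_add u v : inV (addv u v) = inV u + inV v.
Proof.
case: u v => [[x y] z] [[x' y'] z']; apply/rowP => i; rewrite !mxE !inFD.
by have [->|->|->] := ord3P i.
Qed.

Lemma row_inM M i : row i (inM M) = let: (a, b, c) := M in nth 0 [:: inV a; inV b; inV c] i.
Proof.
case: M => [[a b] c]; apply/rowP => j; rewrite !mxE.
by have [->|->|->] := ord3P i.
Qed.

Lemma inV_mul v M : inV (mulvm v M) = inV v *m inM M.
Proof.
rewrite mulmx_sum_row sum3 !row_inM; case: v M => [[x y] z] [[a b] c].
by rewrite /mulvm !inV_add !inV_scale !mxE /= addrA.
Qed.

Lemma inM_mul M N : inM (mulmm M N) = inM M *m inM N.
Proof.
apply/row_matrixP => i; rewrite row_mul !row_inM; case: M => [[a b] c].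
by have [->|->|->] := ord3P i; rewrite /= inV_mul.
Qed.

Lemma inM1 : inM idm = 1%:M.
Proof.
by apply/matrixP => i j; rewrite !mxE; have [->|->|->] := ord3P i;
  have [->|->|->] := ord3P j; rewrite /= ?mxE /= /inF5 /= ?mul0r ?addr0.
Qed.

Lemma inV_herm u v : hf (inV u) (inV v) = inF (herm25 u v).
Proof.
case: u v => [[x y] z] [[x' y'] z']; rewrite /hf sum3 !mxE /=.
by rewrite !inFD !inFM !inF_conj addrA.
Qed.

Lemma inM_hgram M : hgram charF (inM M) = inM (mulmm M (trm (conjm M))).
Proof.
apply/matrixP => i j; rewrite hgramE inM_mul mxE /hf; apply: eq_bigr => k _.
rewrite !mxE; congr (_ * _); case: M => [[[[a b] c] [[a' b'] c']] [[a'' b''] c'']].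
by rewrite !mxE; have [->|->|->] := ord3P j; have [->|->|->] := ord3P k; rewrite /= ?mxE /= inF_conj.
Qed.

Lemma inV_inj : injective inV.
Proof.
move=> [[x y] z] [[x' y'] z'] /rowP e.
move: (e 0) (e 1) (e 2%:R); rewrite !mxE /= => e0 e1 e2.
by rewrite (inF_inj e0) (inF_inj e1) (inF_inj e2).
Qed.

Lemma inV_eq0 v : inV v = 0 -> v = (zero25, zero25, zero25).
Proof. by move=> h; apply: inV_inj; rewrite h; apply/rowP => i; rewrite !mxE !inF0; case: i => [[|[|[|]]]]. Qed.

Lemma normalize_spec v : v <> (zero25, zero25, zero25) ->
  normalized (normalize v) /\ exists2 c, inF c != 0 & normalize v = scale25 c v.
Proof.
have inv_ok x : x <> zero25 -> mul25 (inv25 x) x = one25 /\ inF (inv25 x) != 0.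
  move=> x0; have e : mul25 (inv25 x) x = one25 by case: x x0 => [[] []] // [].
  split=> //; apply/eqP => z; have := inF1; rewrite -e inFM z mul0r => /eqP.
  by rewrite eq_sym oner_eq0.
have mul0 x : mul25 x zero25 = zero25 by case: x => [[] []].
case: v => [[x y] z] nz; rewrite /normalize.
case: (eq25P x zero25) => [x0|x0] /=; last first.
  have [e c0] := inv_ok x x0; split; first by rewrite /normalized /scale25 e.
  by exists (inv25 x).
case: (eq25P y zero25) => [y0|y0] /=; last first.
  have [e c0] := inv_ok y y0; split; first by rewrite /normalized /scale25 e x0 mul0.
  by exists (inv25 y).
have z0 : z <> zero25 by move=> z0; apply: nz; rewrite x0 y0 z0.
have [e c0] := inv_ok z z0; split; first by rewrite /normalized /scale25 e x0 y0 mul0.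
by exists (inv25 z).
Qed.

Definition Pt (i : point) : proj_point F := pt (inV (coord i)).

Lemma points_spec i : i \in points ->
  [/\ normalized (coord i), herm25 (coord i) (coord i) = zero25 & index_of (coord i) = i].
Proof. by move=> /(allP points_okP) /and3P [h /eq25P -> /eqP ->]. Qed.

Lemma normalized_neq0 v : normalized v -> inV v != 0.
Proof.
by move=> h; apply/eqP => /inV_eq0 e; move: h; rewrite e.
Qed.

Lemma Pt_neq0 i : i \in points -> inV (coord i) != 0.
Proof. by move/points_spec => [h _ _]; apply: normalized_neq0. Qed.

Lemma normalized_eq u v c : normalized u -> normalized v -> inV v = c *: inV u -> u = v.
Proof.
move=> nu nv e; suff c1 : c = 1 by apply: inV_inj; rewrite e c1 scale1r.
have nz : c != 0.
  apply/eqP => c0; have := normalized_neq0 nv; by rewrite e c0 scale0r eqxx.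
move: nu nv e; case: u v => [[x y] z] [[x' y'] z'] nu nv /rowP e.
move: (e 0) (e 1) (e 2%:R); rewrite !mxE /=.
have c0 x0 : 0 = c * inF x0 -> x0 = zero25.
  by move/esym/eqP; rewrite mulf_eq0 (negPf nz) => /eqP /inF_eq0.
have bad1 : 0 = c * 1 -> c = 1 by rewrite mulr1 => h; case/eqP: nz.
have bad2 : 1 = c * 0 -> c = 1 by rewrite mulr0 => /eqP; rewrite oner_eq0.
have good : 1 = c * 1 -> c = 1 by rewrite mulr1.
have /orP [/eq25P ex|/andP [/eq25P ex nu']] := nu;
  have /orP [/eq25P ex'|/andP [/eq25P ex' nv']] := nv; rewrite ex ex' ?inF1 ?inF0.
- by move=> /good.
- by move=> /bad1.
- by move=> /bad2.
have /orP [/eq25P ey|/andP [/eq25P ey /eq25P ez]] := nu';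
  have /orP [/eq25P ey'|/andP [/eq25P ey' /eq25P ez']] := nv'; rewrite ey ey' ?inF1 ?inF0.
- by move=> _ /good.
- by move=> _ /bad1.
- by move=> _ /bad2.
- by rewrite ez ez' inF1 => _ _ /good.
Qed.

Lemma Pt_inj : {in points &, injective Pt}.
Proof.
move=> i j hi hj /pt_eqP [||c e]; try exact: Pt_neq0.
have [ni _ ki] := points_spec hi; have [nj _ kj] := points_spec hj.
by rewrite -ki -kj (normalized_eq ni nj e).
Qed.

Lemma calP_Pt i : i \in points -> calP (Pt i).
Proof.
move=> hi; have [_ h0 _] := points_spec hi; have n0 := Pt_neq0 hi.
split; first by apply/(Gamma_pt n0); rewrite inV_herm h0 inF0.
exists (inV (coord i)); split=> //; first by rewrite val_pt // memv_line.
have f x : inF x ^+ 25 = inF x.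
  by rewrite -[25%N]/(5 * 5)%N exprM -!inF_conj; case: x => [[] []].
move=> j; case: (coord i) => [[x y] z]; rewrite mxE.
by have [->|->|->] := ord3P j; rewrite /= f.
Qed.

Lemma calP_index P : calP P -> exists2 i, i \in points & P = Pt i.
Proof.
move=> [hG [v [v0 vP fv]]].
have e : P = pt v.
  have [w w0 e] := ptP P; move: vP; rewrite e => /(mem_pt _ w0) [c ec].
  by apply/pt_eqP => //; exists c.
have [x ex] := inF_surj (fv 0); have [y ey] := inF_surj (fv 1); have [z ez] := inF_surj (fv 2%:R).
have ev : v = inV (x, y, z).
  by apply/rowP => i; rewrite mxE; have [->|->|->] := ord3P i.
have w0 : (x, y, z) <> (zero25, zero25, zero25).
  move=> h; case/negP: v0; apply/eqP; rewrite ev h.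
  by apply/rowP => i; rewrite !mxE !inF0; case: i => [[|[|[|]]]].
have [nw [c c0 ew]] := normalize_spec w0.
have eP : P = pt (inV (normalize (x, y, z))) by rewrite e ev ew inV_scale ptZ // -ev.
have iso : herm25 (normalize (x, y, z)) (normalize (x, y, z)) = zero25.
  apply: inF_eq0; rewrite -inV_herm; apply/(Gamma_pt (normalized_neq0 nw)).
  by rewrite -eP.
rewrite eP /Pt; move: nw iso; case: (normalize (x, y, z)) => [[a b] d] {eP ew}.
have norm_conj t : mul25 t (conj25 t) = (norm25 t, E0) by case: t => [[] []].
rewrite /normalized /herm25 /= !norm_conj => nw iso.
have [/allf25P c1 /allf25P c2] := andP points_completeP.
case/orP: nw iso => [/eq25P ->|/andP [/eq25P ->]].
  move=> iso; have h : eq5 (add5 (norm25 b) (norm25 d)) E4.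
    by move: iso; case: (norm25 b); case: (norm25 d).
  have := c2 b => /allf25P /(_ d); rewrite h /= => /andP [hi /eqvP e1].
  by exists (index_of (one25, b, d)) => //; rewrite e1.
case/orP => [/eq25P ->|/andP [/eq25P -> /eq25P ->]]; last by [].
move=> iso; have h : eq5 (norm25 d) E4 by move: iso; case: (norm25 d).
have := c1 d; rewrite h /= => /andP [hi /eqvP e1].
by exists (index_of (zero25, one25, d)) => //; rewrite e1.
Qed.

Definition genM g := inM (gen_mat g).
Definition wordM (w : word) : 'M[F]_3 := foldl (fun M g => M *m genM g) 1%:M w.

Lemma wordM_rcons w g : wordM (rcons w g) = wordM w *m genM g.
Proof. by rewrite /wordM foldl_rcons. Qed.

Lemma wordM_cat w w' : wordM (w ++ w') = wordM w *m wordM w'.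
Proof.
elim/last_ind: w' => [|w' g IH]; first by rewrite cats0 mulmx1.
by rewrite -rcons_cat !wordM_rcons IH mulmxA.
Qed.

Lemma genM_unitary g : unitary charF (genM g).
Proof.
by have /and3P [/eqmP h _ _] := gen_matsP g; rewrite /unitary inM_hgram h inM1.
Qed.

Lemma wordM_unitary w : unitary charF (wordM w).
Proof.
elim/last_ind: w => [|w g IH]; first exact: unitary1.
by rewrite wordM_rcons; apply: unitaryM => //; apply: genM_unitary.
Qed.

Lemma wordM_unit w : wordM w \in unitmx.
Proof. exact/unitary_unit/wordM_unitary. Qed.

(** An inverse written as a positive word, so that the tables of the generators also serve for
    inverses. *)
Definition winv (w : word) : word := flatten [seq nseq (gen_order g).-1 g | g <- rev w].

Lemma wordM_winv w : wordM w *m wordM (winv w) = 1%:M.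
Proof.
elim: w => [|g w IH]; first by rewrite mulmx1.
have e g' : wordM [:: g'] = genM g' by rewrite /wordM /= mul1mx.
rewrite /winv rev_cons map_rcons flatten_rcons wordM_cat -/(winv w) -cat1s wordM_cat e.
rewrite -mulmxA [X in _ *m X]mulmxA IH mul1mx -e -wordM_cat cat1s.
have /and3P [_ /eqmP h _] := gen_matsP g.
have -> : g :: nseq (gen_order g).-1 g = nseq (gen_order g) g by case: g {h}.
rewrite -inM1 -h; elim: (gen_order g) => [|n IHn]; first by rewrite inM1.
by rewrite iterS inM_mul -IHn -[nseq n.+1 g]cat1s wordM_cat e.
Qed.

Lemma gen_act_points i g : i \in points -> gen_act i g \in points.
Proof. by have /and3P [_ _ /allP h] := gen_matsP g; move=> /h /andP []. Qed.

Lemma word_act_points i w : i \in points -> word_act w i \in points.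
Proof.
by move=> hi; rewrite /word_act; elim: w i hi => //= g w IH i hi; apply/IH/gen_act_points.
Qed.

Lemma act_Pt_gen i g : i \in points -> act (genM g) (Pt i) = Pt (gen_act i g).
Proof.
move=> hi; have ug := unitary_unit (genM_unitary g).
have /and3P [_ _ /allP /(_ i hi) /andP [_ /eqvP e]] := gen_matsP g.
have n0 := Pt_neq0 hi; rewrite /Pt act_pt // -e.
have nz : mulvm (coord i) (gen_mat g) <> (zero25, zero25, zero25).
  move=> h; have := mulmx_neq0 ug n0; rewrite -inV_mul h => /eqP; apply.
  by apply/rowP => j; rewrite !mxE !inF0; case: j => [[|[|[|]]]].
have [_ [c c0 ->]] := normalize_spec nz.
by rewrite inV_scale inV_mul ptZ // mulmx_neq0.
Qed.

Lemma act_Pt i w : i \in points -> act (wordM w) (Pt i) = Pt (word_act w i).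
Proof.
move=> hi; elim/last_ind: w => [|w g IH]; first by rewrite act1.
rewrite wordM_rcons actM ?wordM_unit ?(unitary_unit (genM_unitary g)) // IH.
by rewrite act_Pt_gen ?word_act_points // /word_act foldl_rcons.
Qed.

Lemma word_act_inj w : {in points &, injective (word_act w)}.
Proof.
move=> i j hi hj e; apply: Pt_inj => //; apply: (act_inj (wordM_unit w)).
by rewrite !act_Pt // e.
Qed.

End Model.

Arguments inF : simpl never.

(** * The five generators give all isometries up to scalars *)

Section Generation.
Variable F : closedFieldType.
Hypothesis charF : 5%N \in [pchar F].
Variable r : F.
Hypothesis r2 : r ^+ 2 = 2%:R.
Local Notation inF := (inF r).
Local Notation inV := (inV r).
Local Notation wordM := (wordM r).
Local Notation Pt := (Pt r).
Local Notation unitary := (unitary charF).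

Lemma transitive_points i : i \in points -> exists w, word_act w pole1 = i.
Proof.
have /and3P [/allP h _ _] := poles_okP.
by move=> /h /(pmem_map (all_predT _)) [w _ e]; exists w.
Qed.

Lemma transitive_stab_pole1 i : i \in points -> i != pole1 ->
  exists2 w, word_act w pole1 = pole1 & word_act w pole2 = i.
Proof.
have /and3P [_ h1 /allP h2] := poles_okP.
move=> /h2 /orP [/Pos.eqb_spec -> /eqP //|] /(pmem_map h1) [w /Pos.eqb_spec f1 f2] _.
by exists w.
Qed.

Let v1 := inV (coord pole1).
Let v2 := inV (coord pole2).
Let v3 := inV (zero25, zero25, one25).
Let N : 'M[F]_3 := \matrix_(i, j) nth 0 [:: v1 0 j; v2 0 j; v3 0 j] i.

Let rowN i : row i N = nth 0 [:: v1; v2; v3] i.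
Proof. by apply/rowP => j; rewrite mxE mxE; have [->|->|->] := ord3P i. Qed.

Let a := inF (decode25 6).
Let v1E : v1 = \row_i nth 0 [:: 1; a; 0] i.
Proof.
rewrite /v1 -[coord pole1]/(one25, decode25 6, zero25); apply/rowP => i; rewrite !mxE.
by have [->|->|->] := ord3P i; rewrite /= ?(inF0 r) ?(inF1 r).
Qed.
Let v2E : v2 = \row_i nth 0 [:: 1; - a; 0] i.
Proof.
rewrite /v2 -[coord pole2]/(one25, opp25 (decode25 6), zero25); apply/rowP => i.
rewrite !mxE /a -inFN //.
by have [->|->|->] := ord3P i; rewrite /= ?(inF0 r) ?(inF1 r).
Qed.
Let v3E : v3 = \row_i nth 0 [:: 0; 0; 1] i.
Proof.
apply/rowP => i; rewrite !mxE.
by have [->|->|->] := ord3P i; rewrite /= ?(inF0 r) ?(inF1 r).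
Qed.
Let a6 : a * a ^+ 5 = -1.
Proof. by rewrite -inF_conj // -inFM // -(inF1 r) -inFN. Qed.
Let two0 : 2%:R != 0 :> F.
Proof. by rewrite -(dvdn_pcharf charF). Qed.
Let a0 : a != 0.
Proof.
by apply/eqP => z; move/eqP: a6; rewrite z mul0r eq_sym oppr_eq0 oner_eq0.
Qed.

Let hfE (u w : 'rV[F]_3) : hf u w = u 0 0 * w 0 0 ^+ 5 + u 0 1 * w 0 1 ^+ 5 + u 0 2%:R * w 0 2%:R ^+ 5.
Proof. by rewrite /hf sum3. Qed.

Let N_unit : N \in unitmx.
Proof.
rewrite unitmxE unitfE; apply/negP => /det0P [x x0 e]; case/negP: x0; apply/eqP.
move: e; rewrite mulmx_sum_row sum3 !rowN /= v1E v2E v3E => /rowP e.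
move: (e 0) (e 1) (e 2%:R); rewrite !mxE /= !(mulr0, mulr1, addr0, add0r) => e0 e1 e2.
have h01 : x 0 0 = x 0 1.
  move/eqP: e1; rewrite mulrN -mulrBl mulf_eq0 (negPf a0) orbF subr_eq0.
  by move/eqP.
have h0 : x 0 0 = 0.
  move/eqP: e0; rewrite -h01 -mulr2n -mulr_natl mulf_eq0 (negPf two0) => /eqP //.
apply/rowP => i; rewrite mxE.
by have [->|->|->] := ord3P i; rewrite ?e2 -?h01 ?h0.
Qed.

Lemma torus_pow k :
  [/\ v1 *m wordM (nseq k Gt) = inF zeta25 ^+ k *: v1,
      v2 *m wordM (nseq k Gt) = inF zeta25' ^+ k *: v2 &
      v3 *m wordM (nseq k Gt) = v3].
Proof.
have /and5P [/eqvP h1 /eqvP h2 /eqvP h3 _ _] := torus_okP.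
elim: k => [|k [i1 i2 i3]]; first by rewrite /= !mulmx1 !expr0 !scale1r.
have -> : nseq k.+1 Gt = rcons (nseq k Gt) Gt by elim: k {i1 i2 i3} => //= k ->.
rewrite wordM_rcons !mulmxA i1 i2 i3 -!scalemxAl !exprSr -!scalerA.
by rewrite -!inV_mul // h1 h2 h3 !inV_scale.
Qed.

(** B scales both poles, hence also the vector v3 orthogonal to them. Preservation of h ties the two
    eigenvalues on the poles together and gives nu^6 = 1, leaving modulo scalars the 24 powers of
    [Gt]. *)
Lemma torus_word B : unitary B -> act B (Pt pole1) = Pt pole1 ->
  act B (Pt pole2) = Pt pole2 -> exists k c, c != 0 /\ B = c *: wordM (nseq k Gt).
Proof.
move=> hB; have uB := unitary_unit hB.
have n1 : v1 != 0 by apply: Pt_neq0.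
have n2 : v2 != 0 by apply: Pt_neq0.
rewrite /Pt !act_pt // => /esym/pt_eqP h /esym/pt_eqP h'.
have [la e1] := h n1 (mulmx_neq0 uB n1); have [mu e2] := h' n2 (mulmx_neq0 uB n2).
have k12 : hf v1 v2 = 2%:R.
  by rewrite v1E v2E hfE !mxE /= expr1n exprNn mulr1 expr0n mul0r addr0 mulrCA a6; ring.
have k21 : hf v2 v1 = 2%:R.
  by rewrite v1E v2E hfE !mxE /= expr1n mulr1 expr0n mul0r addr0 mulNr a6; ring.
have lm : la * mu ^+ 5 = 1.
  have := unitary_hf v1 v2 hB; rewrite e1 e2 hfZl hfZr k12 mulrA => e.
  by apply: (mulIf two0); rewrite e mul1r.
have ml : mu * la ^+ 5 = 1.
  have := unitary_hf v2 v1 hB; rewrite e1 e2 hfZl hfZr k21 mulrA => e.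
  by apply: (mulIf two0); rewrite e mul1r.
have la0 : la != 0 by apply/eqP => z; move/eqP: lm; rewrite z mul0r eq_sym oner_eq0.
have mu0 : mu != 0 by apply/eqP => z; move/eqP: ml; rewrite z mul0r eq_sym oner_eq0.
have [w ew] : exists w, w = v3 *m B by eexists.
pose nu := w 0 2%:R.
have o31 : hf v3 v1 = 0 by rewrite v3E v1E hfE !mxE /= expr0n !mul0r !mulr0 !addr0.
have o32 : hf v3 v2 = 0 by rewrite v3E v2E hfE !mxE /= expr0n !mul0r !mulr0 !addr0.
have ow1 : hf w v1 = 0.
  have := unitary_hf v3 v1 hB; rewrite -ew e1 hfZr o31 => /eqP.
  by rewrite mulf_eq0 expf_eq0 (negPf la0) andbF => /eqP.
have ow2 : hf w v2 = 0.
  have := unitary_hf v3 v2 hB; rewrite -ew e2 hfZr o32 => /eqP.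
  by rewrite mulf_eq0 expf_eq0 (negPf mu0) andbF => /eqP.
have e3 : w = nu *: v3.
  move: ow1 ow2; rewrite v1E v2E !hfE !mxE /= expr1n !mulr1 !expr0n !mulr0 !addr0 exprNn => p1 p2.
  have w0 : w 0 0 = 0.
    have p3 := congr2 +%R p1 p2; rewrite addr0 in p3.
    by apply: (mulfI two0); rewrite mulr0 -[RHS]p3; ring.
  have w1 : w 0 1 = 0.
    move/eqP: p1; rewrite w0 add0r mulf_eq0 expf_eq0 (negPf a0) andbF orbF => /eqP //.
  apply/rowP => i; rewrite v3E !mxE.
  by have [->|->|->] := ord3P i; rewrite /= ?mulr0 ?mulr1 ?w0 ?w1.
have nu6 : nu * nu ^+ 5 = 1.
  have := unitary_hf v3 v3 hB; rewrite -ew e3 hfZl hfZr.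
  by rewrite v3E hfE !mxE /= expr0n expr1n !mul0r !add0r !mulr1.
have nu0 : nu != 0 by apply/eqP => z; move/eqP: nu6; rewrite z mul0r eq_sym oner_eq0.
have la25 : la ^+ 25 = la.
  have h25 : mu ^+ 5 * la ^+ 25 = 1 by rewrite -[25%N]/(5 * 5)%N exprM -exprMn ml expr1n.
  by apply: (mulfI (expf_neq0 5 mu0)); rewrite h25 mulrC lm.
have nu25 : nu ^+ 25 = nu.
  have h6 : nu ^+ 6 = 1 by rewrite exprS nu6.
  by rewrite -[25%N]/(6 * 4).+1 exprS exprM h6 expr1n mulr1.
(* Dividing B by nu makes it fix v3; the remaining eigenvalue la / nu is a nonzero element of F_25,
   hence a power of [zeta25], and mu is then forced by mu la^5 = 1. *)
have [x ex] : exists x, la / nu = inF x.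
  by apply: inF_surj => //; rewrite expr_div_n la25 nu25.
have /and5P [_ _ _ /eq25P z55 /allf25P /(_ x)] := torus_okP.
have inF_pow y k : inF (pow25 y k) = inF y ^+ k.
  by elim: k => [|k IH]; rewrite ?inF1 // /pow25 iterS inFM // IH exprS.
case/orP => [/eq25P x0|/hasP [k _ /eq25P ek]].
  by move/eqP: ex; rewrite x0 inF0 mulf_eq0 invr_eq0 (negPf la0) (negPf nu0).
exists k, nu; split=> //.
have [t1 t2 t3] := torus_pow k.
have el : la = nu * inF zeta25 ^+ k by rewrite -inF_pow -ek -ex mulrC divfK.
have em : mu = nu * inF zeta25' ^+ k.
  have zz : (inF zeta25 ^+ k) ^+ 5 * inF zeta25' ^+ k = 1.
    by rewrite exprAC -exprMn -inF_pow -inFM // z55 inF1 expr1n.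
  apply: (mulIf (expf_neq0 5 la0)); rewrite ml {1}el.
  have -> : nu * inF zeta25' ^+ k * (nu * inF zeta25 ^+ k) ^+ 5 =
    (nu * nu ^+ 5) * ((inF zeta25 ^+ k) ^+ 5 * inF zeta25' ^+ k) by rewrite exprMn; ring.
  by rewrite nu6 zz mulr1.
apply: (can_inj (mulKmx N_unit)); apply/row_matrixP => i.
rewrite !row_mul !rowN -scalemxAr.
have [->|->|->] := ord3P i; rewrite /= ?t1 ?t2 ?t3 ?e1 ?e2 ?scalerA.
- by rewrite el.
- by rewrite em.
- by rewrite -ew e3.
Qed.

(** Double transitivity of the words on the rational points reduces B, after two corrections, to an
    isometry fixing both poles. *)
Lemma unitary_word B : unitary B -> exists w c, c != 0 /\ B = c *: wordM w.
Proof.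
move=> hB; have uB := unitary_unit hB.
have p1 : pole1 \in points by []. have p2 : pole2 \in points by [].
have [i hi ei] := calP_index charF r2 (act_calP hB (calP_Pt charF r2 p1)).
have [w ew] := transitive_points hi.
have uw := wordM_unit charF r2 w; have hw := wordM_unitary charF r2 w.
pose B1 := B *m invmx (wordM w).
have hB1 : unitary B1 by apply/unitaryM/unitaryV.
have f1 : act B1 (Pt pole1) = Pt pole1.
  rewrite /B1 actM ?unitmx_inv // ei -ew -(act_Pt charF r2) // actK //.
have [j hj ej] := calP_index charF r2 (act_calP hB1 (calP_Pt charF r2 p2)).
have nj : j != pole1.
  apply/eqP => z; have := act_inj (unitary_unit hB1) (etrans ej _) .
  move=> /(_ (Pt pole1)); rewrite f1 z => /(_ erefl) /(Pt_inj charF r2 p2 p1).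
  by [].
have [w' ew1 ew2] := transitive_stab_pole1 hj nj.
have uw' := wordM_unit charF r2 w'; have hw' := wordM_unitary charF r2 w'.
pose B2 := B1 *m invmx (wordM w').
have hB2 : unitary B2 by apply/unitaryM/unitaryV.
have g1 : act B2 (Pt pole1) = Pt pole1.
  by rewrite /B2 actM ?unitmx_inv ?(unitary_unit hB1) // f1 -{1}ew1 -(act_Pt charF r2) // actK.
have g2 : act B2 (Pt pole2) = Pt pole2.
  by rewrite /B2 actM ?unitmx_inv ?(unitary_unit hB1) // ej -ew2 -(act_Pt charF r2) // actK.
have [k [c [c0 e]]] := torus_word hB2 g1 g2.
exists (nseq k Gt ++ w' ++ w), c; split=> //.
rewrite !wordM_cat scalemxAl -e /B2 /B1 !mulmxA mulmxKV // mulmxKV //.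
Qed.
End Generation.

(** * Equivariance *)

Lemma has_card_inj_image (T U : Type) (f : T -> U) (A : set T) n : injective f ->
  has_card (f @` A) n <-> has_card A n.
Proof.
move=> inj; have e : (f @` A #= A)%card by apply: inj_card_eq => x y _ _ /inj.
split=> h; [apply: card_eq_trans h; exact: card_esym|exact: card_eq_trans h].
Qed.

Lemma image_injI (T U : Type) (f : T -> U) (A B : set T) : injective f ->
  f @` (A `&` B) = f @` A `&` f @` B.
Proof.
move=> inj; rewrite predeqE => y; split=> [[x [Ax Bx] <-]|[[x Ax <-] [z Bz /inj e]]].
  by split; exists x.
by exists x => //; split=> //; rewrite -e.
Qed.

Lemma image_inj (T U : Type) (f : T -> U) : injective f -> injective (fun A : set T => f @` A).
Proof.
move=> inj A B e; rewrite predeqE => x; split=> h.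
  have [y By /inj <-] : (f @` B) (f x) by rewrite -e; exists x.
  by [].
have [y By /inj <-] : (f @` A) (f x) by rewrite e; exists x.
by [].
Qed.

Section Components.
Variables (T : Type) (V : set T) (e : T -> T -> Prop).
Local Notation linked := (clos_refl_sym_trans T (adjacent V e)).

Lemma linked_vertex x y : linked x y -> V x <-> V y.
Proof.
elim=> [a b [Va Vb _ _]|a|a b _ IH|a b c _ IH1 _ IH2] //.
  by rewrite IH.
by rewrite IH1.
Qed.

Lemma component_eq C x : components V e C -> C x -> C = [set y | linked x y].
Proof.
move=> [z Vz ->] /= zx; rewrite predeqE => y; split=> h.
  exact: rst_trans (rst_sym _ _ _ _ zx) h.
exact: rst_trans zx h.
Qed.

Lemma component_vertex C x : components V e C -> C x -> V x.
Proof. by move=> [z Vz ->] /= /linked_vertex <-. Qed.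

Lemma component_inhabited C : components V e C -> exists x, C x.
Proof. by move=> [x Vx ->]; exists x; apply: rst_refl. Qed.

Lemma component_meet C C' x : components V e C -> components V e C' ->
  C x -> C' x -> C = C'.
Proof. by move=> hC hC' Cx C'x; rewrite (component_eq hC Cx) (component_eq hC' C'x). Qed.

Lemma linked_map (f : T -> T) : 
  (forall x y, adjacent V e x y -> adjacent V e (f x) (f y)) ->
  forall x y, linked x y -> linked (f x) (f y).
Proof.
move=> hf x y; elim=> [a b /hf h|a|a b _ IH|a b c _ IH1 _ IH2].
- exact: rst_step.
- exact: rst_refl.
- exact: rst_sym.
- exact: rst_trans IH1 IH2.
Qed.

Lemma component_image (f f' : T -> T) C : cancel f f' -> cancel f' f ->
  (forall x y, adjacent V e x y -> adjacent V e (f x) (f y)) ->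
  (forall x y, adjacent V e x y -> adjacent V e (f' x) (f' y)) ->
  (forall x, V x -> V (f x)) ->
  components V e C -> components V e (f @` C).
Proof.
move=> fK f'K hf hf' hV [x Vx ->]; exists (f x); first exact: hV.
rewrite predeqE => y; split=> /= [[z h <-]|h]; first exact: linked_map h.
by exists (f' y); rewrite ?f'K // -[x]fK; apply: linked_map h.
Qed.
End Components.

Section Equivariance.
Variable F : closedFieldType.
Hypothesis charF : 5%N \in [pchar F].
Local Notation unitary := (unitary charF).
Implicit Types (B : 'M[F]_3) (X Y : set (proj_point F)) (D : set (set (proj_point F))).

Definition mv B X := act B @` X.
Definition mvfam B D := mv B @` D.

Section OneElement.
Variable B : 'M[F]_3.
Hypothesis hB : unitary B.

Let uB : B \in unitmx := unitary_unit hB.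

Lemma mv_inj : injective (mv B).
Proof. exact/image_inj/act_inj. Qed.

Lemma mvK : cancel (mv B) (mv (invmx B)).
Proof. by move=> X; apply: image_actK. Qed.

Lemma mvKV : cancel (mv (invmx B)) (mv B).
Proof. by move=> X; apply: image_actKV. Qed.

Lemma mvfam_inj : injective (mvfam B).
Proof. exact/image_inj/mv_inj. Qed.

Lemma mvfamK : cancel (mvfam B) (mvfam (invmx B)).
Proof.
move=> D; rewrite predeqE => X; split=> [[_ [Y DY <-] <-]|DX]; first by rewrite mvK.
by exists (mv B X); [exists X|rewrite mvK].
Qed.

Lemma mv_Gamma : mv B (@Gamma F) = @Gamma F.
Proof. exact: (act_Aut_Gamma hB).2. Qed.

Lemma mv_meet X Y n : has_card (mv B X `&` mv B Y) n <-> has_card (X `&` Y) n.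
Proof.
rewrite /mv -image_injI; last exact: act_inj.
by apply: has_card_inj_image; apply: act_inj.
Qed.

Lemma mv_meet_Gamma X Y n :
  has_card (mv B X `&` mv B Y `&` (@Gamma F)) n <-> has_card (X `&` Y `&` (@Gamma F)) n.
Proof.
rewrite -{1}mv_Gamma /mv -image_injI; last exact: act_inj.
rewrite -image_injI; last exact: act_inj.
by apply: has_card_inj_image; apply: act_inj.
Qed.

(** The default [L] is never taken, because an invertible B preserves the dimension. *)
Definition act_line (L : proj_line F) : proj_line F :=
  insubd L ((linfun (mulmxr B)) @: val L)%VS.

Let ker0 : lker (linfun (mulmxr B)) == 0%VS :> {vspace 'rV[F]_3}.
Proof.
by apply/lker0P => u v; rewrite !lfunE /=; exact: (can_inj (mulmxK uB)).
Qed.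

Lemma val_act_line L : val (act_line L) = ((linfun (mulmxr B)) @: val L)%VS.
Proof.
rewrite /act_line val_insubd limg_dim_eq; first by rewrite (valP L).
by rewrite (eqP ker0) capv0.
Qed.

Lemma act_line_inj : injective act_line.
Proof.
move=> L L' /(congr1 val); rewrite !val_act_line => /eqP.
by rewrite eq_limg_ker0 // => /eqP /val_inj.
Qed.

Lemma val_act P : val (act B P) = (linfun (mulmxr B) @: val P)%VS.
Proof.
have [v v0 ->] := ptP P.
by rewrite act_pt // !val_pt ?mulmx_neq0 // limg_line lfunE.
Qed.

Lemma on_act_line P L : on_line (act B P) (act_line L) <-> on_line P L.
Proof. by rewrite /on_line val_act val_act_line limg_ker0. Qed.
End OneElement.

Lemma act_lineKV B : unitary B -> cancel (act_line (invmx B)) (act_line B).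
Proof.
move=> hB L; have uB := unitary_unit hB; apply: val_inj.
rewrite (val_act_line hB) (val_act_line (unitaryV hB)) -limg_comp.
have -> : (linfun (mulmxr B) \o linfun (mulmxr (invmx B)) = \1 :> 'End('rV[F]_3))%VF.
  by apply/lfunP => v; rewrite comp_lfunE !lfunE /= mulmxKV.
exact: lim1g.
Qed.

Lemma special_secant_act B L : unitary B -> special_secant L -> special_secant (act_line B L).
Proof.
move=> hB [P [P' [hP hP' n h h']]]; exists (act B P), (act B P').
split; [exact: (act_calP hB)|exact: (act_calP hB)| | |]; try by apply/(on_act_line hB).
by move/(act_inj (unitary_unit hB)).
Qed.

Lemma calS_sub B X L : unitary B -> calS X L -> calS (mv B X) (act_line B L).
Proof.
move=> hB [sL [P [P' [[XP GP] [XP' GP'] n h h']]]].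
split; first exact: special_secant_act.
exists (act B P), (act B P'); split; try by apply/(on_act_line hB).
- by split; [exists P|apply/(act_Gamma _ hB)].
- by split; [exists P'|apply/(act_Gamma _ hB)].
by move/(act_inj (unitary_unit hB)).
Qed.

Lemma calS_mv B X : unitary B -> calS (mv B X) = act_line B @` calS X.
Proof.
move=> hB; rewrite predeqE => L; split=> [h|[L' h <-]]; last exact: calS_sub.
exists (act_line (invmx B) L); last exact: act_lineKV.
by have := calS_sub (unitaryV hB) h; rewrite mvK.
Qed.

Lemma G_rel_mv B X Y : unitary B -> G_rel (mv B X) (mv B Y) <-> G_rel X Y.
Proof.
move=> hB; rewrite /G_rel (mv_meet hB) !calS_mv // -image_injI; last exact: act_line_inj.
by rewrite has_card_inj_image //; apply: act_line_inj.
Qed.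

Lemma calQ_mv B X : unitary B -> calQ (mv B X) <-> calQ X.
Proof.
move=> hB; split; last exact: act_calQ.
by move/(act_calQ (unitaryV hB)); rewrite -/(mv _ _) mvK.
Qed.

Lemma G_adj_mv B X Y : unitary B -> G_adj (mv B X) (mv B Y) <-> G_adj X Y.
Proof.
move=> hB; split=> [[/(calQ_mv _ hB) h1 /(calQ_mv _ hB) h2 n /(G_rel_mv _ _ hB) h]|
  [/(calQ_mv _ hB) h1 /(calQ_mv _ hB) h2 n /(G_rel_mv _ _ hB) h]]; split=> //.
  by move=> e; apply: n; rewrite e.
by move/(mv_inj hB).
Qed.

Lemma calD_mv B D : unitary B -> calD D -> calD (mvfam B D).
Proof.
move=> hB; apply: (component_image (f' := mv (invmx B))).
- exact: mvK.
- exact: mvKV.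
- by move=> X Y /(G_adj_mv _ _ hB).
- by move=> X Y /(G_adj_mv _ _ (unitaryV hB)).
- by move=> X /(calQ_mv _ hB).
Qed.

Lemma calD_mvE B D : unitary B -> calD (mvfam B D) <-> calD D.
Proof.
move=> hB; split; last exact: calD_mv.
by move/(calD_mv (unitaryV hB)); rewrite mvfamK.
Qed.

Lemma mvfam_mem B D X : unitary B -> mvfam B D (mv B X) <-> D X.
Proof. by move=> hB; split=> [[Y DY /(mv_inj hB) <-]|DX] //; exists X. Qed.

Lemma image_filter (T : Type) (f f' : T -> T) (A : set T) (p p' : T -> Prop) :
  cancel f f' -> cancel f' f -> (forall x, p' (f x) <-> p x) ->
  [set y | (f @` A) y /\ p' y] = f @` [set x | A x /\ p x].
Proof.
move=> fK f'K hp; rewrite predeqE => y; split=> /= [[[x Ax <-] /hp px]|[x [Ax px] <-]].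
  by exists x.
by split; [exists x|apply/hp].
Qed.

Lemma meet_count_mv B X D m n : unitary B ->
  meet_count (mv B X) (mvfam B D) m n <-> meet_count X D m n.
Proof.
move=> hB; rewrite /meet_count.
rewrite (image_filter (p := fun Y => has_card (X `&` Y `&` (@Gamma F)) m) D (mvK hB) (mvKV hB)).
  by apply: has_card_inj_image; apply: mv_inj.
by move=> Y; apply: mv_meet_Gamma.
Qed.

Lemma t_is_mv B X D tau : unitary B -> t_is (mv B X) (mvfam B D) tau <-> t_is X D tau.
Proof.
move=> hB; have e m n := propext (meet_count_mv X D m n hB).
by case: tau; rewrite /= !e.
Qed.

Lemma type_count_mv B D D' tau n : unitary B ->
  type_count (mvfam B D) (mvfam B D') tau n <-> type_count D D' tau n.
Proof.
move=> hB; rewrite /type_count.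
rewrite (image_filter (p := fun Y => t_is Y D' tau) D (mvK hB) (mvKV hB)).
  by apply: has_card_inj_image; apply: mv_inj.
by move=> Y; apply: t_is_mv.
Qed.

Lemma T_is_mv B D D' tau : unitary B ->
  T_is (mvfam B D) (mvfam B D') tau <-> T_is D D' tau.
Proof.
move=> hB; case: tau; rewrite /T_is ?(type_count_mv _ _ _ _ hB) //.
  split=> h X; first by move/(mvfam_mem _ _ hB)/h/(t_is_mv _ _ _ hB).
  by move=> [Y /h hY <-]; apply/t_is_mv.
split=> h X; first by move/(mvfam_mem _ _ hB)/h/(t_is_mv _ _ _ hB).
by move=> [Y /h hY <-]; apply/t_is_mv.
Qed.

Lemma H_adj_mv B D D' : unitary B ->
  adjacent (@calD F) (@H_rel F) D D' -> adjacent (@calD F) (@H_rel F) (mvfam B D) (mvfam B D').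
Proof.
move=> hB [h1 h2 n h]; split; [exact: calD_mv|exact: calD_mv| |exact/(T_is_mv _ _ _ hB)].
by move/(mvfam_inj hB).
Qed.

Lemma calN_mv B D D' : unitary B -> calN (mvfam B D) (mvfam B D') <-> calN D D'.
Proof.
move=> hB; split=> [[/(calD_mvE _ hB) h1 n /(T_is_mv _ _ _ hB) h]|[/(calD_mvE _ hB) h1 n /(T_is_mv _ _ _ hB) h]];
  split=> //; first by move=> e; apply: n; rewrite e.
by move/(mvfam_inj hB).
Qed.

End Equivariance.

Lemma allf5P (p : f5 -> bool) : all p f5s -> forall x, p x.
Proof. by rewrite /= andbT => /and5P [h0 h1 h2 h3 h4] []. Qed.

Lemma psubP s t : reflect {subset s <= t} (psub s t).
Proof. by apply: (iffP allP) => h i /h; rewrite pmemE. Qed.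

Lemma label_mapP w i p : PositiveMap.find i (label_map w) = Some p ->
  p \in pairs /\ exists2 j, j \in block p.1 p.2 & i = word_act w j.
Proof.
move=> h; have : (i, p) \in label_list w.
  move: h; rewrite /label_map; elim: (label_list w) => /= [|[j q] l IH].
    by rewrite PositiveMap.gempty.
  have [->|/eqP nij] := eqVneq i j.
    by rewrite PositiveMap.gss => -[->]; rewrite mem_head.
  by rewrite PositiveMap.gso // => /IH h; rewrite in_cons h orbT.
by case/flatten_mapP => q hq /mapP [j hj [-> ->]]; split=> //; exists j.
Qed.

Lemma same_labelP w s : same_label (label_map w) s ->
  exists2 p, p \in pairs & {subset s <= map (word_act w) (block p.1 p.2)}.
Proof.
case: s => [|i s] //=; case e: PositiveMap.find => [p|] //; rewrite everyE => /allP h.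
have [hp [j hj ei]] := label_mapP e; exists p => // k; rewrite in_cons.
case/orP => [/eqP ->|/h]; first by rewrite ei map_f.
case e': PositiveMap.find => [q|] // /andP [/eqP e1 /eqP e2].
have [_ [l hl ->]] := label_mapP e'; apply: map_f.
by rewrite e1 e2.
Qed.

(** * The base component of G *)

Section Codes.
Variable F : closedFieldType.
Hypothesis charF : 5%N \in [pchar F].
Variable r : F.
Hypothesis r2 : r ^+ 2 = 2%:R.
Local Notation inF := (inF r).
Local Notation inV := (inV r).
Local Notation inM := (inM r).
Local Notation wordM := (wordM r).
Local Notation genM := (genM r).
Local Notation Pt := (Pt r).
Implicit Types X Y : set (proj_point F).

Lemma base_hframe : hframe (inM base_frame).
Proof.
have /and5P [/eqmP h1 /eqmP h2 _ _ _] := base_okP.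
have hg : hgram charF (inM base_frame) = inM frame_gram by rewrite inM_hgram // h1.
split.
  have : inM base_frame *m ((map_mx (pFrobenius_aut charF) (inM base_frame))^T *m inM frame_gram_inv) = 1%:M.
    by rewrite mulmxA -/(hgram charF _) hg -inM_mul // h2 inM1.
  by case/mulmx1_unit.
move=> i j; rewrite -(hgramE charF) hg !mxE /frame_form.
have e3 : inF (E3, E0) = - 2%:R.
  rewrite /inF /inF5 /= mul0r addr0; apply/eqP; rewrite -subr_eq0 opprK -natrD.
  by rewrite (five0 charF).
by have [->|->|->] := ord3P i; have [->|->|->] := ord3P j; rewrite /= ?mxE /= ?inF0 ?inF1 ?e3.
Qed.

Definition conic0 : set (proj_point F) := conic_of (inM base_frame).

Lemma param_inV A t : param (inM A) (inF t) = inV (param_point A t).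
Proof.
rewrite param_mul mulmx_sum_row sum3 !row_inM; case: A => [[a b] c] /=.
by rewrite !inV_add // !inV_scale // inFM // !mxE expr0 expr1 expr2 scale1r addrA.
Qed.

(** The interface between conics and computations: the intersection numbers, the common secants and
    the equality of conics are all decided on the six point numbers. *)
Definition hascode X (l : seq point) :=
  [/\ calQ X, uniq l, size l = 6, {subset l <= points} &
    forall P, (X `&` (@Gamma F)) P <-> exists2 i, i \in l & P = Pt i].

Lemma hascode_base : hascode conic0 base_code.
Proof.
have /and5P [_ _ ub /psubP sb /andP [/eqvP e2 e1]] := base_okP.
have uA := base_hframe.1.
have pt_index v : coord (index_of v) = normalize v -> inV v != 0 -> Pt (index_of v) = pt (inV v).
  move=> e v0; rewrite /Pt e; have [|_ [c c0 ->]] := @normalize_spec F charF r r2 v.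
    move=> z; move: v0; rewrite z => /eqP; apply.
    by apply/rowP => j; rewrite !mxE !inF0; case: j => [[|[|[|]]]].
  by rewrite inV_scale // ptZ.
split=> //; first exact/(hframe_calQ charF)/base_hframe.
move=> P; rewrite (hframe_meet charF _ base_hframe).
have -> : frame_points (inM base_frame) = map Pt base_code.
  have e5 x : coord (index_of (param_point base_frame (x, E0))) =
      normalize (param_point base_frame (x, E0)).
    exact/eqvP/(allf5P e1 x).
  have ep x n : nat_of_f5 x = n ->
      pt (param (inM base_frame) n%:R) = Pt (index_of (param_point base_frame (x, E0))).
    move=> <-; rewrite pt_index // -param_inV.
      by congr (pt (param _ _)); rewrite /inF /inF5 /= mul0r addr0.
    exact: param_neq0.
  rewrite /frame_points /= (ep E0 0) // (ep E1 1) // (ep E2 2) // (ep E3 3) // (ep E4 4) //.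
  have -> : pt (row 2%:R (inM base_frame)) = Pt (index_of base_frame.2).
    by rewrite pt_index // -?[inV base_frame.2](row_inM r base_frame 2%:R) // row_neq0.
  by [].
by split=> [/mapP|[i hi ->]]; last exact: map_f.
Qed.

Lemma hascode_mv X l w : hascode X l -> hascode (mv (wordM w) X) (map (word_act w) l).
Proof.
move=> [hX ul sl pl hP]; have hw := wordM_unitary charF r2 w.
have uw := unitary_unit hw; split.
- exact: act_calQ.
- by rewrite map_inj_in_uniq // => i j /pl hi /pl hj; apply: (word_act_inj charF r2).
- by rewrite size_map.
- by move=> _ /mapP [i /pl hi ->]; exact: word_act_points.
move=> P; split=> [[[Q XQ <-] GQ]|[_ /mapP [i hi ->] ->]].
  have /hP [i hi ->] : (X `&` (@Gamma F)) Q by split=> //; apply/(act_Gamma _ hw).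
  by exists (word_act w i); rewrite ?map_f // (act_Pt charF r2) // pl.
have /hP [Xi Gi] : exists2 j, j \in l & Pt i = Pt j by exists i.
by rewrite -(act_Pt charF r2) ?pl //; split; [exists (Pt i)|apply/(act_Gamma _ hw)].
Qed.

(** A quadratic form restricted to a conic has degree at most 4 in the parameter, so the five common
    points with parameters 0, ..., 4 already force it to vanish on the conic. *)
Lemma hascode_sub X Y l l' : hascode X l -> hascode Y l' -> {subset l <= l'} -> X = Y.
Proof.
suff half X' Y' s s' : hascode X' s -> hascode Y' s' -> {subset s <= s'} -> X' `<=` Y'.
  move=> hX hY sub; rewrite predeqE => P; split; first exact: (half _ _ _ _ hX hY sub).
  apply: (half _ _ _ _ hY hX) => i hi.
  have [_ ul sl _ _] := hX; have [_ ul' sl' _ _] := hY.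
  by have [_ ->] := uniq_min_size ul sub (eq_leq (etrans sl' (esym sl))).
move=> [/(calQ_hframe charF) [A hA eX] _ _ _ hX] [[q [hq _ eY _ _]] _ _ _ hY] sub.
have uA := hA.1; have [sq _] := normal_form uA hq.
have rq : restr A q = 0.
  apply/eqP/negPn/negP => nz.
  have ar : all (root (restr A q)) [seq n%:R : F | n <- iota 0 5].
    apply/allP => _ /mapP [n _ ->]; rewrite /root horner_restr; apply/eqP.
    apply/(vanishes_pt hq (param_neq0 _ uA)).
    have /hX [i /sub hi ->] : (X' `&` (@Gamma F)) (pt (param A n%:R)).
      rewrite eX; split; first exact: conic_of_param.
      exact/(hframe_Gamma charF _ hA)/param_nat_pow.
    by have [+ _] := (hY (Pt i)).2 (ex_intro2 _ _ i hi erefl); rewrite eY.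
  have ur : uniq [seq n%:R : F | n <- iota 0 5].
    rewrite map_inj_in_uniq ?iota_uniq // => m n; rewrite !mem_iota => hm hn.
    by apply: (nat5_inj charF).
  by have := max_poly_roots nz ar ur; rewrite size_map size_iota ltnNge sq.
have [b eb] := restr_eq0 uA hq rq.
by move=> P; rewrite eX eY /conic_of /zeros /= eb => h v hv; rewrite mevalM (h v hv) mulr0.
Qed.

Lemma hascode_meet X Y l l' n : hascode X l -> hascode Y l' ->
  has_card (X `&` Y `&` (@Gamma F)) n <-> meet_number l l' = n.
Proof.
move=> [_ ul _ pl hX] [_ _ _ pl' hY].
have h : has_card (X `&` Y `&` (@Gamma F)) (meet_number l l').
  rewrite /meet_number -size_filter.
  apply: (has_card_image (f := Pt)); first exact: filter_uniq.
    by move=> i j; rewrite !mem_filter => /andP [_ /pl hi] /andP [_ /pl hj]; apply: (Pt_inj charF r2).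
  move=> P; split=> [[[XP YP] GP]|[i + ->]].
    have [i hi ei] := (hX P).1 (conj XP GP); have [j hj ej] := (hY P).1 (conj YP GP).
    exists i => //; rewrite mem_filter pmemE hi andbT.
    by rewrite (Pt_inj charF r2 (pl _ hi) (pl' _ hj)) // -ei.
  rewrite mem_filter pmemE => /andP [hj hi].
  have [XP GP] := (hX (Pt i)).2 (ex_intro2 _ _ i hi erefl).
  by have [YP _] := (hY (Pt i)).2 (ex_intro2 _ _ i hj erefl).
by split=> [h'|<- //]; apply: has_card_uniq h h'.
Qed.

Definition conic_block a b : set (proj_point F) := mv (wordM (block_word a b)) conic0.

Lemma iota7 a : a \in iota 0 7 = (a < 7)%N.
Proof. by rewrite mem_iota. Qed.

Lemma blocks_spec a b : (a < 7)%N -> (b < 7)%N -> a != b ->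
  block a b = map (word_act (block_word a b)) base_code /\
  forall g, g \in stab_gens -> {subset map (gen_act^~ g) (block a b)
     <= block (nth 0%N (gen_perm g) a) (nth 0%N (gen_perm g) b)}.
Proof.
move=> a7 b7 nab; have /allP /(_ a) := blocks_okP; rewrite iota7 => /(_ a7).
move/allP => /(_ b); rewrite iota7 => /(_ b7); rewrite (negPf nab).
by move=> /andP [/eqP h /allP hg]; split=> // g /hg /psubP.
Qed.

Lemma hascode_block a b : (a < 7)%N -> (b < 7)%N -> a != b ->
  hascode (conic_block a b) (block a b).
Proof.
move=> a7 b7 nab; have [-> _] := blocks_spec a7 b7 nab.
exact: hascode_mv hascode_base.
Qed.

Lemma gen_perm_lt g a : (a < 7)%N -> (nth 0%N (gen_perm g) a < 7)%N.
Proof. by case: g; do 7?[case: a => [|a] //]. Qed.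

Lemma gen_perm_inj g a b : (a < 7)%N -> (b < 7)%N ->
  nth 0%N (gen_perm g) a = nth 0%N (gen_perm g) b -> a = b.
Proof.
move=> a7 b7 /eqP; rewrite nth_uniq; first by move/eqP.
- by case: g.
- by case: g.
by case: g.
Qed.

Lemma wordM1 g : wordM [:: g] = genM g.
Proof. by rewrite /wordM /= mul1mx. Qed.

Lemma mv_rcons w g X : mv (wordM (rcons w g)) X = mv (genM g) (mv (wordM w) X).
Proof.
rewrite wordM_rcons; apply: image_actM; first exact: wordM_unit.
exact/unitary_unit/(genM_unitary charF r2).
Qed.

Lemma mv_cat w w' X : mv (wordM (w ++ w')) X = mv (wordM w') (mv (wordM w) X).
Proof. by rewrite wordM_cat; apply: image_actM; apply: wordM_unit. Qed.

Lemma hascode_gen X l g : hascode X l -> hascode (mv (genM g) X) (map (gen_act^~ g) l).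
Proof. by rewrite -wordM1 => /(hascode_mv [:: g]). Qed.

Lemma mv_gen_block g a b : g \in stab_gens -> (a < 7)%N -> (b < 7)%N -> a != b ->
  mv (genM g) (conic_block a b) = conic_block (nth 0%N (gen_perm g) a) (nth 0%N (gen_perm g) b).
Proof.
move=> hg a7 b7 nab; have [_ /(_ g hg) sub] := blocks_spec a7 b7 nab.
have n' : nth 0%N (gen_perm g) a != nth 0%N (gen_perm g) b.
  by apply: contraNneq nab => /gen_perm_inj ->.
apply: hascode_sub sub; first exact/hascode_gen/hascode_block.
by apply: hascode_block => //; apply: gen_perm_lt.
Qed.

Lemma perm_word_lt w a : (a < 7)%N -> (perm_word w a < 7)%N.
Proof. by rewrite /perm_word; elim: w a => //= g w IH a a7; apply/IH/gen_perm_lt. Qed.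

Lemma perm_word_inj w a b : (a < 7)%N -> (b < 7)%N -> perm_word w a = perm_word w b -> a = b.
Proof.
rewrite /perm_word; elim: w a b => //= g w IH a b a7 b7 /IH e.
by apply: (gen_perm_inj (g := g)) => //; apply: e; apply: gen_perm_lt.
Qed.

Lemma mv_word_block w a b : all (mem stab_gens) w -> (a < 7)%N -> (b < 7)%N -> a != b ->
  mv (wordM w) (conic_block a b) = conic_block (perm_word w a) (perm_word w b).
Proof.
elim/last_ind: w => [|w g IH] hw a7 b7 nab; first by rewrite /mv image_act1.
move: hw; rewrite all_rcons => /andP [hg hw].
have n' : perm_word w a != perm_word w b by apply: contraNneq nab => /perm_word_inj ->.
rewrite mv_rcons (IH hw a7 b7 nab).
rewrite (mv_gen_block hg (perm_word_lt w a7) (perm_word_lt w b7) n').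
by rewrite /perm_word !foldl_rcons.
Qed.

Lemma conic_blockC a b : conic_block a b = conic_block b a.
Proof. by rewrite /conic_block /block_word minnC maxnC. Qed.

Lemma pairsP p : p \in pairs -> [/\ (p.1 < 7)%N, (p.2 < 7)%N & (p.1 < p.2)%N].
Proof.
rewrite mem_filter => /andP [ab /allpairsP [[x y] /= [hx hy ep]]].
by move: hx hy ab; rewrite ep !iota7 => hx hy ab; split.
Qed.

Lemma mem_pairs a b : (a < b)%N -> (b < 7)%N -> (a, b) \in pairs.
Proof.
move=> ab b7; rewrite mem_filter ab; apply/allpairsP; exists (a, b).
by rewrite !iota7 b7 (ltn_trans ab b7).
Qed.

Definition comp0 : set (set (proj_point F)) :=
  [set X | exists2 p, p \in pairs & X = conic_block p.1 p.2].

Lemma comp0_block a b : (a < 7)%N -> (b < 7)%N -> a != b -> comp0 (conic_block a b).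
Proof.
move=> a7 b7; rewrite neq_ltn => /orP [] h.
  by exists (a, b); [exact: mem_pairs|].
by exists (b, a); [exact: mem_pairs|exact: conic_blockC].
Qed.

Lemma comp0P X : comp0 X -> exists a b, [/\ (a < 7)%N, (b < 7)%N, a != b & X = conic_block a b].
Proof.
move=> [p /pairsP [h1 h2 h3] ->]; exists p.1, p.2; split=> //.
by rewrite neq_ltn h3.
Qed.

Lemma coset_step i g p : (i < 150)%N -> p \in pairs ->
  (coset_act i g < 150)%N /\ exists2 q, q \in pairs &
   mv (genM g) (mv (wordM (coset i)) (conic_block p.1 p.2)) =
   mv (wordM (coset (coset_act i g))) (conic_block q.1 q.2).
Proof.
move=> hi hp; have := coset_act_okP => /allP /(_ g).
have -> : g \in gens by case: g.
move/(_ isT)/allP => /(_ i); rewrite mem_iota => /(_ hi) /andP [hj /allP /(_ p hp)].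
have -> : nth (PositiveMap.empty _) [seq label_map w | w <- coset_words] (coset_act i g) =
          label_map (coset (coset_act i g)) by rewrite (nth_map [::]).
move/same_labelP => [q hq sub]; split=> //; exists q => //.
have [p1 p2 p3] := pairsP hp; have [q1 q2 q3] := pairsP hq.
rewrite -mv_rcons; apply: hascode_sub sub; apply: hascode_mv; apply: hascode_block => //.
  by rewrite neq_ltn p3.
by rewrite neq_ltn q3.
Qed.

(** Every conic is the image of the base conic under an isometry, hence under a word; appending a
    generator permutes the 150 translates of the base component. *)
Lemma calQ_coset X : calQ X -> exists i p, [/\ (i < 150)%N, p \in pairs &
  X = mv (wordM (coset i)) (conic_block p.1 p.2)].
Proof.
move=> /(calQ_act charF base_hframe) [B hB ->].
have [w [c [c0 ->]]] := unitary_word r2 hB.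
have -> : act (c *: wordM w) @` conic_of (inM base_frame) = mv (wordM w) conic0.
  rewrite /mv; congr (_ @` _); apply/funext => P; apply: actZ => //; exact: wordM_unit.
elim/last_ind: w {hB} => [|w g [i [p [hi hp e]]]].
  exists 0%N, (0, 1)%N; split=> //.
  by rewrite /conic_block /mv !image_act1.
rewrite mv_rcons e; have [hj [q hq ->]] := coset_step g hi hp.
exists (coset_act i g), q; exact: And3 hj hq erefl.
Qed.

End Codes.

(** * Special secant lines *)

Section Lines.
Variable F : fieldType.

Definition dotp (n v : 'rV[F]_3) : F := \sum_i n 0 i * v 0 i.

Lemma dotpD n u v : dotp n (u + v) = dotp n u + dotp n v.
Proof. by rewrite /dotp -big_split; apply: eq_bigr => i _; rewrite mxE mulrDr. Qed.

Lemma dotpZ n c v : dotp n (c *: v) = c * dotp n v.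
Proof. by rewrite /dotp mulr_sumr; apply: eq_bigr => i _; rewrite mxE mulrCA. Qed.

Lemma line_through (u v : 'rV[F]_3) : u != 0 -> v != 0 -> pt u <> pt v ->
  exists L : proj_line F, val L = (<[u]> + <[v]>)%VS.
Proof.
move=> u0 v0 nuv; have d2 : \dim (<[u]> + <[v]>)%VS == 2%N.
  rewrite dimv_disjoint_sum ?dim_vline ?u0 ?v0 //.
  apply/eqP; rewrite -subv0; apply/subvP => w; rewrite memv_cap => /andP [/vlineP [a ->] /vlineP [b e]].
  rewrite memv0; apply/eqP; have [->|a0] := eqVneq a 0; first by rewrite scale0r.
  case: nuv; apply/esym/pt_eqP => //; exists (a^-1 * b).
  by rewrite -scalerA -e scalerA mulVf ?scale1r.
by exists (exist (fun U : {vspace 'rV[F]_3} => \dim U == 2%N) _ d2).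
Qed.

Lemma line_unique (u v : 'rV[F]_3) (L L' : proj_line F) : u != 0 -> v != 0 -> pt u <> pt v ->
  on_line (pt u) L -> on_line (pt v) L -> on_line (pt u) L' -> on_line (pt v) L' -> L = L'.
Proof.
move=> u0 v0 nuv; have [M eM] := line_through u0 v0 nuv.
have key (N : proj_line F) : on_line (pt u) N -> on_line (pt v) N -> N = M.
  rewrite /on_line !val_pt // => h1 h2; apply: val_inj; apply/eqP.
  rewrite eq_sym eqEdim eM subv_add h1 h2 -eM.
  by rewrite (eqP (valP M)) (eqP (valP N)).
by move=> h1 h2 h3 h4; rewrite (key _ h1 h2) (key _ h3 h4).
Qed.
End Lines.

Lemma pset_mem i s : (if PositiveMap.find i (pset s) is Some _ then true else false) = (i \in s).
Proof.
elim: s => [|j s IH]; first by rewrite PositiveMap.gempty.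
rewrite in_cons /=; have [->|/eqP nij] := eqVneq i j; first by rewrite PositiveMap.gss.
by rewrite PositiveMap.gso.
Qed.

Lemma count_pset (T : Type) (f : T -> seq point) (ps : seq T) s :
  count (fun t => 1 < count (fun i => if PositiveMap.find i t is Some _ then true else false) s)%N
    [seq pset (f p) | p <- ps] =
  count (fun p => 1 < count (fun i => i \in f p) s)%N ps.
Proof.
rewrite count_map; apply: eq_count => p /=.
by congr (_ < _)%N; apply: eq_count => i; apply: pset_mem.
Qed.

Lemma shared_secantsE s :
  shared_secants s = count (fun p => (1 < count (fun i => i \in secant p.1 p.2) s)%N) base_pairs.
Proof. by rewrite /shared_secants base_secant_setsE; exact: count_pset. Qed.

Section Secants.
Variable F : closedFieldType.
Hypothesis charF : 5%N \in [pchar F].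
Variable r : F.
Hypothesis r2 : r ^+ 2 = 2%:R.
Local Notation inF := (inF r).
Local Notation inV := (inV r).
Local Notation Pt := (Pt r).
Local Notation hascode := (hascode r).
Local Notation conic0 := (conic0 r).
Implicit Types X Y : set (proj_point F).

Lemma inV_dot u v : dotp (inV u) (inV v) = inF (dot u v).
Proof.
case: u v => [[x y] z] [[x' y'] z']; rewrite /dotp sum3 !mxE /= !inFD // !inFM // addrA //.
Qed.

Lemma base_pair_points p : p \in base_pairs ->
  [/\ p.1 \in base_code, p.2 \in base_code & p.1 != p.2].
Proof.
have /allP h : all (fun p => [&& p.1 \in base_code, p.2 \in base_code & p.1 != p.2]) base_pairs.
  by vm_compute.
by move/h/and3P.
Qed.

Lemma base_pair_of i j : i \in base_code -> j \in base_code -> i != j ->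
  (i, j) \in base_pairs \/ (j, i) \in base_pairs.
Proof.
have : all (fun i => all (fun j => (i == j) || ((i, j) \in base_pairs) || ((j, i) \in base_pairs)) base_code) base_code.
  by vm_compute.
move=> /allP h hi hj nij; have /allP := h i hi => /(_ j hj).
by rewrite (negPf nij) => /orP.
Qed.

Lemma base_code_points i : i \in base_code -> i \in points.
Proof. by have /allP h : all (mem points) base_code by []; move/h. Qed.

Lemma secant_line p : p \in base_pairs ->
  exists L : proj_line F, forall k, k \in points -> on_line (Pt k) L <-> k \in secant p.1 p.2.
Proof.
move=> hp; have [h1 h2 n12] := base_pair_points hp.
have q1 := base_code_points h1; have q2 := base_code_points h2.
have n1 : inV (coord p.1) != 0 by apply: Pt_neq0.
have n2 : inV (coord p.2) != 0 by apply: Pt_neq0.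
have n12' : Pt p.1 <> Pt p.2 by move/(Pt_inj charF r2 q1 q2)/eqP; apply/negP.
have [L eL] := line_through n1 n2 n12'; exists L => k hk.
have /allP /(_ p hp) /and5P [/eq25P d1 /eq25P d2 _ /allP /(_ k hk) hk' _] := secants_okP.
rewrite /on_line val_pt ?Pt_neq0 // eL -memvE; move: hk'; rewrite pmemE someE.
case: ifP => [hs hA|_ nd]; split=> // h; last first.
  case/negP: nd; apply/eq25P; apply: (inF_eq0 charF r2); rewrite -inV_dot.
  move/memv_addP: h => [_ /vlineP [a ->] [_ /vlineP [b ->] ->]].
  by rewrite dotpD !dotpZ !inV_dot d1 d2 inF0 !mulr0 addr0.
case/orP: hA => [/eqvP ->|/hasP [t _ /eqvP ->]].
  by apply: subvP (memv_line _); apply: addvSr.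
have [z|nz] := eqVneq (inV (addv (coord p.1) (scale25 t (coord p.2)))) 0.
  case: n12'; apply/esym/pt_eqP => //; move: z; rewrite inV_add // inV_scale //.
  by move/eqP; rewrite addr_eq0 => /eqP z; exists (- inF t); rewrite z scaleNr.
have [|_ [c c0 ->]] := @normalize_spec F charF r r2 (addv (coord p.1) (scale25 t (coord p.2))).
  move=> z; move: nz; rewrite z => /eqP; apply.
  by apply/rowP => j; rewrite !mxE !inF0; case: j => [[|[|[|]]]].
rewrite inV_scale // inV_add // inV_scale // memvZ // memv_add ?memv_line // memvZ // memv_line //.
Qed.

Lemma secant_mem p : p \in base_pairs -> p.1 \in secant p.1 p.2 /\ p.2 \in secant p.1 p.2.
Proof.
by move=> hp; have /allP /(_ p hp) /and5P [_ _ /andP [] ] := secants_okP; rewrite !pmemE.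
Qed.

Lemma secant_inj p q : p \in base_pairs -> q \in base_pairs ->
  q.1 \in secant p.1 p.2 -> q.2 \in secant p.1 p.2 -> p = q.
Proof.
move=> hp hq h1 h2; have /allP /(_ p hp) /and5P [_ _ _ _ /allP /(_ q hq)] := secants_okP.
by rewrite !pmemE h1 h2 orbF => /eqP.
Qed.

Lemma count_two (T : eqType) (a : pred T) (s : seq T) : uniq s ->
  (1 < count a s)%N <-> exists i j, [/\ i \in s, j \in s, i != j, a i & a j].
Proof.
move=> us; rewrite -size_filter; split=> [|[i [j [hi hj nij ai aj]]]].
  have : uniq (filter a s) by apply: filter_uniq.
  case e: (filter a s) => [|i [|j s']] //= /andP [nij _] _; exists i, j.
  have : i \in filter a s by rewrite e mem_head.
  have : j \in filter a s by rewrite e !inE eqxx orbT.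
  rewrite !mem_filter => /andP [-> ->] /andP [-> ->]; split=> //.
  by apply: contraNneq nij => ->; rewrite mem_head.
have : {subset [:: i; j] <= filter a s}.
  by move=> k; rewrite !inE => /orP [] /eqP ->; rewrite mem_filter ?ai ?aj.
move/uniq_leq_size; apply; by rewrite /= inE nij.
Qed.

(** A line belongs to both sets exactly when it joins two points of the base code and contains two
    points of [l]; [secant_inj] ensures that different pairs count different lines. *)
Lemma calS_shared X l : hascode X l -> has_card (calS conic0 `&` calS X) (shared_secants l).
Proof.
move=> [_ ul _ pl hX]; have [_ _ _ pb hb] := hascode_base charF r2.
have /boolp.choice [line hline] : forall p, exists L : proj_line F, p \in base_pairs ->
    forall k, k \in points -> on_line (Pt k) L <-> k \in secant p.1 p.2.
  move=> p; have [hp|_] := boolP (p \in base_pairs).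
    by have [L hL] := secant_line hp; exists L.
  have h0 : (nth xH base_code 0, nth xH base_code 1) \in base_pairs by vm_compute.
  by have [L _] := secant_line h0; exists L.
rewrite shared_secantsE -size_filter.
apply: (has_card_image (f := line)); first by apply: filter_uniq; vm_compute.
  move=> p q; rewrite !mem_filter => /andP [_ hp] /andP [_ hq] e.
  have [m1 m2] := secant_mem hq; have [b1 b2 _] := base_pair_points hq.
  by apply: (secant_inj hp hq); apply/(hline p hp); rewrite ?base_code_points // e;
    apply/(hline q hq); rewrite ?base_code_points.
have uniq_line p L : p \in base_pairs -> on_line (Pt p.1) L -> on_line (Pt p.2) L -> L = line p.
  move=> hp o1 o2; have [m1 m2] := secant_mem hp; have [b1 b2 n12] := base_pair_points hp.
  have q1 := base_code_points b1; have q2 := base_code_points b2.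
  apply: (@line_unique _ (inV (coord p.1)) (inV (coord p.2))) o1 o2 _ _; try exact: Pt_neq0.
  - by move/(Pt_inj charF r2 q1 q2)/eqP; apply/negP.
  - exact/(hline p hp).
  - exact/(hline p hp).
move=> L; split=> [[[sL [P [P' [/hb [i hi ->] /hb [j hj ->] nP o1 o2]]]] [_ [R [R' [/hX [k hk ->] /hX [k' hk' ->] nR o3 o4]]]]]|].
  have nij : i != j by apply/eqP => e; apply: nP; rewrite e.
  have [p hp eL] : exists2 p, p \in base_pairs & L = line p.
    by case: (base_pair_of hi hj nij) => h; eexists; try exact: h; apply: uniq_line.
  exists p => //; rewrite mem_filter hp andbT; apply/(count_two _ ul); exists k, k'.
  split=> //; first by apply/eqP => e; apply: nR; rewrite e.
    by apply: (hline p hp k (pl k hk)).1; rewrite -eL.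
  by apply: (hline p hp k' (pl k' hk')).1; rewrite -eL.
move=> [p]; rewrite mem_filter => /andP [/(count_two _ ul) [k [k' [hk hk' nk s1 s2]]] hp] ->.
have [m1 m2] := secant_mem hp; have [b1 b2 n12] := base_pair_points hp.
have q1 := base_code_points b1; have q2 := base_code_points b2.
have o1 : on_line (Pt p.1) (line p) by apply/(hline p hp).
have o2 : on_line (Pt p.2) (line p) by apply/(hline p hp).
have n12' : Pt p.1 <> Pt p.2 by move/(Pt_inj charF r2 q1 q2)/eqP; apply/negP.
have sL : special_secant (line p).
  by exists (Pt p.1), (Pt p.2); split=> //; apply: (calP_Pt charF r2).
split; split=> //.
  by exists (Pt p.1), (Pt p.2); split=> //; apply/hb; [exists p.1|exists p.2].
exists (Pt k), (Pt k'); split; try by [apply: (hline p hp k (pl k hk)).2|apply: (hline p hp k' (pl k' hk')).2].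
- by apply/hX; exists k.
- by apply/hX; exists k'.
by move/(Pt_inj charF r2 (pl _ hk) (pl _ hk'))/eqP; apply/negP.
Qed.

End Secants.

(** * Neighbours of the base conic *)

Section Adjacency.
Variable F : closedFieldType.
Hypothesis charF : 5%N \in [pchar F].
Variable r : F.
Hypothesis r2 : r ^+ 2 = 2%:R.
Local Notation inF := (inF r).
Local Notation inV := (inV r).
Local Notation inM := (inM r).
Local Notation wordM := (wordM r).
Local Notation hascode := (hascode r).
Local Notation conic0 := (conic0 r).
Local Notation conic_block := (conic_block r).
Implicit Types X Y : set (proj_point F).

(** The Gram matrix antidiag(1, -2, 1) makes the coordinates of v in the frame x_0 = h(v, row 2),
    x_2 = h(v, row 0), while h(v, row 1) = -2 x_1; and (-2)^2 = -1 in characteristic 5. The conic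
    thus has an equation in Hermitian products, free of inverse matrices and easy to compute. *)
Lemma hframe_conic A (v : 'rV[F]_3) : hframe A -> v != 0 ->
  conic_of A (pt v) <-> hf v (row 2%:R A) * hf v (row 0 A) + hf v (row 1 A) ^+ 2 = 0.
Proof.
move=> [uA hA] v0; have e5 := five0 charF.
rewrite (conic_of_pt A v0); set x := v *m invmx A.
have ev : v = \sum_i x 0 i *: row i A by rewrite -mulmx_sum_row mulmxKV.
have hj j : hf v (row j A) = \sum_i x 0 i * frame_form F i j.
  by rewrite {1}ev hf_suml; apply: eq_bigr => i _; rewrite hA.
rewrite !hj !sum3 /frame_form /= !(mulr0, mulr1, addr0, add0r).
have -> : x 0 0 * x 0 2%:R + (x 0 1 * - 2%:R) ^+ 2 = x 0 0 * x 0 2%:R - x 0 1 ^+ 2.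
  apply/eqP; rewrite -subr_eq0; apply/eqP; transitivity (5%:R * x 0 1 ^+ 2); first by ring.
  by rewrite e5 mul0r.
by split=> [->|/eqP]; rewrite ?subrr // subr_eq0 => /eqP.
Qed.

Lemma inM_word w : inM (word_mat w) = wordM w.
Proof.
elim/last_ind: w => [|w g IH]; first exact: inM1.
by rewrite wordM_rcons -IH /word_mat foldl_rcons inM_mul.
Qed.

Lemma mv_conic0 w : mv (wordM w) conic0 = conic_of (inM (mulmm base_frame (word_mat w))).
Proof.
rewrite inM_mul // inM_word; apply: act_conic_of; first exact: (base_hframe charF r2).1.
exact: wordM_unit.
Qed.

Lemma word_frame w : hframe (inM (mulmm base_frame (word_mat w))).
Proof.
rewrite inM_mul // inM_word; apply: hframe_mul; first exact: base_hframe.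
exact: (wordM_unitary charF r2).
Qed.

Definition quad (M : mat) (v : 'rV[F]_3) : F :=
  \sum_(j < 3) \sum_(k < 3) inF (entry M j k) * v 0 j * v 0 k.

Lemma inF2 : inF (E2, E0) = 2%:R.
Proof. by rewrite /inF /inF5 /= mul0r addr0. Qed.

Lemma quad_gram A v : quad (gram A) v =
  2%:R * (hf v (row 2%:R (inM A)) * hf v (row 0 (inM A)) + hf v (row 1 (inM A)) ^+ 2).
Proof.
rewrite !row_inM; case: A => [[[[a0 a1] a2] [[b0 b1] b2]] [[c0 c1] c2]].
rewrite /quad /hf !sum3 !mxE /=.
rewrite -!(inF_conj charF r2) !(inFD charF) !(inFM charF r2) inF2; ring.
Qed.

Lemma quad_sub M N c v : quad (subm M N c) v = quad M v + inF c * quad N v.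
Proof.
case: M N => [[[[a0 a1] a2] [[b0 b1] b2]] [[c0 c1] c2]] [[[[a0' a1'] a2'] [[b0' b1'] b2']] [[c0' c1'] c2']].
by rewrite /quad !sum3 /= !(inFD charF) !(inFM charF r2); ring.
Qed.

(** Rank one means that M_ii times the quadratic form is the square of the linear form given by row
    i. *)
Lemma rank_oneP M : rank_one M -> exists2 n : 'rV[F]_3, n != 0 &
  forall v, quad M v = 0 -> dotp n v = 0.
Proof.
move=> /hasP [i hi /andP [/eq25P Mii /allP h]].
pose n : 'rV[F]_3 := \row_j inF (entry M i j).
have i3 : (i < 3)%N by rewrite mem_iota in hi.
have m0 : inF (entry M i i) != 0 by apply/eqP => /(inF_eq0 charF r2).
exists n.
  apply/eqP => /rowP /(_ (Ordinal i3)); rewrite !mxE /= => /eqP; by apply/negP.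
move=> v q0; have : dotp n v ^+ 2 = inF (entry M i i) * quad M v.
  rewrite expr2 {1}/dotp mulr_suml /quad mulr_sumr; apply: eq_bigr => j _.
  rewrite /dotp mulr_sumr mulr_sumr; apply: eq_bigr => k _; rewrite !mxE.
  have m3 (l : 'I_3) : (l : nat) \in iota 0 3 by rewrite mem_iota ltn_ord.
  have /allP /(_ k (m3 k)) /eq25P e := h j (m3 j).
  by rewrite !mulrA -(inFM charF r2) e (inFM charF r2); ring.
by rewrite q0 mulr0 => /eqP; rewrite expf_eq0 => /eqP.
Qed.

Lemma conic0_quad v : v != 0 -> conic0 (pt v) -> quad (gram base_frame) v = 0.
Proof.
by move=> v0 /(hframe_conic (base_hframe charF r2) v0) h; rewrite quad_gram h mulr0.
Qed.

(** Of four points of the conic on the line n at most one is at infinity, so a polynomial of degree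
    at most 2 has three roots. It vanishes identically, and n annihilates the three vectors of the
    frame. *)
Lemma line_conic_meet (n : 'rV[F]_3) (Z : set (proj_point F)) : n != 0 ->
  (forall v, v != 0 -> Z (pt v) -> conic0 (pt v) /\ dotp n v = 0) -> ~ has_card Z 4.
Proof.
move=> n0 hZ /has_card_seq [s [us ss hs]].
have hA := base_hframe charF r2; have uA := hA.1; set A := inM base_frame in hA uA *.
pose q : {poly F} := (dotp n (row 0 A))%:P + (dotp n (row 1 A))%:P * 'X + (dotp n (row 2%:R A))%:P * 'X^2.
have qt t : q.[t] = dotp n (param A t).
  rewrite param_mul mulmx_sum_row sum3 !mxE !dotpD !dotpZ /q !hornerE /= modn_small //; ring.
pose s' := [seq P <- s | P != pt (row 2%:R A)].
have [ts [uts hts]] : exists ts : seq F, uniq ts /\ s' = [seq pt (param A t) | t <- ts].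
  have : {subset s' <= s'} by []; have : uniq s' by apply: filter_uniq.
  move: {1 2 4}s' => s2; elim: s2 => [|P s2 IH] us2 sub; first by exists [::].
  have := sub _ (mem_head P s2); rewrite mem_filter => /andP [/eqP nP Ps].
  have [v v0 eP] := ptP P; have ZP : Z (pt v) by rewrite -eP; apply/hs.
  have [C _] := hZ v v0 ZP; rewrite -eP in C.
  case: (conic_ofP uA C) => // -[t et].
  have us2' : uniq s2 by case/andP: us2.
  have [R hR|ts [uts e2]] := IH us2'; first by apply: sub; rewrite in_cons hR orbT.
  exists (t :: ts); rewrite /= uts andbT et e2; split=> //.
  by apply/negP => ht; case/andP: us2 => /negP + _; rewrite e2 et; apply; apply: map_f.
have sz : (3 <= size ts)%N.
  have : size s' = size ts by rewrite hts size_map.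
  move=> <-; rewrite size_filter.
  have := count_predC (fun P => P != pt (row 2%:R A)) s; rewrite ss.
  have : (count (predC (fun P => P != pt (row 2%:R A))) s <= 1)%N.
    rewrite (eq_count (a2 := pred1 (pt (row 2%:R A)))); last by move=> P; rewrite /= negbK.
    by rewrite count_uniq_mem // leq_b1.
  move=> h1 h2; have : (4 <= count (fun P => P != pt (row 2%:R A)) s + 1)%N by rewrite -h2 leq_add2l.
  by rewrite addn1.
have ar : all (root q) ts.
  apply/allP => t ht; rewrite /root qt; apply/eqP.
  have : pt (param A t) \in s' by rewrite hts; apply: map_f.
  rewrite mem_filter => /andP [_ /hs hP].
  by have [] := hZ _ (param_neq0 t uA) hP.
have q0 : q = 0.
  apply/eqP/negPn/negP => nz; have := max_poly_roots nz ar uts.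
  have sq : (size q <= 3)%N.
    rewrite /q -[_%:P * 'X]mulrC !mul_polyC.
    apply: (leq_trans (size_polyD _ _)); rewrite geq_max; apply/andP; split; last first.
      by apply: (leq_trans (size_scale_leq _ _)); rewrite size_polyXn.
    apply: (leq_trans (size_polyD _ _)); rewrite geq_max; apply/andP; split.
      exact: leq_trans (size_polyC_leq1 _) _.
    by rewrite mulrC mul_polyC; apply: (leq_trans (size_scale_leq _ _)); rewrite size_polyX.
  by move=> h; move: (leq_trans h sq); rewrite ltnNge sz.
case/negP: n0; apply/eqP.
have e i : dotp n (row i A) = 0.
  move/polyP: q0 => q0; move: (q0 0%N) (q0 1%N) (q0 2%N).
  rewrite !(coefD, coefCM, coefXn, coefX, coefC, coef0) /= !(mulr0, mulr1, addr0, add0r).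
  by have [->|->|->] := ord3P i.
have : A *m n^T = 0.
  apply/colP => i; rewrite !mxE -[RHS](e i); apply: eq_bigr => k _.
  by rewrite !mxE mulrC.
move/(congr1 (mulmx (invmx A))); rewrite mulKmx // mulmx0 => /(congr1 trmx).
by rewrite trmxK trmx0.
Qed.

Lemma bitangent_meet w : bitangent w -> ~ has_card (conic0 `&` mv (wordM w) conic0) 4.
Proof.
rewrite /bitangent someE => /hasP [c _ /rank_oneP [n n0 hn]].
apply: (line_conic_meet n0) => v v0 [C0 Cw]; split=> //; apply: hn.
rewrite quad_sub (conic0_quad v0 C0) mulr0 addr0 quad_gram.
rewrite mv_conic0 in Cw; move/(hframe_conic (word_frame w) v0): Cw => ->.
by rewrite mulr0.
Qed.

Lemma G_rel_sym X Y : G_rel X Y -> G_rel Y X.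
Proof. by rewrite /G_rel [Y `&` X]setIC [calS Y `&` calS X]setIC. Qed.

Lemma G_adj_sym X Y : G_adj X Y -> G_adj Y X.
Proof. by move=> [h1 h2 n /G_rel_sym h]; split=> // e; apply: n. Qed.

Lemma coset0 : coset 0 = [::].
Proof. by []. Qed.

(** All conics are among the 150 translates, so the exhaustive check applies; a bitangent one is
    excluded by the condition of four common points. *)
Lemma neighbour_comp0 Y : G_adj conic0 Y ->
  exists2 p, p \in pairs & ~~ disjoint01 p.1 p.2 /\ Y = conic_block p.1 p.2.
Proof.
move=> [_ /(calQ_coset charF r2) [i [p [hi hp eY]]] _ [h4 h3]].
have [p1 p2 p3] := pairsP hp; have p12 : p.1 != p.2 by rewrite neq_ltn p3.
have hc : hascode Y (map (word_act (coset i)) (block p.1 p.2)).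
  by rewrite eY; apply/(hascode_mv charF r2)/(hascode_block charF r2).
have e3 : shared_secants (map (word_act (coset i)) (block p.1 p.2)) = 3.
  exact: has_card_uniq (calS_shared charF r2 hc) h3.
have eY' : Y = mv (wordM (block_word p.1 p.2 ++ coset i)) conic0.
  by rewrite eY (mv_cat charF r2).
have /allP /(_ i) := neighbours_okP; rewrite mem_iota => /(_ hi) /allP /(_ p hp).
cbv beta zeta; case: ifP => [/andP [/eqP i0 nd] _|_].
  by exists p => //; split=> //; rewrite eY i0 coset0 /mv image_act1.
case: ifP => [|_ hb]; first by rewrite e3.
by case: (bitangent_meet (w := block_word p.1 p.2 ++ coset i) hb); rewrite -eY'.
Qed.

Lemma block01 : conic_block 0 1 = conic0.
Proof. exact: image_act1. Qed.

Lemma conic_valueE M t : hf (inV t) (row 2%:R (inM M)) * hf (inV t) (row 0 (inM M)) + hf (inV t) (row 1 (inM M)) ^+ 2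
    = inF (conic_value M t).
Proof.
rewrite !row_inM; case: M => [[a b] c]; rewrite /= !inV_herm //.
by rewrite inFD // !inFM // expr2.
Qed.

(** The second conic restricted to the first is a polynomial of degree at most 4 that is not zero,
    since it does not vanish at infinity. The four roots found in F_25 are therefore all its roots
    in F. *)
Lemma adjacent02 : G_adj conic0 (conic_block 0 2).
Proof.
have hc0 := hascode_base charF r2; have hc : hascode (conic_block 0 2) (block 0 2).
  exact: (hascode_block charF r2).
have hA1 := word_frame (block_word 0 2).
have eX := mv_conic0 (block_word 0 2); rewrite -/(conic_block 0 2) in eX.
have [/eqP s3 ninf /eqP c4] := and3P adjacent_okP.
move: (mulmm base_frame _) hA1 eX ninf c4 => A1 hA1 eX /eq25P ninf c4.
have hA := base_hframe charF r2; have uA := hA.1.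
have onX t : inV t != 0 -> conic_block 0 2 (pt (inV t)) <-> conic_value A1 t = zero25.
  move=> t0; rewrite eX (hframe_conic hA1 t0) conic_valueE.
  by split=> [/(inF_eq0 charF r2)|->]; rewrite ?inF0.
have row2 : row 2%:R (inM base_frame) = inV base_frame.2 by rewrite row_inM.
have row20 : inV base_frame.2 != 0 by rewrite -row2 row_neq0.
have [T [uT sT hT]] : exists T : seq f25, [/\ uniq T, size T = 4%N &
    forall t, t \in T -> conic_value A1 (param_point base_frame t) = zero25].
  exists [seq t <- f25s | eq25 (conic_value A1 (param_point base_frame t)) zero25]; split.
  - by apply: filter_uniq; vm_compute.
  - by rewrite size_filter.
  by move=> t; rewrite mem_filter => /andP [/eq25P].
move: (param_inV charF r2 base_frame) uA hA row2 row20 ninf hT.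
have hS : has_card (calS conic0 `&` calS (conic_block 0 2)) 3.
  by rewrite -s3; apply: (calS_shared charF r2 hc).
have h0 : calQ conic0 by case: hc0.
have h1 : calQ (conic_block 0 2) by case: hc.
clear hc hc0 s3; move: h0 h1 hS; rewrite /conic0; move: (inM base_frame) (base_frame.2) (param_point base_frame).
move=> A v2 pp h0 h1 hS parA uA hA row2 row20 ninf hT.
have card4 : has_card (conic_of A `&` conic_block 0 2) 4.
  have hX t : t \in T -> (conic_of A `&` conic_block 0 2) (pt (param A (inF t))).
    move=> /hT ht; split; first exact: conic_of_param.
    by have n0 := param_neq0 (inF t) uA; rewrite parA in n0 *; apply/(onX _ n0).
  rewrite -sT; apply: (has_card_image (f := fun t => pt (param A (inF t)))) => //.
    by move=> s t _ _ /(param_eq uA)/(inF_inj charF r2).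
  move=> P; split=> [[/(conic_ofP uA) h hP]|[t tT ->]]; last exact: hX.
  case: h => [[x ex]|e]; last first.
    by case: ninf; apply/(onX _ row20); rewrite -row2 -e.
  pose f := restr A (conic_form (inM A1)).
  have [sf _] := normal_form uA (conic_form_homog (inM A1)).
  have rootf y : conic_block 0 2 (pt (param A y)) -> root f y.
    rewrite eX /conic_of /zeros /= => /(vanishes_pt (conic_form_homog _) (param_neq0 y uA)).
    by move=> h; rewrite /root /f horner_restr h.
  have nf : f != 0.
    apply/eqP => f0; have [b eb] := restr_eq0 uA (conic_form_homog (inM A1)) f0.
    case: ninf; apply/(onX _ row20); rewrite -row2 eX /conic_of /zeros /= eb => v hv.
    by rewrite mevalM (conic_of_row2 uA hv) mulr0.
  have /mapP [t tT et] : x \in [seq inF t | t <- T].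
    apply/negPn/negP => nx; have ar : all (root f) (x :: [seq inF t | t <- T]).
      apply/andP; split; first by apply: rootf; rewrite -ex.
      by apply/allP => _ /mapP [t /hX [_ Xt] ->]; apply: rootf.
    have ur : uniq (x :: [seq inF t | t <- T]).
      by rewrite cons_uniq nx map_inj_uniq //; exact: (inF_inj charF r2).
    by have := max_poly_roots nf ar ur; rewrite /= size_map sT ltnNge sf.
  by exists t; rewrite // ex et.
have nX : conic_of A <> conic_block 0 2.
  by move=> e; case: ninf; apply/(onX _ row20); rewrite -row2 -e; apply: conic_of_row2.
exact: And4 h0 h1 nX (conj card4 hS).
Qed.

End Adjacency.

(** * The base component as T(7), and its translates *)

Section BaseComponent.
Variable F : closedFieldType.
Hypothesis charF : 5%N \in [pchar F].
Variable r : F.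
Hypothesis r2 : r ^+ 2 = 2%:R.
Local Notation wordM := (wordM r).
Local Notation genM := (genM r).
Local Notation Pt := (Pt r).
Local Notation hascode := (hascode r).
Local Notation conic0 := (conic0 r).
Local Notation conic_block := (conic_block r).
Local Notation comp0 := (comp0 r).
Implicit Types X Y : set (proj_point F).

Let word_unitary w : unitary charF (wordM w) := wordM_unitary charF r2 w.

Lemma triple_word a b c : (a < 7)%N -> (b < 7)%N -> (c < 7)%N -> a != b -> a != c -> b != c ->
  exists2 w, all (mem stab_gens) w &
    [/\ perm_word w 0 = a, perm_word w 1 = b & perm_word w 2 = c].
Proof.
move=> a7 b7 c7 nab nac nbc; have /andP [/allP hw] := triples_okP.
move/allP => /(_ a); rewrite iota7 => /(_ a7) /allP /(_ b).
rewrite iota7 => /(_ b7) /allP /(_ c); rewrite iota7 => /(_ c7).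
rewrite (negPf nab) (negPf nac) (negPf nbc) => /mapP [w /hw ww [-> -> ->]].
by exists w.
Qed.

Lemma adjacent_blocks a b c : (a < 7)%N -> (b < 7)%N -> (c < 7)%N -> a != b -> a != c -> b != c ->
  G_adj (conic_block a b) (conic_block a c).
Proof.
move=> a7 b7 c7 nab nac nbc; have [w hw [<- <- <-]] := triple_word a7 b7 c7 nab nac nbc.
rewrite -(mv_word_block charF r2 hw (isT : 0 < 7)%N (isT : 1 < 7)%N isT).
rewrite -(mv_word_block charF r2 hw (isT : 0 < 7)%N (isT : 2 < 7)%N isT).
apply/(G_adj_mv _ _ (word_unitary w)); rewrite block01; exact: adjacent02.
Qed.

Lemma pair_word a b : (a < 7)%N -> (b < 7)%N -> a != b ->
  exists2 w, all (mem stab_gens) w & perm_word w 0 = a /\ perm_word w 1 = b.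
Proof.
move=> a7 b7 nab; have [c /and3P [c7 nac nbc]] : exists c, [&& (c < 7)%N, a != c & b != c].
  have /allP := (erefl : all (fun a => all (fun b => has (fun c => (a != c) && (b != c)) (iota 0 7)) (iota 0 7)) (iota 0 7)).
  move/(_ a); rewrite iota7 => /(_ a7) /allP /(_ b); rewrite iota7 => /(_ b7) /hasP [c hc h].
  by exists c; rewrite -iota7 hc.
by have [w hw [h1 h2 _]] := triple_word a7 b7 c7 nab nac nbc; exists w.
Qed.

Lemma hascode_eq X l l' : hascode X l -> hascode X l' -> {subset l <= l'}.
Proof.
move=> [_ _ _ pl hX] [_ _ _ pl' hX'] i hi.
have [j hj e] := (hX' (Pt i)).1 ((hX (Pt i)).2 (ex_intro2 _ _ i hi erefl)).
by rewrite (Pt_inj charF r2 (pl _ hi) (pl' _ hj) e).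
Qed.

Lemma hascode_pair p : p \in pairs -> hascode (conic_block p.1 p.2) (block p.1 p.2).
Proof.
move=> /pairsP [h1 h2 h3]; have n : p.1 != p.2 by rewrite neq_ltn h3.
exact: (hascode_block charF r2 h1 h2 n).
Qed.

Lemma conic_block_inj p q : p \in pairs -> q \in pairs ->
  conic_block p.1 p.2 = conic_block q.1 q.2 -> p = q.
Proof.
move=> hp hq e; have /allP /(_ p hp) /allP /(_ q hq) := blocks_separatedP.
have hcp := hascode_pair hp; rewrite e in hcp.
move: (hascode_eq hcp (hascode_pair hq)) => {e hcp} sub.
by case/orP => [/eqP //|/psubP []].
Qed.

Lemma conic_block_eq a b c d : (a < 7)%N -> (b < 7)%N -> (c < 7)%N -> (d < 7)%N -> a != b -> c != d ->
  conic_block a b = conic_block c d -> (a = c /\ b = d) \/ (a = d /\ b = c).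
Proof.
move=> a7 b7 c7 d7; rewrite !neq_ltn => /orP [] ab /orP [] cd e.
- by case: (conic_block_inj (mem_pairs ab b7) (mem_pairs cd d7) e) => {e} -> ->; left.
- rewrite [RHS]conic_blockC in e.
  by case: (conic_block_inj (mem_pairs ab b7) (mem_pairs cd c7) e) => {e} -> ->; right.
- rewrite conic_blockC in e.
  by case: (conic_block_inj (mem_pairs ab a7) (mem_pairs cd d7) e) => {e} -> ->; right.
rewrite conic_blockC [RHS]conic_blockC in e.
by case: (conic_block_inj (mem_pairs ab a7) (mem_pairs cd c7) e) => {e} -> ->; left.
Qed.

Lemma adjacent_comp0 a b Y : (a < 7)%N -> (b < 7)%N -> a != b -> G_adj (conic_block a b) Y ->
  exists c d, [/\ (c < 7)%N, (d < 7)%N, c != d, Y = conic_block c d &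
    [|| c == a, c == b, d == a | d == b]].
Proof.
move=> a7 b7 nab; have [w hw [<- <-]] := pair_word a7 b7 nab.
rewrite -(mv_word_block charF r2 hw (isT : 0 < 7)%N (isT : 1 < 7)%N isT) block01.
rewrite -[Y](mvKV (word_unitary w)) => /(G_adj_mv _ _ (word_unitary w)).
move=> /(neighbour_comp0 charF r2) [p /pairsP [h1 h2 h3] [nd ->]].
have n3 : p.1 != p.2 by rewrite neq_ltn h3.
exists (perm_word w p.1), (perm_word w p.2); rewrite !perm_word_lt //; split=> //.
- by apply: contraNneq n3 => /perm_word_inj ->.
- exact: mv_word_block.
move: nd; rewrite /disjoint01 !negb_and !negbK.
by case/or4P => /eqP ->; rewrite eqxx ?orbT.
Qed.

Lemma calD_comp0 : calD comp0.
Proof.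
exists conic0; first by have [] := hascode_base charF r2.
have closed X Y : G_adj X Y -> comp0 X -> comp0 Y.
  move=> hXY /comp0P [a [b [a7 b7 nab eX]]]; rewrite eX in hXY.
  have [c [d [c7 d7 ncd -> _]]] := adjacent_comp0 a7 b7 nab hXY.
  exact: comp0_block.
rewrite predeqE => X; split=> [/comp0P [a [b [a7 b7 nab ->]]]|h] /=.
  rewrite -block01.
  (* With the pair oriented so that d is not 0, the path {0, 1}, {0, d}, {c, d} connects it to the
     base conic; repetitions are allowed. *)
  have [c [d [c7 d7 d0 ncd ->]]] : exists c d, [/\ (c < 7)%N, (d < 7)%N, d != 0%N, c != d & conic_block a b = conic_block c d].
    have [b0|b0] := eqVneq b 0%N; last by exists a, b.
    by exists b, a; rewrite conic_blockC; split; rewrite // -?b0 // eq_sym.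
  have l1 : clos_refl_sym_trans _ (adjacent (@calQ F) (@G_rel F)) (conic_block 0 1) (conic_block 0 d).
    have [->|nd] := eqVneq 1%N d; first exact: rst_refl.
    by apply: rst_step; apply: adjacent_blocks; rewrite // eq_sym.
  apply: rst_trans l1 _; rewrite [conic_block c d]conic_blockC [conic_block 0 d]conic_blockC.
  have [->|nd] := eqVneq 0%N c; first exact: rst_refl.
  by apply: rst_step; apply: adjacent_blocks; rewrite // eq_sym.
have : comp0 conic0 <-> comp0 X.
  elim: h => [U V hUV|U|U V _ IH|U V W _ IH1 _ IH2] //.
  - by split; apply: closed; [exact: hUV|exact: G_adj_sym].
  - by rewrite IH.
  - by rewrite IH1.
by case=> + _; apply; rewrite -block01; apply: comp0_block.
Qed.

Definition coset_comp i : set (set (proj_point F)) := mvfam (wordM (coset i)) comp0.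

Lemma calD_coset i : calD (coset_comp i).
Proof. exact/(calD_mv (word_unitary _))/calD_comp0. Qed.

Lemma calDP D : calD D -> exists2 i, (i < 150)%N & D = coset_comp i.
Proof.
move=> hD; have [X DX] := component_inhabited hD.
have [i [p [hi hp eX]]] := calQ_coset charF r2 (component_vertex hD DX).
exists i => //; apply: component_meet hD (calD_coset i) DX _; rewrite eX.
by apply/(mvfam_mem _ _ (word_unitary _)); exists p.
Qed.

Lemma coset_comp0 : coset_comp 0 = comp0.
Proof.
rewrite predeqE => X; split=> [[Y hY <-]|hX]; first by rewrite /mv image_act1.
by exists X; rewrite // /mv image_act1.
Qed.

Lemma coset_gen i g : (i < 150)%N ->
  (coset_act i g < 150)%N /\ mvfam (genM g) (coset_comp i) = coset_comp (coset_act i g).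
Proof.
move=> hi; have hp : (0, 1)%N \in pairs by [].
have [hj [q hq e]] := coset_step charF r2 g hi hp; split=> //.
have hg := genM_unitary charF r2 g.
apply: (component_meet (x := mv (genM g) (mv (wordM (coset i)) (conic_block 0 1)))).
- exact/(calD_mv hg)/calD_coset.
- exact: calD_coset.
- by apply/(mvfam_mem _ _ hg)/(mvfam_mem _ _ (word_unitary _)); exists (0, 1)%N.
by rewrite e; apply/(mvfam_mem _ _ (word_unitary _)); exists q.
Qed.

Lemma mvfamM B C D : unitary charF B -> unitary charF C -> mvfam (B *m C) D = mvfam C (mvfam B D).
Proof.
move=> hB hC; have e X : mv (B *m C) X = mv C (mv B X) by apply: image_actM; apply: unitary_unit.
rewrite predeqE => X; split=> [[Y DY <-]|[_ [Y DY <-] <-]]; last by exists Y; rewrite ?e.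
by rewrite e; exists (mv B Y) => //; exists Y.
Qed.

Lemma mvfam1 (D : set (set (proj_point F))) : mvfam 1%:M D = D.
Proof.
rewrite predeqE => X; split=> [[Y hY <-]|hX]; first by rewrite /mv image_act1.
by exists X; rewrite // /mv image_act1.
Qed.

Lemma coset_word i w : (i < 150)%N ->
  (coset_move i w < 150)%N /\ mvfam (wordM w) (coset_comp i) = coset_comp (coset_move i w).
Proof.
move=> hi; elim/last_ind: w => [|w g [hj IH]]; first by rewrite mvfam1.
rewrite wordM_rcons mvfamM //; last exact: genM_unitary.
by rewrite IH /coset_move foldl_rcons; apply: coset_gen.
Qed.

Lemma coset_comp_base i : (i < 150)%N -> coset_comp i = comp0 -> i = 0%N.
Proof.
move=> hi e; apply/eqP/negPn/negP => i0.
have /allP /(_ i) := base_separatedP; rewrite mem_iota lt0n i0 => /(_ hi) /allP h.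
have : coset_comp i conic0 by rewrite e -block01; apply: comp0_block.
case=> Y [p hp ->] e0; have /negP := h p hp; apply; apply/psubP.
have hc' := hascode_mv charF r2 (coset i) (hascode_pair hp); rewrite e0 in hc'.
exact: (hascode_eq (hascode_base charF r2) hc').
Qed.

Lemma class_lt i : (coset_class i < 3)%N.
Proof. exact: ltn_pmod. Qed.

Definition turns (w : word) : nat := count (fun g => if g is Gt then true else false) w.

Lemma class_word i w : (i < 150)%N -> coset_class (coset_move i w) = ((coset_class i + turns w) %% 3)%N.
Proof.
move=> hi; elim/last_ind: w => [|w g IH].
  by rewrite addn0 modn_small ?class_lt.
rewrite /coset_move foldl_rcons -/(coset_move i w).
have [hj _] := coset_word w hi; have /allP /(_ (coset_move i w)) := classes_okP.
rewrite mem_iota => /(_ hj) /allP /(_ g).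
have -> : g \in gens by case: g.
move/(_ isT)/eqP => ->; rewrite IH modnDml /turns -cats1 count_cat addnA.
by case: g; rewrite /= ?addn0.
Qed.

(* [coset i] followed by the inverse of [coset j] measures the class of i
   relative to that of j. *)
Definition relative j i := coset_move i (winv (coset j)).

Lemma coset_relative i j : (i < 150)%N -> (j < 150)%N ->
  [/\ (relative j i < 150)%N, mvfam (wordM (coset j)) (coset_comp (relative j i)) = coset_comp i &
   coset_class i = ((coset_class (relative j i) + coset_class j) %% 3)%N].
Proof.
move=> hi hj; have [h e] := coset_word (winv (coset j)) hi.
have [h' e'] := coset_word (winv (coset j)) hj.
split=> //.
  rewrite -e -mvfamM //; have -> : wordM (winv (coset j)) *m wordM (coset j) = 1%:M.
    exact/mulmx1C/wordM_winv.
  exact: mvfam1.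
have j0 : coset_move j (winv (coset j)) = 0%N.
  apply: coset_comp_base => //; rewrite -e' /coset_comp -mvfamM //.
  by rewrite wordM_winv // mvfam1.
have := class_word (winv (coset j)) hj; rewrite j0 => c0.
rewrite /relative class_word // modnDml -addnA [(turns _ + _)%N]addnC -modnDmr -c0.
by rewrite (_ : coset_class 0 = 0)%N // addn0 modn_small // class_lt.
Qed.

Lemma same_class i j : (i < 150)%N -> (j < 150)%N ->
  (coset_class i == coset_class j) = (coset_class (relative j i) == 0%N).
Proof.
move=> hi hj; have [_ _ ->] := coset_relative hi hj.
move: (class_lt j) (class_lt (relative j i)); move: (coset_class j) (coset_class (relative j i)).
by move=> [|[|[|?]]] [|[|[|?]]].
Qed.

End BaseComponent.

(** * The components of H *)

Section Types.
Variable F : closedFieldType.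
Hypothesis charF : 5%N \in [pchar F].
Variable r : F.
Hypothesis r2 : r ^+ 2 = 2%:R.
Local Notation wordM := (wordM r).
Local Notation hascode := (hascode r).
Local Notation conic_block := (conic_block r).
Local Notation comp0 := (comp0 r).
Local Notation coset_comp := (coset_comp r).
Implicit Types X Y : set (proj_point F).

Let word_unitary w : unitary charF (wordM w) := wordM_unitary charF r2 w.

Definition coset_conic i (p : nat * nat) := mv (wordM (coset i)) (conic_block p.1 p.2).

Lemma hascode_coset i p : p \in pairs -> hascode (coset_conic i p) (coset_block i p).
Proof. by move=> hp; exact: (hascode_mv charF r2 (coset i) (hascode_pair charF r2 hp)). Qed.

Lemma coset_conic_inj i p q : p \in pairs -> q \in pairs ->
  coset_conic i p = coset_conic i q -> p = q.
Proof. by move=> hp hq /(mv_inj (word_unitary _)); exact: (conic_block_inj charF r2 hp hq). Qed.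

Lemma coset_compP i X : coset_comp i X <-> exists2 p, p \in pairs & X = coset_conic i p.
Proof.
split=> [[_ [p hp ->] <-]|[p hp ->]]; first by exists p.
by exists (conic_block p.1 p.2) => //; exists p.
Qed.

Lemma pairs_uniq : uniq pairs.
Proof. by []. Qed.

Lemma count_card (f : nat * nat -> set (proj_point F)) (A : set (set (proj_point F))) (a : pred (nat * nat)) n :
  {in pairs &, injective f} -> (forall X, A X <-> exists2 p, p \in pairs & X = f p /\ a p) ->
  has_card A n <-> count a pairs = n.
Proof.
move=> inj hA; have h : has_card A (count a pairs).
  rewrite -size_filter; apply: (has_card_image (f := f)).
  - exact/filter_uniq/pairs_uniq.
  - by move=> p q; rewrite mem_filter => /andP [_ hp]; rewrite mem_filter => /andP [_ hq]; apply: inj.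
  move=> X; rewrite hA; split=> [[p hp [-> ap]]|[p]]; first by exists p; rewrite // mem_filter ap.
  by rewrite mem_filter => /andP [ap hp] ->; exists p.
by split=> [h'|<- //]; apply: has_card_uniq h h'.
Qed.

Lemma meet_count_profile i p m n : p \in pairs ->
  meet_count (conic_block p.1 p.2) (coset_comp i) m n <-> profile i p m = n.
Proof.
move=> hp; apply: (count_card (f := coset_conic i)).
  by move=> q q' hq hq'; apply: coset_conic_inj.
have hm q : q \in pairs -> has_card (conic_block p.1 p.2 `&` coset_conic i q `&` (@Gamma F)) m <->
   meet_number (block p.1 p.2) (coset_block i q) = m.
  by move=> hq; apply: (hascode_meet charF r2) (hascode_pair charF r2 hp) (hascode_coset i hq).
move=> X; split=> [[/coset_compP [q hq ->] /(hm q hq)/eqP h]|[q hq [-> /eqP/(hm q hq) h]]].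
  exact: (ex_intro2 _ _ q hq (conj erefl h)).
by split=> //; apply/coset_compP; exact: (ex_intro2 _ _ q hq erefl).
Qed.

Lemma t_is_profile i p tau : p \in pairs ->
  t_is (conic_block p.1 p.2) (coset_comp i) tau <-> profile_type (profile i p) tau.
Proof.
move=> hp; have e m n := propext (meet_count_profile i m n hp).
case: tau; rewrite /t_is !e /profile_type.
- by split=> [[-> ->]|/andP [/eqP -> /eqP ->]].
- by split=> [[-> -> ->]|/and3P [/eqP -> /eqP -> /eqP ->]].
by split=> [[-> ->]|/andP [/eqP -> /eqP ->]].
Qed.

Lemma type_count_number i tau n :
  type_count comp0 (coset_comp i) tau n <-> type_number i tau = n.
Proof.
apply: (count_card (f := fun p => conic_block p.1 p.2)).
  by move=> q q' hq hq'; apply: (conic_block_inj charF r2).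
move=> X; split=> [[[p hp ->] /(t_is_profile _ _ hp) h]|[p hp [-> /(t_is_profile _ _ hp) h]]].
  exact: (ex_intro2 _ _ p hp (conj erefl h)).
by split=> //; exact: (ex_intro2 _ _ p hp erefl).
Qed.

Lemma stab_word_comp0 w : all (mem stab_gens) w -> mvfam (wordM w) comp0 = comp0.
Proof.
move=> hw; apply: (component_meet (x := mv (wordM w) (conic_block 0 1))).
- exact/(calD_mv (word_unitary w))/(calD_comp0 charF r2).
- exact: (calD_comp0 charF r2).
- by apply/(mvfam_mem _ _ (word_unitary w)); exact: comp0_block.
rewrite (mv_word_block charF r2 hw (isT : 0 < 7)%N (isT : 1 < 7)%N isT).
apply: comp0_block; try exact: perm_word_lt.
by apply/eqP => /(perm_word_inj (isT : 0 < 7)%N (isT : 1 < 7)%N).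
Qed.

Lemma orbit_rep i : (i < 150)%N -> exists k w, [/\ k \in orbit_reps, all (mem stab_gens) w,
  (k < 150)%N, coset_move k w = i & coset_class i = coset_class k].
Proof.
move=> hi; have /andP [/allP h /allP /(_ i)] := orbits_okP.
rewrite mem_iota => /(_ hi) /mapP [x /h /and3P [hk hw /eqP e] ->].
have k150 : (x.1.2 < 150)%N.
  by have /allP : all (fun k => k < 150)%N orbit_reps by []; apply.
exists x.1.2, x.2; split=> //; rewrite -e (class_word charF r2) //.
have -> : turns x.2 = 0%N.
  by move: hw; rewrite /turns; elim: x.2 => //= g w IH /andP [hg /IH ->]; case: g hg.
by rewrite addn0 modn_small // class_lt.
Qed.

Lemma T_is_move k w tau : (k < 150)%N -> all (mem stab_gens) w ->
  T_is comp0 (coset_comp (coset_move k w)) tau <-> T_is comp0 (coset_comp k) tau.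
Proof.
move=> hk hw; have [_ <-] := coset_word charF r2 w hk.
by rewrite -{1}(stab_word_comp0 hw); apply/T_is_mv/word_unitary.
Qed.

Lemma rep_types k : k \in orbit_reps ->
  (T_is comp0 (coset_comp k) Beta21 <-> k \in [:: 67; 125]%N) /\
  (T_is comp0 (coset_comp k) Alpha15Gam6 <-> k = 106%N).
Proof.
move=> hk; have /allP /(_ k hk) /andP [/eqP e1 /eqP e2] := types_okP; split.
  rewrite -e1; split=> [h|/allP h X [p hp ->]].
    by apply/allP => p hp; apply/(t_is_profile _ _ hp)/h; exact: (ex_intro2 _ _ p hp erefl).
  exact/(t_is_profile _ _ hp)/h.
rewrite /T_is; split=> [[/type_count_number h1 /type_count_number h2]|ek].
  by apply/eqP; rewrite -e2 h1 h2.
by move/esym: e2; rewrite ek eqxx => /esym /andP [/eqP h1 /eqP h2]; split; apply/type_count_number.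
Qed.

(** The two stabilizer orbits in the neighbourhood lie in the classes 1 and 2, so the class of a
    neighbour tells its orbit. Stabilizer words contain no [Gt] and do not change the class. *)
Lemma calN_coset i : (i < 150)%N -> calN comp0 (coset_comp i) ->
  exists k w, [/\ (k, coset_class i) \in [:: (67, 1); (125, 2)]%N, all (mem stab_gens) w, (k < 150)%N &
    coset_move k w = i].
Proof.
move=> hi [_ _]; have [k [w [hk hw k150 <- ->]]] := orbit_rep hi.
move/(T_is_move _ k150 hw)/(rep_types hk).1; rewrite !inE => /orP [] /eqP ->;
  by [exists 67%N, w|exists 125%N, w].
Qed.

Local Notation linked := (clos_refl_sym_trans _ (adjacent (@calD F) (@H_rel F))).

Lemma linked_mv B D D' : unitary charF B -> linked D D' -> linked (mvfam B D) (mvfam B D').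
Proof. by move=> hB; apply: linked_map => U V; apply: H_adj_mv. Qed.

Lemma H_rel_class i : (i < 150)%N -> H_rel comp0 (coset_comp i) -> coset_class i = 0%N.
Proof.
move=> hi; have [k [w [hk hw k150 <- ->]]] := orbit_rep hi.
by move/(T_is_move _ k150 hw)/(rep_types hk).2 => ->.
Qed.

Lemma linked_106 : linked comp0 (coset_comp 106).
Proof.
apply: rst_step; split.
- exact: (calD_comp0 charF r2).
- exact: (calD_coset charF r2).
- by move/esym/(coset_comp_base charF r2 (isT : 106 < 150)%N).
by apply/(rep_types _).2.
Qed.

(** The components of class 0 are reached by walks made of stabilizer elements, which fix the base
    component, and of the word of coset 106, which moves it to an H-neighbour; either kind of step
    preserves being linked to the base. *)
Lemma linked_class0 i : (i < 150)%N -> coset_class i = 0%N -> linked comp0 (coset_comp i).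
Proof.
move=> hi c0; have /andP [/allP h /allP /(_ i)] := walks_okP.
rewrite mem_iota => /(_ hi); rewrite c0 eqxx => /mapP [x /h /andP [/eqP <- +] ->].
elim/last_ind: (x.2) => [|w g IH]; first by rewrite (coset_comp0 r); move=> _; exact: rst_refl.
rewrite all_rcons foldl_rcons => /andP [hg /IH].
have : (foldl walk_act 0 w < 150)%N.
  elim/last_ind: w {IH} => [|w g' IH] //; rewrite foldl_rcons.
  by case: g' => /=; [exact: (coset_gen charF r2 Ga IH).1|exact: (coset_gen charF r2 Gb IH).1|
    exact: (coset_gen charF r2 Gc IH).1|exact: (coset_word charF r2 (coset 106) IH).1|
    exact: (coset_gen charF r2 Gu IH).1].
move: (foldl _ _ _) => j hj hl.
have gen_step g' : g' \in stab_gens -> linked comp0 (coset_comp (coset_act j g')).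
  move=> hg'; have hw : all (mem stab_gens) [:: g'] by rewrite /= andbT.
  have := linked_mv (word_unitary [:: g']) hl; rewrite (stab_word_comp0 hw).
  by rewrite (coset_word charF r2 [:: g'] hj).2.
case: g hg => hg; [exact: (gen_step Ga isT)|exact: (gen_step Gb isT)|exact: (gen_step Gc isT)| |by []].
(* The word of coset 106 carries the link from the base to j to a link from coset 106 to the next
   component of the walk. *)
apply: rst_trans linked_106 _; rewrite -(coset_word charF r2 (coset 106) hj).2.
exact: linked_mv.
Qed.

(** Translating by the inverse of coset j reduces both directions to links with the base component:
    edges there stay in class 0, and class 0 is connected. *)
Lemma linked_class i j : (i < 150)%N -> (j < 150)%N ->
  linked (coset_comp j) (coset_comp i) <-> coset_class i = coset_class j.
Proof.
move=> hi hj; split=> [h|/eqP e].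
  suff key D D' : linked D D' -> forall a b, (a < 150)%N -> (b < 150)%N ->
      D = coset_comp a -> D' = coset_comp b -> coset_class b = coset_class a.
    exact: key h _ _ hj hi erefl erefl.
  have same a b : (a < 150)%N -> (b < 150)%N -> coset_comp a = coset_comp b -> coset_class b = coset_class a.
    move=> ha hb e; have [hk ek _] := coset_relative charF r2 hb ha; have ck := same_class charF r2 hb ha.
    apply/eqP; rewrite ck; apply/eqP; rewrite (coset_comp_base charF r2 hk) //.
    by apply: (mvfam_inj (word_unitary (coset a))); rewrite ek -e.
  elim=> [U V [_ _ _ hUV]|U|U V _ IH|U V W hUV IH1 _ IH2] a b ha hb eU eV.
  - have [hk ek _] := coset_relative charF r2 hb ha; have ck := same_class charF r2 hb ha; apply/eqP; rewrite ck; apply/eqP.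
    apply: (H_rel_class hk); apply/(T_is_mv _ _ _ (word_unitary (coset a))).
    by rewrite ek -eV -/(coset_comp a) -eU.
  - by apply: same; rewrite // -eU.
  - by apply/esym/IH.
  have hV : calD V.
    by apply/(linked_vertex hUV); rewrite eU; exact: (calD_coset charF r2).
  have [c hc eVc] := calDP charF r2 hV.
  by rewrite (IH2 c b) // (IH1 a c).
have [hk ek _] := coset_relative charF r2 hi hj.
rewrite -ek -/(coset_comp j); apply: linked_mv => //; apply: linked_class0 => //.
by apply/eqP; rewrite -(same_class charF r2).
Qed.

End Types.

(** * The groups of the two Fano planes *)

Definition word_perm_fun (w : word) (a : 'I_7) : 'I_7 := Ordinal (perm_word_lt w (ltn_ord a)).

Lemma word_perm_inj w : injective (word_perm_fun w).
Proof. by move=> a b /(congr1 val) /= /perm_word_inj e; apply/ord_inj/e. Qed.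

Definition word_perm (w : word) : 'S_7 := perm (@word_perm_inj w).

Lemma word_permE w a : word_perm w a = perm_word w a :> nat.
Proof. by rewrite permE. Qed.

Lemma word_perm_cat w w' : word_perm (w ++ w') = (word_perm w * word_perm w')%g.
Proof. by apply/permP => a; apply: ord_inj; rewrite permM !word_permE /perm_word foldl_cat. Qed.

Lemma word_perm_nil : word_perm [::] = 1%g.
Proof. by apply/permP => a; apply: ord_inj; rewrite perm1 word_permE. Qed.

Lemma word_perm_even w : all (mem stab_gens) w -> ~~ word_perm w.
Proof.
elim: w => [|g w IH]; first by rewrite word_perm_nil odd_perm1.
move=> /andP [hg /IH h]; rewrite -cat1s word_perm_cat odd_permM (negPf h) addbF.
(* a generator of odd order is a square *)
suff [n e] : exists n, word_perm [:: g] = (word_perm (nseq n g) * word_perm (nseq n g))%g.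
  by rewrite e odd_permM addbb.
(* 22 is 1 modulo both orders, 3 and 7. *)
exists 11; rewrite -word_perm_cat; apply/permP => a; apply: ord_inj; rewrite !word_permE.
have /allP /(_ g hg) /allP /(_ a) : all (fun g => all (fun a =>
    perm_word [:: g] a == perm_word (nseq 11 g ++ nseq 11 g) a) (iota 0 7)) stab_gens by [].
by rewrite iota7 => /(_ (ltn_ord a)) /eqP.
Qed.

Definition preserves (T : nat -> nat -> nat) (s : 'S_7) :=
  forall a b c : 'I_7, a != b -> T a b = c -> T (s a) (s b) = s c.

Section PlaneWords.
Variables (i : nat) (gs : seq gen) (T : nat -> nat -> nat) (ws : seq word).
Hypothesis ok : plane_ok i gs T ws.

Lemma plane_gens g : g \in gs -> coset_act i g = i /\ g \in stab_gens.
Proof. by case/and5P: ok => /andP [_ _] /allP h _ _ _ /h /andP [/eqP]. Qed.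

Lemma plane_stab_word w : all (mem gs) w -> all (mem stab_gens) w.
Proof. by apply: sub_all => g /plane_gens []. Qed.

Lemma plane_fixed w : all (mem gs) w -> coset_move i w = i.
Proof. by rewrite /coset_move; elim: w => //= g w IH /andP [/plane_gens [-> _]]. Qed.

Lemma plane_word_preserves w : all (mem gs) w -> preserves T (word_perm w).
Proof.
elim: w => [|g w IH]; first by rewrite word_perm_nil => _ a b c nab; rewrite !perm1.
move=> /andP [hg /IH h] a b c nab e; rewrite -cat1s word_perm_cat !permM; apply: h.
  by apply: contraNneq nab => /perm_inj ->.
rewrite !word_permE /perm_word /= -e.
case/and5P: ok => _ _ /allP /(_ g hg) /allP /(_ a) + _ _.
rewrite iota7 => /(_ (ltn_ord a)) /allP /(_ b); rewrite iota7 => /(_ (ltn_ord b)).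
by rewrite (negPf nab : (a == b :> nat) = false) => /eqP.
Qed.

(** A word with the same effect as s on the triangle 0, 1, 3 exists by [plane_ok]; the other four
    labels follow by third points. *)
Lemma plane_generated s : preserves T s -> exists2 w, all (mem gs) w & s = word_perm w.
Proof.
move=> hs; pose o k : 'I_7 := inord k.
have oE k : (k < 7)%N -> o k = k :> nat by move=> k7; rewrite inordK.
case/and5P: ok => /andP [/eqP T01 /allP cl] _ _ /allP hw /andP [+ _].
have ns (a b : nat) : (a < 7)%N -> (b < 7)%N -> a != b -> (s (o a) : nat) != s (o b).
  by move=> a7 b7; apply: contraNneq => /ord_inj/perm_inj/(congr1 val); rewrite /= !oE // => ->.
move/allP => /(_ (s (o 0))); rewrite iota7 => /(_ (ltn_ord _)) /allP /(_ (s (o 1))).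
rewrite iota7 => /(_ (ltn_ord _)) /allP /(_ (s (o 3))); rewrite iota7 => /(_ (ltn_ord _)).
have e2 : T (s (o 0)) (s (o 1)) = s (o 2) by apply: hs; rewrite ?oE // -val_eqE /= !oE.
rewrite e2 !(negPf (ns _ _ _ _ _)) // => /mapP [w /hw ww [e0 e1 e3]]; exists w => //.
have hp := plane_word_preserves ww.
have eq0 : s (o 0) = word_perm w (o 0) by apply: ord_inj; rewrite word_permE oE.
have eq1 : s (o 1) = word_perm w (o 1) by apply: ord_inj; rewrite word_permE oE.
have eq3 : s (o 3) = word_perm w (o 3) by apply: ord_inj; rewrite word_permE oE.
have step (a b c : 'I_7) : a != b -> T a b = c -> s a = word_perm w a -> s b = word_perm w b ->
    s c = word_perm w c.
  by move=> nab e ea eb; apply: ord_inj; rewrite -(hs a b c) // -(hp a b c) // ea eb.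
have no (a b : nat) : (a < 7)%N -> (b < 7)%N -> a != b -> o a != o b.
  by move=> a7 b7; rewrite -val_eqE /= !oE.
have eq2 : s (o 2) = word_perm w (o 2) by apply: step eq0 eq1; rewrite ?no // !oE.
apply/permP => c; have := cl c; rewrite iota7 => /(_ (ltn_ord c)).
have co k : (k < 7)%N -> c = k :> nat -> c = o k by move=> k7 e; apply: ord_inj; rewrite oE.
rewrite !inE => /or3P [/eqP/co-> //|/eqP/co-> //|].
case/or3P => [/eqP/co-> //|/eqP/co-> //|].
by case/or3P => /eqP e; [apply: step eq0 eq3|apply: step eq1 eq3|apply: step eq2 eq3]; rewrite ?no // !oE.
Qed.
End PlaneWords.

Section Fano.

Lemma F2P (x : 'F_2) : x = 0 \/ x = 1.
Proof. by case: x => [[|[|n]] h] //; [left|right]; apply: val_inj. Qed.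

Definition code (v : 'rV['F_2]_3) : nat :=
  (4 * v 0%R (inord 0) + 2 * v 0%R (inord 1) + v 0%R (inord 2))%N.

Definition of_code (k : nat) : 'rV['F_2]_3 := \row_(i < 3) (nth 0 [:: k %/ 4; k %/ 2; k] i)%N%:R.

Lemma of_codeK k : (k < 8)%N -> code (of_code k) = k.
Proof.
move=> k8; rewrite /code !mxE !inordK //=.
by move: k8; do 8?[case: k => [|k] //].
Qed.

Lemma codeK v : of_code (code v) = v.
Proof.
apply/rowP => i; rewrite !mxE /code; move: (F2P (v 0 (inord 0))) (F2P (v 0 (inord 1))) (F2P (v 0 (inord 2))).
have [->|->|->] := ord3P i.
- rewrite (_ : inord 0 = 0 :> 'I_3); last by apply: val_inj; rewrite /= inordK.
  by move=> [] -> [] -> [] ->; apply: val_inj.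
- rewrite (_ : inord 1 = 1 :> 'I_3); last by apply: val_inj; rewrite /= inordK.
  by move=> [] -> [] -> [] ->; apply: val_inj.
rewrite (_ : inord 2 = 2%:R :> 'I_3); last by apply: val_inj; rewrite /= inordK.
by move=> [] -> [] -> [] ->; apply: val_inj.
Qed.

Lemma code_lt v : (code v < 8)%N.
Proof.
by rewrite /code; move: (F2P (v 0 (inord 0))) (F2P (v 0 (inord 1))) (F2P (v 0 (inord 2))) =>
  [] -> [] -> [] ->.
Qed.

Lemma code0 : code 0 = 0%N.
Proof. by rewrite /code !mxE. Qed.

Lemma code_gt0 v : v != 0 -> (0 < code v)%N.
Proof. by rewrite lt0n; apply: contraNneq => e; apply/eqP/(can_inj codeK); rewrite e code0. Qed.

Lemma rhoE v : v != 0 -> rho v = (code v).-1 :> nat.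
Proof. by move=> /code_gt0 h; rewrite /rho inordK // -ltnS prednK ?code_lt. Qed.

Lemma addvv (v : 'rV['F_2]_3) : v + v = 0.
Proof. by apply/rowP => j; rewrite !mxE; case: (F2P (v 0 j)) => ->; apply: val_inj. Qed.

Lemma addv_neq0 (u v : 'rV['F_2]_3) : u != v -> u + v != 0.
Proof. by apply: contraNneq => e; rewrite -[u]addr0 -(addvv v) addrA e add0r. Qed.

Lemma third_rho u v : u != 0 -> v != 0 -> u != v -> third (rho u) (rho v) = rho (u + v).
Proof.
move=> u0 v0 nuv; have uv0 := addv_neq0 nuv.
rewrite !rhoE //; have := code_gt0 u0; have := code_gt0 v0.
have : code u != code v by apply: contraNneq nuv => /(can_inj codeK) ->.
rewrite /code !mxE; move: (F2P (u 0 (inord 0))) (F2P (u 0 (inord 1))) (F2P (u 0 (inord 2))).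
move: (F2P (v 0 (inord 0))) (F2P (v 0 (inord 1))) (F2P (v 0 (inord 2))).
by move=> [] -> [] -> [] -> [] -> [] -> [] ->.
Qed.

Definition rho_inv (a : 'I_7) : 'rV['F_2]_3 := of_code a.+1.

Lemma rho_inv_neq0 a : rho_inv a != 0.
Proof.
apply/eqP => e; have := of_codeK (ltn_ord a : a.+1 < 8)%N.
by rewrite -/(rho_inv a) e code0.
Qed.

Lemma rho_invK a : rho (rho_inv a) = a.
Proof. by apply: ord_inj; rewrite rhoE ?rho_inv_neq0 // of_codeK // ltnS ltn_ord. Qed.

Lemma rhoK v : v != 0 -> rho_inv (rho v) = v.
Proof. by move=> v0; rewrite /rho_inv rhoE // prednK ?codeK // code_gt0. Qed.

(** The third point of a line is the sum of the other two vectors, so this is the fundamental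
    theorem of projective geometry over F_2: collineations are linear. *)
Lemma Sigma_bP s : s \in Sigma_b <-> preserves third s.
Proof.
rewrite inE; split=> [/existsP [A /andP [/eqP dA /forallP hA]]|hs].
  have uA : A \in unitmx by rewrite unitmxE dA unitr1.
  have sA v : v != 0 -> s (rho v) = rho (v *m A) by move=> v0; have := hA v; rewrite v0 => /eqP.
  have A0 v : v != 0 -> v *m A != 0.
    by apply: contraNneq => /(congr1 (mulmx^~ (invmx A))); rewrite mulmxK // mul0mx => /eqP.
  move=> a b c nab; rewrite -[a]rho_invK -[b]rho_invK; have na := rho_inv_neq0 a; have nb := rho_inv_neq0 b.
  have nv : rho_inv a != rho_inv b by apply: contraNneq nab => /(congr1 rho); rewrite !rho_invK => /eqP.
  have nab0 := addv_neq0 nv.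
  rewrite third_rho // => /ord_inj <-; rewrite !sA // mulmxDl third_rho ?A0 //.
  by apply: contraNneq nv => /(congr1 (mulmx^~ (invmx A))); rewrite !mulmxK // => /eqP.
(* Extended by 0 at the origin, the permutation becomes an additive map, and additive maps over F_2
   are linear. *)
pose f v := if v == 0 then 0 else rho_inv (s (rho v)).
have f0 : f 0 = 0 by rewrite /f eqxx.
have fnz v : v != 0 -> f v != 0 by rewrite /f => /negPf ->; apply: rho_inv_neq0.
have fD : {morph f : u v / u + v}.
  move=> u v; have [->|u0] := eqVneq u 0; first by rewrite f0 !add0r.
  have [->|v0] := eqVneq v 0; first by rewrite f0 !addr0.
  have [->|nuv] := eqVneq u v; first by rewrite !addvv f0.
  have nuv0 := addv_neq0 nuv.
  have nr : rho u != rho v by apply: contraNneq nuv => /(congr1 rho_inv); rewrite !rhoK // => /eqP.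
  have := hs _ _ _ nr (third_rho u0 v0 nuv).
  rewrite /f (negPf u0) (negPf v0) (negPf nuv0).
  have ns : rho_inv (s (rho u)) != rho_inv (s (rho v)).
    by apply: contraNneq nr => /(congr1 rho); rewrite !rho_invK => /perm_inj/eqP.
  rewrite -{1}[s (rho u)]rho_invK -{1}[s (rho v)]rho_invK third_rho ?rho_inv_neq0 //.
  move/ord_inj => <-; rewrite rhoK //; exact: addv_neq0.
have fZ (x : 'F_2) v : f (x *: v) = x *: f v.
  by case: (F2P x) => ->; rewrite ?scale0r ?scale1r.
pose A : 'M['F_2]_3 := \matrix_i f (delta_mx 0 i).
have fA v : v *m A = f v.
  rewrite mulmx_sum_row {2}[v]row_sum_delta (big_morph f fD f0); apply: eq_bigr => i _.
  by rewrite rowK fZ.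
apply/existsP; exists A; apply/andP; split.
  have dA : \det A != 0.
    by apply/negP => /det0P [v v0]; rewrite fA => /eqP; rewrite (negPf (fnz v v0)).
  by case: (F2P (\det A)) dA => ->; rewrite ?eqxx.
by apply/forallP => v; apply/implyP => v0; rewrite fA /f (negPf v0) rho_invK.
Qed.

Definition tau : 'S_7 := tperm (inord 5) (inord 6).

Lemma tauE a : tau a = swap56 a :> nat.
Proof.
have e5 : (inord 5 : 'I_7) = 5%N :> nat by rewrite inordK.
have e6 : (inord 6 : 'I_7) = 6%N :> nat by rewrite inordK.
rewrite /tau /swap56; case: tpermP => [->|->|/eqP n5 /eqP n6]; rewrite ?e5 ?e6 //.
by rewrite -val_eqE /= e5 in n5; rewrite -val_eqE /= e6 in n6; rewrite (negPf n5) (negPf n6).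
Qed.

Lemma Sigma_b'E : Sigma_b' = (Sigma_b :^ tau)%g.
Proof.
apply/setP => s; rewrite mem_conjg !inE; apply: eq_existsb => A; congr andb.
apply: eq_forallb => v; congr implb; rewrite /rho' -/tau conjgE invgK tpermV !permM.
by rewrite -(inj_eq (@perm_inj _ tau)) -[tau (tau _)]permM tperm2 perm1.
Qed.

Lemma Sigma_b'P s : s \in Sigma_b' <-> preserves third' s.
Proof.
rewrite Sigma_b'E mem_conjg Sigma_bP conjgE invgK tpermV.
have tt a : tau (tau a) = a by rewrite -permM tperm2 perm1.
have tn a b : (tau a != tau b) = (a != b) by rewrite (inj_eq (@perm_inj _ tau)).
have sw a : swap56 (tau a) = a by rewrite -tauE tt.
have e (a b c : 'I_7) : third' a b = c <-> third (tau a) (tau b) = tau c.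
  rewrite /third' -!tauE; split=> [h|->]; last exact: sw.
  rewrite [RHS]tauE -h.
  have t7 : (third (tau a) (tau b) < 7)%N.
    have /allP /(_ (tau a)) : all (fun a => all (fun b => third a b < 7)%N (iota 0 7)) (iota 0 7) by [].
    by rewrite iota7 => /(_ (ltn_ord _)) /allP /(_ (tau b)); rewrite iota7 => /(_ (ltn_ord _)).
  by move: (third _ _) t7 => k; do 7?[case: k => [|k] //].
split=> hs a b c nab.
  move/e => h; apply/e; have := hs (tau a) (tau b) (tau c).
  by rewrite tn nab !permM !tt => /(_ isT h).
move=> h; rewrite !permM; apply/e; apply: hs; rewrite ?tn //.
by apply/e; rewrite !tt.
Qed.

Lemma Sigma_b_even s : s \in Sigma_b -> ~~ s.
Proof.
move/Sigma_bP/(plane_generated plane_j) => [w hw ->].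
exact/word_perm_even/(plane_stab_word plane_j).
Qed.

(** If y normalizes the group, it carries the common stabilizer of a and b to that of y a and y b,
    hence fixed labels to fixed labels. The third point is the only further fixed label, so y
    respects lines. *)
Lemma Sigma_b_norm y : (Sigma_b :^ y)%g = Sigma_b -> y \in Sigma_b.
Proof.
move=> hy; apply/Sigma_bP => a b c nab e.
have nabc : (a != c) && (b != c).
  have /allP /(_ a) : all (fun a => all (fun b => (a == b) || (third a b != a) && (third a b != b)) (iota 0 7)) (iota 0 7) by [].
  rewrite iota7 => /(_ (ltn_ord _)) /allP /(_ b); rewrite iota7 => /(_ (ltn_ord _)).
  rewrite (negPf nab : (a == b :> nat) = false) e /= => /andP [h1 h2].
  by rewrite eq_sym -val_eqE h1 eq_sym -val_eqE.
apply/esym/eqP/negPn/negP => nc.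
have ny (x z : 'I_7) : x != z -> (y x == y z :> nat) = false.
  by move=> n; apply/negP => /eqP/ord_inj/perm_inj e'; rewrite e' eqxx in n.
have /allP /(_ (y a)) := moved_okP; rewrite iota7 => /(_ (ltn_ord _)) /allP /(_ (y b)).
rewrite iota7 => /(_ (ltn_ord _)); rewrite (ny a b nab) => /allP /(_ (y c)).
rewrite iota7 => /(_ (ltn_ord _)); case/andP: nabc; rewrite eq_sym => nac; rewrite eq_sym => nbc.
rewrite (ny c a nac) (ny c b nbc) (negPf nc) !orFb someE => /hasP [l].
rewrite mem_filter => /andP [/andP [ha hb] /mapP [w hw el]] hc.
have wnth x : nth 0%N l (y x) = word_perm w (y x).
  by rewrite el (nth_map 0%N) ?size_iota ?ltn_ord // nth_iota ?ltn_ord // word_permE.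
rewrite !wnth in ha hb hc.
have ww : all (mem [:: Ga; Gb]) w.
  by case/and5P: plane_j => _ _ _ /allP h _; apply: h.
have : (word_perm w ^ y^-1)%g \in Sigma_b.
  by rewrite -mem_conjg hy; apply/Sigma_bP/(plane_word_preserves plane_j).
move/Sigma_bP => /(_ a b c nab e).
have E x : ((word_perm w) ^ y^-1)%g x = (y^-1)%g (word_perm w (y x)).
  by rewrite conjgE invgK !permM.
have fa : word_perm w (y a) = y a by apply/ord_inj/eqP.
have fb : word_perm w (y b) = y b by apply/ord_inj/eqP.
rewrite !E fa fb !permK e => /ord_inj ec; case/negP: hc; apply/eqP.
by rewrite {2}ec permKV.
Qed.

(** The group is its own normalizer and consists of even permutations, so all elements conjugating
    it to a given conjugate have the same parity; for [Sigma_b'] this parity is odd, by [tau]. *)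
Lemma conj_Sigma_b (a : 'S_7) :
  (conj_in_Alt7 (Sigma_b :^ a)%g Sigma_b <-> ~~ a) /\
  (conj_in_Alt7 (Sigma_b :^ a)%g Sigma_b' <-> a).
Proof.
have ot : odd_perm tau by rewrite odd_tperm -val_eqE /= !inordK.
have key x : (Sigma_b :^ a)%g = (Sigma_b :^ x)%g -> odd_perm a = odd_perm x.
  move=> h; have /Sigma_b_norm/Sigma_b_even : (Sigma_b :^ (a * x^-1))%g = Sigma_b.
    by rewrite conjsgM h conjsgK.
  by rewrite odd_permM odd_permV -addNb addbC; case: (odd_perm a); case: (odd_perm x).
split; split.
- by move=> [x]; rewrite Alt_even => hx /key ->.
- by move=> ha; exists a; rewrite // Alt_even.
- move=> [x]; rewrite Alt_even Sigma_b'E -conjsgM => hx /key ->.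
  by rewrite odd_permM ot (negPf hx).
move=> ha; exists (tau^-1 * a)%g; first by rewrite Alt_even odd_permM odd_permV ot ha.
by rewrite Sigma_b'E -conjsgM mulKVg.
Qed.

End Fano.

(** * Automorphisms of T(7) *)

Lemma triangle_meet (x y z s t : nat) : x <> y -> x <> z -> y <> z ->
  (s = x \/ s = y \/ t = x \/ t = y) -> (s = x \/ s = z \/ t = x \/ t = z) ->
  (s = y \/ s = z \/ t = y \/ t = z) ->
  ((s = x /\ t = y) \/ (s = y /\ t = x)) \/ ((s = x /\ t = z) \/ (s = z /\ t = x)) \/
  ((s = y /\ t = z) \/ (s = z /\ t = y)).
Proof.
move=> nxy nxz nyz m1 m2 m3.
case: m1 => [|[|[|]]] e1; case: m2 => [|[|[|]]] e2; case: m3 => [|[|[|]]] e3; subst;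
  first [congruence | by left; left | by left; right | by right; left; left | by right; left; right
    | by right; right; left | by right; right; right].
Qed.

(** Read the pairs as edges. If pq avoided x, it would be yz, and st would be a fourth edge meeting
    all three sides of the triangle xyz, whereas only the sides themselves do. *)
Lemma third_in_star (x y z p q s t : nat) : x <> y -> x <> z -> y <> z ->
  p <> q -> s <> t -> (p = x \/ p = y \/ q = x \/ q = y) -> (p = x \/ p = z \/ q = x \/ q = z) ->
  (s = x \/ s = y \/ t = x \/ t = y) -> (s = x \/ s = z \/ t = x \/ t = z) ->
  (s = p \/ s = q \/ t = p \/ t = q) ->
  ~ ((s = x /\ t = y) \/ (s = y /\ t = x)) -> ~ ((s = x /\ t = z) \/ (s = z /\ t = x)) ->
  ~ ((s = p /\ t = q) \/ (s = q /\ t = p)) -> x = p \/ x = q.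
Proof.
move=> nxy nxz nyz npq nst m1 m2 m3 m4 m5 s1 s2 s3.
have [->|/eqP nxp] := eqVneq x p; first by left.
have [->|/eqP nxq] := eqVneq x q; first by right.
have {m1 m2 npq} h : (p = y /\ q = z) \/ (p = z /\ q = y).
  clear m3 m4 m5 s1 s2 s3 nst nxy nxz.
  by case: m1 => [|[|[|]]] e1; case: m2 => [|[|[|]]] e2; subst; (tauto || congruence).
have m6 : s = y \/ s = z \/ t = y \/ t = z.
  by move: h m5 => [[-> ->]|[-> ->]]; clear; tauto.
have [h'|[h'|h']] := triangle_meet nxy nxz nyz m3 m4 m6; [by case: s1|by case: s2|].
by case: s3; move: h h' => [[-> ->]|[-> ->]] [[-> ->]|[-> ->]]; clear; tauto.
Qed.

Lemma fresh (s : seq 'I_7) : (size s < 7)%N -> exists k, k \notin s.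
Proof.
move=> hs; case: (pickP (fun k => k \notin s)) => [k hk|h]; first by exists k.
have : (size (enum 'I_7) <= size s)%N.
  by apply: uniq_leq_size (enum_uniq _) _ => k _; move/negbFE: (h k).
by rewrite size_enum_ord leqNgt hs.
Qed.

Section Relabelling.
Variable F : closedFieldType.
Hypothesis charF : 5%N \in [pchar F].
Variable r : F.
Hypothesis r2 : r ^+ 2 = 2%:R.
Local Notation conic_block := (conic_block r).
Local Notation comp0 := (comp0 r).
Variable theta : {set 'I_7} -> set (proj_point F).
Hypothesis theta_in : forall e, T7_vertices e -> comp0 (theta e).
Hypothesis theta_inj : forall e e', T7_vertices e -> T7_vertices e' -> theta e = theta e' -> e = e'.
Hypothesis theta_adj : forall e e', T7_vertices e -> T7_vertices e' ->
  (T7_adj e e' <-> G_adj (theta e) (theta e')).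
Local Notation pair a b := ([set a; b]%SET).

Lemma vertex_pair (a b : 'I_7) : a != b -> T7_vertices (pair a b).
Proof. by move=> nab; rewrite /T7_vertices /= cards2 nab. Qed.

Definition meet (p q s t : nat) := s = p \/ s = q \/ t = p \/ t = q.
Definition same (p q s t : nat) := (s = p /\ t = q) \/ (s = q /\ t = p).

Lemma block_adjacent (p q s t : 'I_7) : p != q -> s != t ->
  G_adj (conic_block p q) (conic_block s t) <-> meet p q s t /\ ~ same p q s t.
Proof.
move=> npq nst; split=> [h|[m n]].
  split.
    have [c [d [c7 d7 ncd e]]] := adjacent_comp0 charF r2 (ltn_ord p) (ltn_ord q) npq h.
    have := conic_block_eq charF r2 (ltn_ord s) (ltn_ord t) c7 d7 nst ncd e.
    by case=> [[-> ->]|[-> ->]] /or4P [] /eqP ->; rewrite /meet; tauto.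
  move=> n; have [_ _ ne _] := h; case: ne.
  by case: n => [[-> ->]|[-> ->]]; [exact: erefl|exact: conic_blockC].
have adj (a b c : 'I_7) : a != b -> a != c -> b != c -> G_adj (conic_block a b) (conic_block a c).
  by move=> nab nac nbc; apply: (adjacent_blocks charF r2) => //; exact: ltn_ord.
have neq (a b : 'I_7) : a <> b :> nat -> a != b by move=> h; apply/eqP => e; apply: h; rewrite e.
case: m => [|[|[|]]] /ord_inj e; subst.
- by apply: adj => //; apply: neq => e; apply: n; left.
- by rewrite conic_blockC; apply: adj => //; [rewrite eq_sym|apply: neq => e; apply: n; right].
- by rewrite [X in G_adj _ X]conic_blockC; apply: adj; rewrite // 1?eq_sym //; apply: neq => e; apply: n; right.
rewrite conic_blockC [X in G_adj _ X]conic_blockC; apply: adj; rewrite // 1?eq_sym //.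
by apply: neq => e; apply: n; left.
Qed.

Lemma labels : exists f : 'I_7 * 'I_7 -> 'I_7 * 'I_7, forall a b, a != b ->
  (f (a, b)).1 != (f (a, b)).2 /\ theta (pair a b) = conic_block (f (a, b)).1 (f (a, b)).2.
Proof.
have /boolp.choice [f hf] : forall ab : 'I_7 * 'I_7, exists xy : 'I_7 * 'I_7, ab.1 != ab.2 ->
    xy.1 != xy.2 /\ theta (pair ab.1 ab.2) = conic_block xy.1 xy.2.
  move=> [a b]; have [->|nab] := eqVneq a b; first by exists (b, b); rewrite eqxx.
  have [x [y [x7 y7 nxy e]]] := comp0P (theta_in (vertex_pair nab)).
  by exists (Ordinal x7, Ordinal y7) => _; split.
by exists f => a b nab; exact: hf (a, b) nab.
Qed.

(** The six pairs through one label form a clique too large to be a triangle, so they are sent to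
    pairs through a common label; this defines sigma. *)
Lemma relabelling : exists sigma : 'S_7, forall a b : 'I_7, a != b ->
  theta (pair a b) = conic_block (sigma a) (sigma b).
Proof.
have [f hf] := labels.
pose p a b := (f (a, b)).1; pose q a b := (f (a, b)).2.
have npq a b : a != b -> p a b != q a b by move=> /hf [].
have e_theta a b : a != b -> theta (pair a b) = conic_block (p a b) (q a b) by move=> /hf [].
have adjE a b c d : a != b -> c != d ->
    T7_adj (pair a b) (pair c d) <-> meet (p a b) (q a b) (p c d) (q c d) /\ ~ same (p a b) (q a b) (p c d) (q c d).
  move=> nab ncd; rewrite theta_adj; [|exact: vertex_pair|exact: vertex_pair].
  rewrite (e_theta a b nab) (e_theta c d ncd); exact: block_adjacent (npq a b nab) (npq c d ncd).
have sameE a b c d : a != b -> c != d -> same (p a b) (q a b) (p c d) (q c d) -> pair a b = pair c d.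
  move=> nab ncd h; apply: theta_inj; [exact: vertex_pair|exact: vertex_pair|].
  rewrite (e_theta a b nab) (e_theta c d ncd); case: h => [[/ord_inj -> /ord_inj ->]|[/ord_inj -> /ord_inj ->]].
    exact: erefl.
  exact: conic_blockC.
have star_meet a b c : a != b -> a != c -> b != c ->
    meet (p a b) (q a b) (p a c) (q a c) /\ ~ same (p a b) (q a b) (p a c) (q a c).
  move=> nab nac nbc; apply/(adjE _ _ _ _ nab nac); split.
  - exact: vertex_pair.
  - exact: vertex_pair.
  - move/setP => /(_ b); rewrite !inE eqxx orbT => /esym/orP [] /eqP e.
      by rewrite e eqxx in nab.
    by rewrite e eqxx in nbc.
  by apply/set0Pn; exists a; rewrite !inE eqxx.
have neq (a b : 'I_7) : a != b -> a <> b :> nat by move=> /eqP n /ord_inj.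
have star a : exists x : 'I_7, forall b, a != b -> x = p a b \/ x = q a b.
  have [b1] := @fresh [:: a] isT; rewrite inE eq_sym => n1.
  have [b2] := @fresh [:: a; b1] isT; rewrite !inE !negb_or ![b2 == _]eq_sym => /andP [n2 n12].
  have [m12 s12] := star_meet a b1 b2 n1 n2 n12.
  (* Here x is the label common to the images of {a, b1} and {a, b2}, and y, z are the other two. A
     label k outside a, b1, b2, b supplies the edge {a, k} that rules out a triangle. *)
  have key (x y z : 'I_7) : ((x = p a b1 /\ y = q a b1) \/ (x = q a b1 /\ y = p a b1)) ->
     ((x = p a b2 /\ z = q a b2) \/ (x = q a b2 /\ z = p a b2)) ->
     forall b, a != b -> x = p a b \/ x = q a b.
    move=> h1 h2 b nb.
    have [e1|nb1] := eqVneq b b1; first by rewrite e1; case: h1 => [[-> _]|[-> _]]; [left|right].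
    have [e2|nb2] := eqVneq b b2; first by rewrite e2; case: h2 => [[-> _]|[-> _]]; [left|right].
    have [k] := @fresh [:: a; b1; b2; b] isT; rewrite !inE !negb_or => /and4P [ka k1 k2 kb].
    rewrite eq_sym in ka; rewrite eq_sym in nb1; rewrite eq_sym in nb2; rewrite eq_sym in k1.
    rewrite eq_sym in k2; rewrite eq_sym in kb.
    have [m1 s1] := star_meet a b1 b n1 nb nb1; have [m2 s2] := star_meet a b2 b n2 nb nb2.
    have [m3 s3] := star_meet a b1 k n1 ka k1; have [m4 s4] := star_meet a b2 k n2 ka k2.
    have [m5 s5] := star_meet a b k nb ka kb.
    have o1 := neq _ _ (npq a b1 n1); have o2 := neq _ _ (npq a b2 n2).
    have o3 := neq _ _ (npq a b nb); have o4 := neq _ _ (npq a k ka).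
    have hx : x <> y :> nat by case: h1 => [[-> ->]|[-> ->]] // e; apply: o1; rewrite e.
    have hz : x <> z :> nat by case: h2 => [[-> ->]|[-> ->]] // e; apply: o2; rewrite e.
    have hyz : y <> z :> nat.
      move=> /ord_inj e; apply: s12; rewrite /same.
      by case: h1 => [[e1 e2]|[e1 e2]]; case: h2 => [[e3 e4]|[e3 e4]];
        rewrite -e1 -e2 -e3 -e4 e; tauto.
    suff : x = p a b :> nat \/ x = q a b :> nat by case=> /ord_inj; [left|right].
    apply: (@third_in_star x y z (p a b) (q a b) (p a k) (q a k)) => //.
    - by move: m1; rewrite /meet; case: h1 => [[-> ->]|[-> ->]]; tauto.
    - by move: m2; rewrite /meet; case: h2 => [[-> ->]|[-> ->]]; tauto.
    - by move: m3; rewrite /meet; case: h1 => [[-> ->]|[-> ->]]; tauto.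
    - by move: m4; rewrite /meet; case: h2 => [[-> ->]|[-> ->]]; tauto.
    - by move: s3; rewrite /same; case: h1 => [[-> ->]|[-> ->]]; tauto.
    by move: s4; rewrite /same; case: h2 => [[-> ->]|[-> ->]]; tauto.
  case: m12 => [|[|[|]]] /ord_inj e.
  - by exists (p a b1); apply: (key _ (q a b1) (q a b2)); [left|left; rewrite e].
  - by exists (q a b1); apply: (key _ (p a b1) (q a b2)); [right|left; rewrite e].
  - by exists (p a b1); apply: (key _ (q a b1) (p a b2)); [left|right; rewrite e].
  by exists (q a b1); apply: (key _ (p a b1) (p a b2)); [right|right; rewrite e].
have [s hs] := boolp.choice star.
(* If s a = s b, the images of the disjoint pairs {a, c} and {b, d} share a label and would be
   adjacent. *)
have s_inj : injective s.
  move=> a b e; apply/eqP/negPn/negP => nab.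
  have [c] := @fresh [:: a; b] isT; rewrite !inE !negb_or => /andP [ca cb].
  have [d] := @fresh [:: a; b; c] isT; rewrite !inE !negb_or => /and3P [da db dc].
  have nac : a != c by rewrite eq_sym.
  have nbd : b != d by rewrite eq_sym.
  have hne : ~ same (p a c) (q a c) (p b d) (q b d).
    move/(sameE _ _ _ _ nac nbd)/setP => /(_ a); rewrite !inE eqxx (negPf nab) /= eq_sym.
    by rewrite (negPf da).
  have hm : meet (p a c) (q a c) (p b d) (q b d).
    rewrite /meet; have := hs a c nac; have := hs b d nbd; rewrite e.
    by case=> <- []  <-; tauto.
  have [_ _ _] := (adjE _ _ _ _ nac nbd).2 (conj hm hne).
  case/set0Pn => k; rewrite !inE => /andP [/orP [] /eqP -> /orP [] /eqP e'].
  - by rewrite e' eqxx in nab.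
  - by rewrite e' eqxx in da.
  - by rewrite e' eqxx in cb.
  by rewrite e' eqxx in dc.
exists (perm s_inj) => a b nab; rewrite !permE (e_theta a b nab).
have nba : b != a by rewrite eq_sym.
have e : conic_block (p a b) (q a b) = conic_block (p b a) (q b a).
  by rewrite -(e_theta a b nab) -(e_theta b a nba) finset.setUC.
have ns : s a != s b by apply: contraNneq nab => /s_inj ->.
have h := conic_block_eq charF r2 (ltn_ord _) (ltn_ord _) (ltn_ord _) (ltn_ord _) (npq _ _ nab) (npq _ _ nba) e.
have : (s a = p a b /\ s b = q a b) \/ (s a = q a b /\ s b = p a b).
  have := hs a b nab; have := hs b a nba; move/eqP: ns.
  by case: h => [[/ord_inj -> /ord_inj ->]|[/ord_inj -> /ord_inj ->]]; intuition congruence.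
by case=> [[-> ->]|[-> ->]]; [exact: erefl|exact: conic_blockC].
Qed.

End Relabelling.

(** * Stabilizers *)

Section Projectivities.
Variable F : closedFieldType.
Implicit Types g : proj_point F -> proj_point F.

Lemma projectivity_inj g : projectivity g -> injective g.
Proof.
move=> [h h0 hg] P Q /(congr1 val); rewrite !hg => /eqP.
by rewrite eq_limg_ker0 // => /eqP /val_inj.
Qed.

Lemma projectivity_comp g g' : projectivity g -> projectivity g' -> projectivity (g \o g').
Proof.
move=> [h h0 hg] [h' h0' hg']; exists (h \o h')%VF; last by move=> P /=; rewrite hg hg' limg_comp.
by apply/lker0P => u v; rewrite !comp_lfunE => /(lker0P h0)/(lker0P h0').
Qed.

Lemma Aut_Gamma_comp g g' : Aut_Gamma g -> Aut_Gamma g' -> Aut_Gamma (g \o g').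
Proof.
by move=> [pg eg] [pg' eg']; split; [exact: projectivity_comp|rewrite -image_comp eg' eg].
Qed.

Lemma Aut_Gamma_meet g (X Y : set (proj_point F)) n : Aut_Gamma g ->
  has_card (g @` X `&` g @` Y `&` (@Gamma F)) n <-> has_card (X `&` Y `&` (@Gamma F)) n.
Proof.
move=> [/projectivity_inj ig eg]; rewrite -{1}eg -!image_injI //.
exact: has_card_inj_image.
Qed.
End Projectivities.

Section Stabilizers.
Variable F : closedFieldType.
Hypothesis charF : 5%N \in [pchar F].
Variable r : F.
Hypothesis r2 : r ^+ 2 = 2%:R.
Local Notation wordM := (wordM r).
Local Notation conic_block := (conic_block r).
Local Notation comp0 := (comp0 r).
Local Notation coset_comp := (coset_comp r).
Local Notation unitary := (unitary charF).
Implicit Types (X Y : set (proj_point F)) (D : set (set (proj_point F))) (g : proj_point F -> proj_point F).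

Let word_unitary w : unitary (wordM w) := wordM_unitary charF r2 w.

Definition conj_by (B : 'M[F]_3) g := act B \o g \o act (invmx B).

Lemma stab_act B D : unitary B -> mvfam B D = D -> stab D (act B).
Proof. by move=> hB e; split; [exact: act_Aut_Gamma|exact: e]. Qed.

Lemma conj_by_mv B g X : unitary B -> conj_by B g @` (mv B X) = mv B (g @` X).
Proof.
move=> hB; have K := actK (unitary_unit hB).
rewrite predeqE => P; split=> [[_ [Q XQ <-] <-]|[_ [Q XQ <-] <-]].
  by exists (g Q); [exists Q|rewrite /conj_by /= K].
by exists (act B Q); [exists Q|rewrite /conj_by /= K].
Qed.

Lemma stab_mv B D g : unitary B -> stab D g -> stab (mvfam B D) (conj_by B g).
Proof.
move=> hB [ag eg]; split.
  apply: Aut_Gamma_comp; last exact/act_Aut_Gamma/unitaryV.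
  by apply: Aut_Gamma_comp => //; apply: act_Aut_Gamma.
rewrite predeqE => X; split=> [[_ [Y DY <-] <-]|[Y DY <-]].
  by rewrite conj_by_mv //; apply/(mvfam_mem _ _ hB); rewrite -eg; exists Y.
rewrite -eg in DY; case: DY => Z DZ <-.
by exists (mv B Z); [apply/(mvfam_mem _ _ hB)|rewrite conj_by_mv].
Qed.

Definition labelled (t : 'S_7) g := forall a b : 'I_7, a != b ->
  g @` conic_block a b = conic_block (t a) (t b).

Definition both_stab D (t : 'S_7) := exists2 g, (stab comp0 `&` stab D) g & labelled t g.

Lemma labelled_word w : all (mem stab_gens) w -> labelled (word_perm w) (act (wordM w)).
Proof. by move=> hw a b nab; rewrite !word_permE; apply: (mv_word_block charF r2 hw). Qed.

(** Equivariance of the joint stabilizer: replacing a neighbour by its image under a stabilizer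
    element conjugates the group of label permutations, so one representative per orbit suffices. *)
Lemma both_stab_conj B s D t : unitary B -> mvfam B comp0 = comp0 -> labelled s (act B) ->
  both_stab D t -> both_stab (mvfam B D) (t ^ s)%g.
Proof.
move=> hB e0 e [g [h1 h2] hg]; exists (conj_by B g).
  by split; [rewrite -{1}e0; apply: stab_mv|apply: stab_mv].
move=> a b nab; move: nab; rewrite -[a](permKV s) -[b](permKV s).
move: ((s^-1)%g a) ((s^-1)%g b) => a' b'; rewrite (inj_eq (@perm_inj _ s)) => nab.
have nt : t a' != t b' by apply: contraNneq nab => /perm_inj ->.
rewrite -(e a' b' nab) -/(mv _ _) conj_by_mv // (hg a' b' nab).
by rewrite /mv (e _ _ nt) !permJ.
Qed.

Lemma both_stab_word w D t : all (mem stab_gens) w ->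
  both_stab (mvfam (wordM w) D) t <-> both_stab D (t ^ (word_perm w)^-1)%g.
Proof.
move=> hw; have hB := word_unitary w; have e0 := stab_word_comp0 charF r2 hw.
have e := labelled_word hw; split=> h; last by have := both_stab_conj hB e0 e h; rewrite conjgKV.
rewrite -[D](mvfamK hB); apply: both_stab_conj h; first exact: unitaryV.
  by rewrite -{1}e0 mvfamK.
move=> a b; rewrite -[a](permKV (word_perm w)) -[b](permKV (word_perm w)).
move: ((word_perm w)^-1%g a) ((word_perm w)^-1%g b) => a' b'.
rewrite (inj_eq (@perm_inj _ _)) !permK => nab; rewrite -(e a' b' nab).
exact: (mvK hB).
Qed.

(** The geometric counterpart of [linked_pairs], expressed through intersections with the curve so
    that projectivities preserving Gamma respect it. *)
Definition link i X X' := exists2 Y, coset_comp i Y &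
  has_card (X `&` Y `&` (@Gamma F)) 1 /\ has_card (X' `&` Y `&` (@Gamma F)) 2.

Lemma linked_pairsP i p q : p \in pairs -> q \in pairs ->
  q \in linked_pairs i p <-> link i (conic_block p.1 p.2) (conic_block q.1 q.2).
Proof.
move=> hp hq; have hm s y m : s \in pairs -> y \in pairs ->
    has_card (conic_block s.1 s.2 `&` coset_conic r i y `&` (@Gamma F)) m <->
    meet_number (block s.1 s.2) (coset_block i y) = m.
  by move=> hs hy; apply: (hascode_meet charF r2) (hascode_pair charF r2 hs) (hascode_coset charF r2 i hy).
rewrite mem_filter hq andbT someE; split=> [/hasP [y]|[Y /coset_compP [y hy ->] [/(hm _ _ _ hp hy) h1 /(hm _ _ _ hq hy) h2]]].
  rewrite mem_filter => /andP [/eqP/hm h1 hy] /eqP/hm h2; exists (coset_conic r i y).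
    by apply/coset_compP; exact: (ex_intro2 _ _ y hy erefl).
  exact: (conj (h1 hp hy) (h2 hq hy)).
by apply/hasP; exists y; [rewrite mem_filter hy h1 eqxx|rewrite h2].
Qed.

Lemma link_reflect i g X X' : stab (coset_comp i) g -> link i (g @` X) (g @` X') -> link i X X'.
Proof.
move=> [ag eg] [Y]; rewrite -eg => -[Z hZ <-] [/(Aut_Gamma_meet _ _ _ ag) h1 /(Aut_Gamma_meet _ _ _ ag) h2].
by exists Z.
Qed.

Section Plane.
Variables (i : nat) (gs : seq gen) (T : nat -> nat -> nat) (ws : seq word).
Hypotheses (ok : plane_ok i gs T ws) (hi : (i < 150)%N).

Lemma thirdP (a b c : 'I_7) : a != b -> T a b = c <->
  [/\ c != a, c != b & forall d e : 'I_7, d != e ->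
    link i (conic_block a b) (conic_block d e) -> c != d /\ c != e].
Proof.
have key (a' b' : 'I_7) : (a' < b')%N -> T a' b' = T b' a' /\ (T a' b' = c <->
  [/\ c != a', c != b' & forall d e : 'I_7, d != e ->
    link i (conic_block a' b') (conic_block d e) -> c != d /\ c != e]).
  move=> ab; have hp := mem_pairs ab (ltn_ord b').
  have /and5P [_ _ _ _ /andP [_ /allP /(_ _ hp) /allP /(_ c)]] := ok.
  rewrite iota7 => /(_ (ltn_ord c)) /andP [/eqP e /eqP sym]; split=> //.
  transitivity ((c : nat) == T (a', b').1 (a', b').2); first by rewrite eq_sym; split=> /eqP.
  rewrite e; split=> [/and3P [n1 n2 /allP h]|[n1 n2 h]]; last first.
    apply/and3P; split=> //; apply/allP => q hq'.
    have hq : q \in pairs by move: hq'; rewrite mem_filter => /andP [].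
    have [q1 q2 q3] := pairsP hq; move/(linked_pairsP i hp hq): hq'.
    have nq : Ordinal q1 != Ordinal q2 by rewrite -val_eqE /= neq_ltn q3.
    by move=> hl; have [h1 h2] := h _ _ nq hl; apply/andP; split.
  split=> // d f; rewrite -val_eqE neq_ltn => /orP [] df hl.
    have hq := mem_pairs df (ltn_ord f).
    by have /andP [] := h _ ((linked_pairsP i hp hq).2 hl).
  rewrite [X in link i _ X]conic_blockC in hl; have hq := mem_pairs df (ltn_ord d).
  by have /andP [] := h _ ((linked_pairsP i hp hq).2 hl).
move=> nab; have : (a < b)%N || (b < a)%N by rewrite -neq_ltn.
case/orP => ab; first by case: (key a b ab) => _ h; exact: h.
case: (key b a ab) => sym h; rewrite -sym h conic_blockC.
by split=> [[n1 n2 hl]|[n1 n2 hl]]; exact: And3 n2 n1 hl.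
Qed.

(** A joint stabilizer element preserves [link], from which [thirdP] recovers the third points,
    hence acts by a collineation. Conversely a collineation is a word in [gs], and such words fix
    both components. *)
Lemma plane_stab t : both_stab (coset_comp i) t <-> preserves T t.
Proof.
split=> [[g [_ hg] lg] a b c nab /(thirdP _ nab) [na nb hc]|/(plane_generated ok) [w hw ->]].
  have tn (x y : 'I_7) : x != y -> t x != t y by apply: contraNneq => /perm_inj ->.
  apply/(thirdP _ (tn _ _ nab)); split; [exact: tn|exact: tn|move=> d e].
  rewrite -[d](permKV t) -[e](permKV t); move: ((t^-1)%g d) ((t^-1)%g e) => d' e' nde.
  have nde' : d' != e' by apply: contraNneq nde => ->.
  rewrite -(lg _ _ nab) -(lg _ _ nde') => /(link_reflect hg) /(hc _ _ nde') [h1 h2].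
  by split; apply: tn.
have hw' := plane_stab_word ok hw; exists (act (wordM w)); last exact: labelled_word.
split; apply: stab_act => //; first exact: (stab_word_comp0 charF r2 hw').
by have [_ ->] := coset_word charF r2 w hi; rewrite (plane_fixed ok hw).
Qed.
End Plane.

End Stabilizers.

Section Neighbours.
Variable F : closedFieldType.
Hypothesis charF : 5%N \in [pchar F].
Variable r : F.
Hypothesis r2 : r ^+ 2 = 2%:R.
Local Notation wordM := (wordM r).
Local Notation conic_block := (conic_block r).
Local Notation comp0 := (comp0 r).
Local Notation coset_comp := (coset_comp r).
Local Notation both_stab := (both_stab r).
Local Notation unitary := (unitary charF).
Local Notation pair a b := ([set a; b]%SET).
Implicit Types (D : set (set (proj_point F))) (C : set (set (set (proj_point F)))).

(** Coset 67, of class 1, carries the plane [third]; coset 125, of class 2, carries [third'], which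
    is conjugate to it by the odd [tau]. Passing to another member of the orbit conjugates by an
    even permutation, so the class fixes the parity of a. *)
Lemma neighbour_group i : (i < 150)%N -> calN comp0 (coset_comp i) ->
  exists2 a : 'S_7, odd_perm a = (coset_class i == 2%N) & (coset_class i == 1%N) || (coset_class i == 2%N) /\
    forall t, both_stab (coset_comp i) t <-> t \in (Sigma_b :^ a)%g.
Proof.
move=> hi /(calN_coset charF r2 hi) [k [w [hk hw k150 ek]]].
have [_ eD] := coset_word charF r2 w k150; rewrite ek in eD.
have es := word_perm_even hw.
have bs t := both_stab_word charF r2 (coset_comp k) t hw.
move: hk; rewrite !inE => /orP [] /eqP [ek' ->]; rewrite ek' in bs eD k150.
  exists (word_perm w); first by rewrite (negPf es).
  split=> // t; rewrite -eD bs (plane_stab charF r2 plane_j k150) -Sigma_bP.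
  by rewrite mem_conjg.
exists (tau * word_perm w)%g.
  by rewrite odd_permM (negPf es) odd_tperm -val_eqE /= !inordK.
split=> // t; rewrite -eD bs (plane_stab charF r2 plane_k k150) -Sigma_b'P Sigma_b'E.
by rewrite -mem_conjg -conjsgM.
Qed.

Lemma vertexP (e : {set 'I_7}) : T7_vertices e <-> exists a b, a != b /\ e = pair a b.
Proof.
split=> [/cards2P [a [b [nab ->]]]|[a [b [nab ->]]]]; first by exists a, b.
exact: vertex_pair.
Qed.

Lemma perm_pair (s : 'S_7) a b : s @: pair a b = pair (s a) (s b).
Proof. by rewrite imsetU !imset_set1. Qed.

Lemma perm_imageE B D (theta : {set 'I_7} -> set (proj_point F)) (sigma : 'S_7) s : unitary B ->
  (forall a b : 'I_7, a != b -> theta (pair a b) = mv B (conic_block (sigma a) (sigma b))) ->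
  s \in perm_image theta (stab (mvfam B comp0) `&` stab (mvfam B D)) <-> both_stab D (s ^ sigma)%g.
Proof.
move=> hB ht; rewrite inE; split=> [/asboolP [g [h1 h2] hg]|[g [h1 h2] hg]].
  exists (conj_by (invmx B) g).
    by split; [rewrite -[comp0](mvfamK hB)|rewrite -[D](mvfamK hB)]; apply: stab_mv (unitaryV hB) _.
  move=> a b; rewrite -[a](permKV sigma) -[b](permKV sigma).
  move: (sigma^-1%g a) (sigma^-1%g b) => a' b'; rewrite (inj_eq (@perm_inj _ _)) => nab.
  rewrite !permJ; apply: (mv_inj hB); have nsab : s a' != s b' by apply: contraNneq nab => /perm_inj ->.
  rewrite -(ht _ _ nsab) -perm_pair -(hg _ (vertex_pair nab)) (ht _ _ nab).
  by rewrite -{1}[conic_block _ _](mvK hB) (conj_by_mv _ _ (unitaryV hB)) (mvKV hB).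
apply/asboolP; exists (conj_by B g); first by split; apply: stab_mv.
move=> e /vertexP [a [b [nab ->]]].
have nsab : s a != s b by apply: contraNneq nab => /perm_inj ->.
have nt : sigma a != sigma b by apply: contraNneq nab => /perm_inj ->.
by rewrite perm_pair (ht _ _ nab) (ht _ _ nsab) (conj_by_mv _ _ hB) (hg _ _ nt) !permJ.
Qed.

Lemma T7_relabelling B theta : unitary B -> T7_isomorphism (mvfam B comp0) theta ->
  exists sigma : 'S_7, forall a b : 'I_7, a != b ->
    theta (pair a b) = mv B (conic_block (sigma a) (sigma b)).
Proof.
move=> hB [[fun_t inj_t _] adj_t]; have hV := unitaryV hB.
have [sigma hs] : exists sigma : 'S_7, forall a b : 'I_7, a != b ->
    mv (invmx B) (theta (pair a b)) = conic_block (sigma a) (sigma b).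
  apply: (@relabelling _ charF r r2 (fun e => mv (invmx B) (theta e))).
  - move=> e /fun_t; rewrite -{2}[comp0](mvfamK hB) => he; exact: (ex_intro2 _ _ _ he erefl).
  - move=> e e' he he' /(mv_inj hV); apply: inj_t; exact/mem_set.
  by move=> e e' he he'; rewrite (adj_t e e' he he'); split=> /(G_adj_mv _ _ hV).
by exists sigma => a b nab; rewrite -(hs a b nab) (mvKV hB).
Qed.

Lemma component_class C : H_components C ->
  exists2 c, (c < 3)%N & forall i, (i < 150)%N -> C (coset_comp i) <-> coset_class i = c.
Proof.
move=> hC; have [D CD] := component_inhabited hC.
have [j hj eD] := calDP charF r2 (component_vertex hC CD); rewrite eD in CD.
exists (coset_class j); first exact: class_lt.
by move=> i hi; rewrite (component_eq hC CD); apply: linked_class.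
Qed.

Lemma component_class_inj C C' c : H_components C -> H_components C' ->
  (forall i, (i < 150)%N -> C (coset_comp i) <-> coset_class i = c) ->
  (forall i, (i < 150)%N -> C' (coset_comp i) <-> coset_class i = c) -> C = C'.
Proof.
move=> hC hC' h h'; have [D CD] := component_inhabited hC.
have [j hj eD] := calDP charF r2 (component_vertex hC CD); rewrite eD in CD.
by apply: (component_meet hC hC' CD); apply/(h' j hj)/(h j hj).
Qed.

End Neighbours.

Lemma sqrt2 (F : closedFieldType) : exists r : F, r ^+ 2 = 2%:R.
Proof.
have [r hr] := @solve_monicpoly F 2 (fun i => if i == 0%N then 2%:R else 0) isT.
by exists r; rewrite hr big_ord_recl big_ord1 /= expr0 mulr1 mul0r addr0.
Qed.

Theorem proposition1p17 (F : closedFieldType) (charF : 5%N \in [pchar F])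
    (D : set (set (proj_point F))) (hD : calD D)
    (Ci Cj Ck : set (set (set (proj_point F))))
    (hCi : H_components Ci) (hCj : H_components Cj)
    (hCk : H_components Ck)
    (hij : Ci <> Cj) (hik : Ci <> Ck) (hjk : Cj <> Ck) (hDCi : Ci D)
    (theta : {set 'I_7} -> set (proj_point F))
    (htheta : T7_isomorphism D theta) :
  let characterizes (X Y : set (set (set (proj_point F)))) :=
    forall D', calN D D' ->
      ((calN D `&` X) D' <->
         conj_in_Alt7 (perm_image theta (stab D `&` stab D')) Sigma_b) /\
      ((calN D `&` Y) D' <->
         conj_in_Alt7 (perm_image theta (stab D `&` stab D')) Sigma_b') in
  [/\ calN D = (calN D `&` Cj) `|` (calN D `&` Ck),
      (calN D `&` Cj) `&` (calN D `&` Ck) = set0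
    & characterizes Cj Ck \/ characterizes Ck Cj].
Proof.
have [r r2] := sqrt2 F.
have [i0 hi0 eD] := calDP charF r2 hD.
have hB := wordM_unitary charF r2 (coset i0).
have [sigma hs] : exists sigma : 'S_7, forall a b : 'I_7, a != b ->
    theta [set a; b]%SET = mv (wordM r (coset i0)) (conic_block r (sigma a) (sigma b)).
  by rewrite eD in htheta; exact: (T7_relabelling r2 hB htheta).
(* The boolean b tells whether the class of D' exceeds that of D by 1 or by 2 modulo 3. *)
have core D' : calN D D' -> exists i b, [/\ (i < 150)%N, D' = coset_comp r i,
    coset_class i = (((if b then 1 else 2) + coset_class i0) %% 3)%N,
    conj_in_Alt7 (perm_image theta (stab D `&` stab D')) Sigma_b <-> b != odd_perm sigma &
    conj_in_Alt7 (perm_image theta (stab D `&` stab D')) Sigma_b' <-> b == odd_perm sigma].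
  move=> hN; have [i hi eD'] := calDP charF r2 (let: And3 h _ _ := hN in h).
  have [hk ek ck] := coset_relative charF r2 hi hi0.
  have /(neighbour_group charF r2 hk) [a oa [hc hg]] : calN (comp0 r) (coset_comp r (relative i0 i)).
    by apply/(calN_mv _ _ hB); rewrite ek -eD'; rewrite eD in hN.
  exists i, (coset_class (relative i0 i) == 1%N).
  (* Moving D back to the base component yields the group of [neighbour_group], and the labelling
     theta differs from the standard one by sigma; both enter only through the parity of a
     sigma^-1. *)
  have -> : perm_image theta (stab D `&` stab D') = (Sigma_b :^ (a * sigma^-1))%g.
    apply/setP => x; apply/idP/idP => h; move: h; rewrite conjsgM mem_conjgV.
      by rewrite {1}eD eD' -ek => /(perm_imageE _ _ hB hs)/hg.
    by move/hg => h; rewrite {1}eD eD' -ek; apply/(perm_imageE _ _ hB hs).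
  have [h1 h2] := conj_Sigma_b (a * sigma^-1)%g.
  split=> //.
  - by rewrite ck; congr ((_ + _) %% 3)%N; case/orP: hc => /eqP ->.
  - by rewrite h1 odd_permM odd_permV oa; case/orP: hc => /eqP ->; case: (odd_perm sigma).
  by rewrite h2 odd_permM odd_permV oa; case/orP: hc => /eqP ->; case: (odd_perm sigma).
have [ci ci3 hci] := component_class charF r2 hCi.
have [cj cj3 hcj] := component_class charF r2 hCj.
have [ck ck3 hck] := component_class charF r2 hCk.
have eci : coset_class i0 = ci by apply/hci; rewrite // -eD.
have nij : ci <> cj by move=> e; subst cj; apply: hij; apply: (component_class_inj charF r2 hCi hCj hci hcj).
have nik : ci <> ck by move=> e; subst ck; apply: hik; apply: (component_class_inj charF r2 hCi hCk hci hck).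
have njk : cj <> ck by move=> e; subst ck; apply: hjk; apply: (component_class_inj charF r2 hCj hCk hcj hck).
split.
- rewrite predeqE => D'; split=> [hN|[[]|[]] //].
  have [i [b [hi eD' cl _ _]]] := core D' hN; rewrite eci in cl.
  have : coset_class i = cj \/ coset_class i = ck.
    rewrite cl; move: ci cj ck ci3 cj3 ck3 nij nik njk {hci hcj hck eci cl} => ci cj ck.
    by case: b; move: ci cj ck => [|[|[|?]]] // [|[|[|?]]] // [|[|[|?]]] //= *; auto.
  by case=> e; [left|right]; split=> //; rewrite eD'; [apply/hcj|apply/hck].
- rewrite predeqE => D'; split=> // -[[_ h1] [_ h2]]; apply: hjk.
  exact: component_meet hCj hCk h1 h2.
have memN (X : set (set (set (proj_point F)))) D' : calN D D' -> (calN D `&` X) D' <-> X D'.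
  by move=> hN; split=> [[]|].
(* The classes of the two components of H other than that of D; b0 records which one is that of
   Cj. *)
pose m (b : bool) := (((if b then 1 else 2) + ci) %% 3)%N.
have [b0 ej ek] : exists2 b0, cj = m b0 & ck = m (~~ b0).
  move: ci cj ck ci3 cj3 ck3 nij nik njk {hci hcj hck eci} @m => ci cj ck.
  move: ci cj ck => [|[|[|?]]] // [|[|[|?]]] // [|[|[|?]]] // *;
    by [exists true|exists false].
have m_inj b b' : m b = m b' <-> b = b'.
  split=> [|-> //]; rewrite /m; move: ci ci3 {hci eci nij nik ej ek m}.
  by case: b; case: b' => // -[|[|[|?]]].
(* The group of D' is conjugate to [Sigma_b] when b differs from the parity of sigma, and D' is in
   Cj when b = b0; comparing b0 with the parity decides whether j and k are interchanged. *)
have [eb|nb] := eqVneq b0 (odd_perm sigma); [right|left] => D' hN;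
    have [i [b [hi eD' cl e1 e2]]] := core D' hN; rewrite eci -/(m b) in cl;
    rewrite !memN // e1 e2 eD' hcj // hck // cl ej ek !m_inj.
  rewrite -eb; split; first by case: (b) (b0) => -[].
  by split=> /eqP.
have -> : odd_perm sigma = ~~ b0 by move: nb; case: (odd_perm sigma) (b0) => -[].
by split; case: (b) (b0) => -[].
Qed.
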